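(* Let $(\alpha|\beta)\in\mathscr P^2(n)$ and let $\lambda,\mu$ be partitions with $|\lambda|+p|\mu|=n$. Then $$[M(p\alpha|p\beta):Y(p\lambda|p^2\mu)]\le[M(\alpha|\beta):Y(\lambda|p\mu)].$$ Moreover, if $\boldsymbol\delta_0=\varnothing$ for every $(\boldsymbol\gamma|\boldsymbol\delta)\in\Lambda((\alpha|\beta),\rho)$, where $\rho$ is the composition attached to $(\lambda|p\mu)$ below, then equality holds.
   Context: $F$ is a field of odd prime characteristic $p$; $\mathfrak S_n$ is the symmetric group on $\{1,\dots,n\}$. Compositions are finite sequences of non-negative integers with nonzero last entry ($\varnothing$ is the composition of $0$), partitions are non-increasing compositions, entries beyond the length are $0$; $q\alpha=(q\alpha_1,q\alpha_2,\dots)$ and $\alpha+\beta$ is the componentwise sum (padding with zeros). $\mathscr P^2(n)$ is the set of pairs $(\alpha|\beta)$ of partitions with $|\alpha|+|\beta|=n$. For a pair of compositions $(\alpha|\beta)$ with $|\alpha|+|\beta|=n$, $M(\alpha|\beta)=\mathrm{Ind}_{\mathfrak S_\alpha\times\mathfrak S_\beta}^{\mathfrak S_n}(F\boxtimes\mathrm{sgn})$, where $\mathfrak S_\alpha$ is the Young subgroup permuting $\{1,\dots,|\alpha|\}$ and acting trivially and $\mathfrak S_\beta$ is the Young subgroup of $\{|\alpha|+1,\dots,n\}$ acting by sign. $[M:N]$ is the multiplicity of the indecomposable $N$ in a Krull–Schmidt decomposition of $M$. Dominance: $(\lambda|\nu)\trianglerighteq(\alpha|\beta)$ iff for all $k\ge1$,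 $\sum_{i\le k}\lambda_i\ge\sum_{i\le k}\alpha_i$ and $|\lambda|+\sum_{i\le k}\nu_i\ge|\alpha|+\sum_{i\le k}\beta_i$. Signed Young modules: for partitions $\lambda,\mu$ with $|\lambda|+p|\mu|=n$, $Y(\lambda|p\mu)$ denotes the unique (up to isomorphism) indecomposable direct summand of $M(\lambda|p\mu)$ which is a direct summand of $M(\alpha|\beta)$, $(\alpha|\beta)\in\mathscr P^2(n)$, only if $(\lambda|p\mu)\trianglerighteq(\alpha|\beta)$ (this exists and occurs with multiplicity one in $M(\lambda|p\mu)$; every indecomposable summand of every $M(\alpha|\beta)$ is some $Y(\lambda|p\mu)$). $p$-adic expansion: $\lambda=\sum_{i\ge0}p^i\lambda(i)$ uniquely with each $\lambda(i)$ $p$-restricted (consecutive parts differ by less than $p$). Given $(\lambda|p\mu)$ with $p$-adic expansions $\lambda=\sum p^i\lambda(i)$, $\mu=\sum p^i\mu(i)$, set $n_0=|\lambda(0)|$, $n_i=|\lambda(i)|+|\mu(i-1)|$ for $i\ge1$, $r$ maximal with $n_r\ne0$, and $\rho=(1^{n_0},p^{n_1},\dots,(p^r)^{n_r})$ (the composition with $n_0$ parts $1$, then $n_1$ parts $p$, etc.). For $(\alpha|\beta)$ compositions and such a $\rho$, $\Lambda((\alpha|\beta),\rho)$ is the set of pairs of tuples of compositions $(\boldsymbol\gamma_0,\dots,\boldsymbol\gamma_r|\boldsymbol\delta_0,\dots,\boldsymbol\delta_r)$ with $\alpha=\sum_{i=0}^rp^i\boldsymbol\gamma_i$, $\beta=\sum_{i=0}^rp^i\boldsymbol\delta_i$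 and $|\boldsymbol\gamma_i|+|\boldsymbol\delta_i|=n_i$ for each $i$. *)

(* Defs.v *)
From HB Require Import structures.
From mathcomp Require Import all_boot all_order all_algebra all_fingroup.
From mathcomp Require Import mxrepresentation.
Set Implicit Arguments. Unset Strict Implicit. Unset Printing Implicit Defensive.
Import GRing.Theory.
Local Open Scope ring_scope.

Definition is_comp (s : seq nat) : bool := last 1%N s != 0%N.
Definition is_part (s : seq nat) : bool := sorted geq s && (0%N \notin s).
Definition scale (q : nat) (s : seq nat) : seq nat := [seq (q * x)%N | x <- s].

Definition dominates (l v a b : seq nat) : Prop :=
  forall k : nat, (1 <= k)%N ->
    (sumn (take k a) <= sumn (take k l))%N /\
    (sumn a + sumn (take k b) <= sumn l + sumn (take k v))%N.

(* the i-th p-adic digit lambda(i) of a partition lambda (possibly padded with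
   trailing zeros, which is irrelevant since only its size is used):
   lambda(i)_j = sum_{k >= j} digit_i(lambda_k - lambda_{k+1}) *)
Definition pdigit (p : nat) (l : seq nat) (i : nat) : seq nat :=
  [seq (\sum_(j <= k < size l) ((nth 0 l k - nth 0 l k.+1) %/ p ^ i %% p))%N
  | j <- iota 0 (size l)].

Definition nsz (p : nat) (lam mu : seq nat) (i : nat) : nat :=
  (sumn (pdigit p lam i) + (if i is i'.+1 then sumn (pdigit p mu i') else 0))%N.

(* r = maximal i with n_i <> 0 (all such i are <= n); 0 if there is none *)
Definition rmax (p n : nat) (lam mu : seq nat) : nat :=
  (\max_(i < n.+1 | nsz p lam mu i != 0%N) i)%N.

(* (g_0..g_r | d_0..d_r) in Lambda((a|b), rho) where rho is attached to (lam|p mu);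
   only the indices 0..r of g, d are relevant *)
Definition inLambda (p n : nat) (lam mu a b : seq nat) (g d : nat -> seq nat) : Prop :=
  let r := rmax p n lam mu in
  (forall i, (i <= r)%N ->
     [/\ is_comp (g i), is_comp (d i) & (sumn (g i) + sumn (d i))%N = nsz p lam mu i]) /\
  (forall j, nth 0%N a j = (\sum_(i < r.+1) p ^ i * nth 0 (g i) j)%N) /\
  (forall j, nth 0%N b j = (\sum_(i < r.+1) p ^ i * nth 0 (d i) j)%N).

Definition Sn (n : nat) : {group {perm 'I_n}} := [set: {perm 'I_n}]%G.
Definition Nn (n : nat) : nat := gcard (Sn n).

Section Modules.
Variable F : fieldType.

Definition rG (n : nat) : mx_representation F (Sn n) (Nn n) := regular_repr F (Sn n).

Definition blk (c : seq nat) (i : nat) : nat :=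
  count (fun k => sumn (take k.+1 c) <= i)%N (iota 0 (size c)).

Definition young (n : nat) (c : seq nat) : {set {perm 'I_n}} :=
  [set s : {perm 'I_n} | [forall i : 'I_n, blk c (s i) == blk c i]].

(* the character F (x) sgn on S_a x S_b: sign of the restriction of h
   to the positions >= |a| *)
Definition chi (n a : nat) (h : {perm 'I_n}) : F :=
  (-1) ^+ #|[set ij : 'I_n * 'I_n | [&& (a <= ij.1)%N, (ij.1 < ij.2)%N & (h ij.2 < h ij.1)%N]]|.

(* left translation on functions Sn -> F (row vectors): (f * L_h)(x) = f(h x) *)
Definition lreg_mx (n : nat) (h : {perm 'I_n}) : 'M[F]_(Nn n) :=
  \matrix_(i, j) ((i == gring_index (Sn n) (h * enum_val j)) %:R).

(* M(a|b) = Ind_{S_a x S_b}^{S_n}(F (x) sgn), realised as the submodule of the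
   (right) regular module of functions f with f(h x) = chi(h) f(x), h in S_a x S_b *)
Definition Mmod (n : nat) (a b : seq nat) : 'M[F]_(Nn n) :=
  (\bigcap_(h in young n (a ++ b)) kermx (lreg_mx h - (chi (sumn a) h)%:M))%MS.

Definition indecomp (n : nat) (U : 'M[F]_(Nn n)) : Prop :=
  [/\ mxmodule (rG n) U, U != 0 &
      forall V W : 'M[F]_(Nn n), mxmodule (rG n) V -> mxmodule (rG n) W ->
        mxdirect (V + W) -> (V + W == U)%MS -> V == 0 \/ W == 0].

Definition summand (n : nat) (U M : 'M[F]_(Nn n)) : Prop :=
  mxmodule (rG n) U /\
  exists W : 'M[F]_(Nn n), [/\ mxmodule (rG n) W, mxdirect (U + W) & (U + W == M)%MS].

Definition KS_decomp (n : nat) (M : 'M[F]_(Nn n)) (m : nat) (V : 'I_m -> 'M[F]_(Nn n)) : Prop :=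
  [/\ forall i, indecomp (V i), mxdirect (\sum_i V i) & (\sum_i V i == M)%MS].

Definition iso_count (n m : nat) (V : 'I_m -> 'M[F]_(Nn n)) (Y : 'M[F]_(Nn n)) (k : nat) : Prop :=
  exists S : {set 'I_m}, (forall i, i \in S <-> mx_iso (rG n) (V i) Y) /\ #|S| = k.

Definition isY (q n : nat) (lam mu : seq nat) (Y : 'M[F]_(Nn n)) : Prop :=
  [/\ indecomp Y, summand Y (Mmod n lam (scale q mu)) &
      forall a b : seq nat, is_part a -> is_part b -> (sumn a + sumn b)%N = n ->
        (exists U, summand U (Mmod n a b) /\ mx_iso (rG n) U Y) ->
        dominates lam (scale q mu) a b].

End Modules.

(* Main.v *)
(* M(a|b) is spanned by the words of content (a|b), the letters counted by b being odd, that is,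
   anticommuting, and homomorphisms are the kernels K(w, w') equivariant under S_n.  Every kernel is a
   sum of products of kernels through pointwise minima of words (a PBW decomposition), so that
   End M(lam|p mu) = F.1 + I, where I is spanned by the maps factoring through some M(v) not dominated
   by (lam|p mu).  Hence the projection Th onto F detects Y(lam|p mu), and [M(a|b) : Y(lam|p mu)] is the
   rank of the form (f, g) |-> Th(f g) on Hom(M(lam|p mu), M(a|b)) x Hom(M(a|b), M(lam|p mu)).

   Restriction of kernels to the words that are constant on prescribed blocks of p-power length is
   multiplicative (a Brauer quotient).  For blocks of length p it maps the maps between M(p lam|p^2 mu)
   and M(p a|p b) into those between M(lam|p mu) and M(a|b), with image the parity preserving ones, and
   transports the forms into each other.  This gives the inequality, and equality if |a| = |lam|, since
   then every map is parity preserving up to the radical of the form.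

   For the blocks of length p^i given by the columns of the p-adic digits of lam and mu, Th is James's
   functional "coefficient of the polytabloid".  If the form does not vanish, some word of content (a|b)
   constant on these blocks has the parity of the base word on all blocks of length > 1; it is an element
   of Lambda with |delta_0| = |lam| - |a|.  So the hypothesis forces |a| = |lam|. *)
Require Import Defs.
From HB Require Import structures.
From mathcomp Require Import all_boot all_order all_algebra all_fingroup.
From mathcomp Require Import all_solvable mxrepresentation.
From mathcomp Require Import zify ring.
Set Implicit Arguments. Unset Strict Implicit. Unset Printing Implicit Defensive.
Import GRing.Theory.
Local Open Scope ring_scope.

(** * The sign of a permutation acting on anticommuting letters *)

(** All modules live in one algebra: the alphabet has h even and L.+1 - h odd letters for every
    content in question, [one u] is the idempotent of the content of [u], and the kernels
    [cut u K u'] are Hom(M(u), M(u')). The even letters precede the odd ones, so the numbers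
    [cnt w k] of letters below k are the partial sums in the dominance order on pairs, and lowering
    a letter can only raise them.

    That p is odd enters twice. As 2 is invertible, an equivariant kernel vanishes at (w, w') if w
    and w' are each constant on two positions but differ in parity there; so parity can change only
    on blocks of length 1. As p-groups have odd order, their elements act without sign on the words
    they fix.

    James's functional makes [Th] explicit, so that its nonvanishing yields a concrete word. For (p
    lam|p^2 mu) the functional is [Th] composed with the Brauer map, so both multiplicities are
    measured by the same functional. They are compared by factoring an identity matrix through the
    dual bases of the other form. *)

Section SuperSign.
Variable F : fieldType.

Definition invs n (B : {set 'I_n}) (s : {perm 'I_n}) : {set 'I_n * 'I_n} :=
  [set ij | [&& ij.1 \in B, ij.2 \in B, (ij.1 < ij.2)%N & (s ij.2 < s ij.1)%N]].

(* The sign created when [s] moves anticommuting letters sitting at the positions in [B]; for [B] the last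
   positions and [s] in the Young subgroup it is the character [chi]. *)
Definition eps n (B : {set 'I_n}) (s : {perm 'I_n}) : F := (-1) ^+ #|invs B s|.

(** Each factor depends only on the unordered pair, so a permutation can be substituted in the
    product; the bare count of inversions does not allow this. *)
Lemma epsE n (B : {set 'I_n}) (s : {perm 'I_n}) :
  eps B s = \prod_(ij : 'I_n * 'I_n | (ij.1 < ij.2)%N)
    (if (ij.1 \in B) && (ij.2 \in B) then
       if (ij.1 < ij.2)%N == (s ij.1 < s ij.2)%N then 1 else -1 else 1).
Proof.
rewrite /eps -prodr_const big_mkcond [RHS]big_mkcond /=; apply: eq_bigr => -[i j] _.
rewrite inE /=; case: (i \in B) => /=; last by case: ifP.
case: (j \in B) => /=; last by case: ifP.
case: ltnP => //= ij.
have nij : s i != s j by rewrite (inj_eq perm_inj) -val_eqE /= ltn_eqF.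
by move: nij; rewrite -val_eqE /=; case: ltngtP.
Qed.

(** The pairs with i < j stand for the two-element sets. These are permuted by [s], and where it
    reverses the order the symmetry of [g] makes up for it. *)
Lemma prod_pairs_reindex n (g : 'I_n * 'I_n -> F) (s : {perm 'I_n}) :
    (forall i j, g (i, j) = g (j, i)) ->
  \prod_(ij : 'I_n * 'I_n | (ij.1 < ij.2)%N) g (s ij.1, s ij.2) =
  \prod_(ij : 'I_n * 'I_n | (ij.1 < ij.2)%N) g ij.
Proof.
move=> gC; pose h (t : {perm 'I_n}) (ij : 'I_n * 'I_n) := (t ij.1, t ij.2).
have hK t : cancel (h t) (h t^-1%g) by move=> [i j]; rewrite /h /= !permK.
have hVK t : cancel (h t^-1%g) (h t) by move=> [i j]; rewrite /h /= !permKV.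
rewrite (reindex (h s^-1%g)) /=; last by exists (h s) => x _; [exact: hVK|exact: hK].
rewrite (eq_bigr g) => [|[i j] _]; last by rewrite !permKV.
rewrite (bigID (fun ij : 'I_n * 'I_n => (ij.1 < ij.2)%N)) /=.
rewrite [RHS](bigID (fun ij : 'I_n * 'I_n => (s^-1%g ij.1 < s^-1%g ij.2)%N)) /=.
congr (_ * _); first by apply: eq_bigl => -[i j] /=; rewrite andbC.
rewrite (reindex (fun ij : 'I_n * 'I_n => (ij.2, ij.1))) /=; last first.
  by exists (fun ij => (ij.2, ij.1)) => -[i j].
apply: eq_big => [[i j]|[i j] _] //=.
have [->|ij] := eqVneq i j; first by rewrite !ltnn.
have sij : s^-1%g i != s^-1%g j by rewrite (inj_eq perm_inj).
by move: ij sij; rewrite -!val_eqE /=; lia.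
Qed.

(** A pair is inverted by the product iff exactly one of the two factors inverts it, where [t] meets
    the letters at their new positions [s @: B]. So [eps] is a cocycle, and a character on the
    stabiliser of [B]. *)
Lemma eps_mul n (B : {set 'I_n}) (s t : {perm 'I_n}) :
  eps B (s * t)%g = eps B s * eps (s @: B) t.
Proof.
have -> : eps (s @: B) t = \prod_(ij : 'I_n * 'I_n | (ij.1 < ij.2)%N)
    (if (ij.1 \in B) && (ij.2 \in B) then
     if (s ij.1 < s ij.2)%N == (t (s ij.1) < t (s ij.2))%N then 1 else -1 else 1).
  rewrite epsE.
  pose g (ij : 'I_n * 'I_n) : F := (if (ij.1 \in s @: B) && (ij.2 \in s @: B) then
     if (ij.1 < ij.2)%N == (t ij.1 < t ij.2)%N then 1 else -1 else 1).
  rewrite -(@prod_pairs_reindex _ g s) => [|i j].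
    by apply: eq_bigr => -[i j] _; rewrite /g /= !mem_imset //; apply: perm_inj.
  rewrite /g /= andbC; case: ifP => // _.
  have [->|ij] := eqVneq i j; first by [].
  have tij : t i != t j by rewrite (inj_eq perm_inj).
  by rewrite (_ : (i < j)%N == (t i < t j)%N = ((j < i)%N == (t j < t i)%N)) //; move: ij tij; rewrite -!val_eqE /=; lia.
rewrite !epsE -big_split /=; apply: eq_bigr => -[i j] /= ij.
case: ifP => _; last by rewrite mul1r.
by rewrite ij !permM; do 2!case: (_ < _)%N; rewrite ?mulr1 ?mul1r ?mulrNN ?mulr1.
Qed.

Lemma eps_sq n (B : {set 'I_n}) (s : {perm 'I_n}) : eps B s * eps B s = 1.
Proof. by rewrite /eps -signr_odd; case: odd; rewrite ?mulrNN mulr1. Qed.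

Lemma eps_neq0 n (B : {set 'I_n}) (s : {perm 'I_n}) : eps B s != 0.
Proof. by apply/eqP => e0; move/eqP: (eps_sq B s); rewrite e0 mul0r eq_sym oner_eq0. Qed.

Lemma eps1 n (B : {set 'I_n}) : eps B 1%g = 1.
Proof.
rewrite /eps (_ : invs _ _ = set0) ?cards0 //; apply/setP=> -[i j].
by rewrite !inE /= !perm1; case: ltngtP; rewrite !andbF.
Qed.

(** On the stabiliser of [B] the cocycle is a character with values 1 and -1. This is what frees
    Brauer quotients of signs. *)
Lemma eps_odd_order n (B : {set 'I_n}) (s : {perm 'I_n}) :
  s @: B = B -> odd #[s]%g -> eps B s = 1.
Proof.
move=> sB od.
have eX k : eps B (s ^+ k)%g = eps B s ^+ k.
  by elim: k => [|k IH]; rewrite ?eps1 // expgS eps_mul sB IH exprS.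
have := eX #[s]%g; rewrite expg_order eps1 => h.
have [//|e] : eps B s = 1 \/ eps B s = -1.
  by rewrite /eps -signr_odd; case: odd; [right|left].
by rewrite h e -signr_odd od.
Qed.

(** Besides (x, y) itself the inversions are (x, z) and (z, y) for the z in [B] strictly between, so
    their number is odd. *)
Lemma eps_tperm_in n (B : {set 'I_n}) x y : x != y -> x \in B -> y \in B ->
  eps B (tperm x y) = -1.
Proof.
wlog xy : x y / (x < y)%N => [W|_ xB yB].
  move=> nxy xB yB; have [xy|yx|/val_inj e] := ltngtP x y; first exact: W.
    by rewrite tpermC; apply: W; rewrite // eq_sym.
  by rewrite e eqxx in nxy.
pose Z := [set z in B | (x < z < y)%N].
have -> : eps B (tperm x y) = (-1) ^+ #|(x, y) |: ([set (x, z) | z in Z] :|: [set (z, y) | z in Z])|.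
  rewrite /eps; congr (_ ^+ #|pred_of_set _|); apply/setP=> -[i j].
  rewrite !inE /= xpair_eqE.
  have m1 : ((i, j) \in [set (x, z) | z in Z]) = (i == x) && (j \in Z).
    apply/imsetP/andP => [[z zZ [-> ->]]|[/eqP -> jZ]]; first by rewrite eqxx.
    by exists j.
  have m2 : ((i, j) \in [set (z, y) | z in Z]) = (j == y) && (i \in Z).
    apply/imsetP/andP => [[z zZ [-> ->]]|[/eqP -> jZ]]; first by rewrite eqxx.
    by exists i.
  rewrite m1 m2 !inE.
  have nE (u v : 'I_n) : (u == v) = (u == v :> nat) by [].
  have neq (u v : 'I_n) : u <> v -> u != v :> nat by move=> h; apply/eqP => /val_inj.
  rewrite !nE; have := xy.
  case: (tpermP x y i) => [->|->|/neq ix /neq iy]; case: (tpermP x y j) => [->|->|/neq jx /neq jy];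
    rewrite ?xB ?yB /=; move: (i \in B) (j \in B) => bi bj; lia.
rewrite cardsU1 cardsU (_ : _ :&: _ = set0); last first.
  apply/setP=> ij; rewrite !inE; apply/negP => /andP[/imsetP[z zZ ->] /imsetP[z' z'Z [e _]]].
  by move: z'Z; rewrite inE -e ltnn andbF.
rewrite !card_imset ?cards0 ?subn0; try by move=> u v [].
rewrite (_ : (_ \notin _) = true); last first.
  rewrite inE negb_or; apply/andP; split; apply/imsetP => -[z zZ [e1]].
    by move: zZ; rewrite inE -e1 ltnn !andbF.
  by move: zZ; rewrite inE -e1 ltnn /= !andbF.
by rewrite addnn exprD expr1 -signr_odd odd_double mulr1.
Qed.

Lemma eps_tperm_out n (B : {set 'I_n}) x y : x \notin B -> y \notin B ->
  eps B (tperm x y) = 1.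
Proof.
move=> xB yB; rewrite /eps (_ : invs _ _ = set0) ?cards0 //; apply/setP=> -[i j].
rewrite !inE /=; apply/negP => /and4P[iB jB ij].
have h z : z \in B -> tperm x y z = z.
  by move=> zB; apply: tpermD; apply/eqP => e; [rewrite e zB in xB|rewrite e zB in yB].
by rewrite !h //; lia.
Qed.

End SuperSign.

(** * Words and equivariant kernels *)

Section WordAction.
Variables (n : nat) (T : eqType).
Implicit Types (w : {ffun 'I_n -> T}) (s t : {perm 'I_n}).

Definition act w s : {ffun 'I_n -> T} := [ffun i => w (s^-1%g i)].

Lemma actE w s i : act w s (s i) = w i.
Proof. by rewrite ffunE permK. Qed.

Lemma act1 w : act w 1%g = w.
Proof. by apply/ffunP => i; rewrite ffunE invg1 perm1. Qed.

Lemma actM w s t : act w (s * t)%g = act (act w s) t.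
Proof. by apply/ffunP => i; rewrite !ffunE invMg permM. Qed.

Lemma actK s : cancel (act^~ s) (act^~ s^-1%g).
Proof. by move=> w; rewrite -actM mulgV act1. Qed.

Lemma actKV s : cancel (act^~ s^-1%g) (act^~ s).
Proof. by move=> w; rewrite -actM mulVg act1. Qed.

Lemma act_inj s : injective (act^~ s).
Proof. exact: can_inj (actK s). Qed.

Lemma act_stabP w s : reflect (act w s = w) [forall i, w (s i) == w i].
Proof.
apply: (iffP forallP) => [H|e i]; last by rewrite -{1}e actE.
by apply/ffunP => i; rewrite ffunE -{2}[i](permKV s) (eqP (H _)).
Qed.

Lemma act_conj w (w' : {ffun 'I_n -> T}) :
  perm_eq [seq w i | i : 'I_n] [seq w' i | i : 'I_n] -> exists s, w' = act w s.
Proof.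
rewrite perm_sym => e.
have := e; rewrite (_ : [seq w i | i : 'I_n] = [tuple w i | i < n]) //.
case/tuple_permP => s Hs; exists s^-1%g; apply/ffunP => i; rewrite ffunE invgK.
have := congr1 (fun l => nth (w i) l i) Hs.
rewrite -tnth_nth tnth_mktuple tnth_mktuple => <-.
rewrite (nth_map i) ?size_enum_ord //.
by rewrite nth_ord_enum.
Qed.

Lemma tperm_stab w x y : w x = w y -> act w (tperm x y) = w.
Proof. by move=> e; apply/act_stabP/forallP => i; case: tpermP => // ->; rewrite e. Qed.

(** The stabiliser of a word is a product of symmetric groups, hence generated by its
    transpositions. Multiplying by the transposition of [x] and [s x] lowers the number of moved
    positions. *)
Lemma stab_ind w (P : {perm 'I_n} -> Prop) :
    P 1%g ->
    (forall x y s, x != y -> w x = w y -> act w s = w -> P s -> P (tperm x y * s)%g) ->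
  forall s, act w s = w -> P s.
Proof.
move=> P1 PM s; have [m] := ubnP #|[set i | s i != i]|.
elim: m s => // m IH s lem ws.
have [s1|] := eqVneq [set i | s i != i] set0.
  suff -> : s = 1%g by [].
  apply/permP => i; rewrite perm1; apply/eqP.
  by have := in_set0 i; rewrite -s1 inE => /negbFE.
case/set0Pn => x; rewrite inE => sx.
have wsx : w x = w (s x) by move/act_stabP/forallP/(_ x)/eqP: ws.
have -> : s = (tperm x (s x) * (tperm x (s x) * s))%g by rewrite mulgA tperm2 mul1g.
have wt : act w (tperm x (s x) * s)%g = w by rewrite actM tperm_stab.
apply: PM => //; first by rewrite eq_sym.
apply: IH => //; apply: (@leq_trans #|[set i | s i != i]|); last by rewrite -ltnS.
apply: proper_card; apply/properP; split.
  by apply/subsetP => i; rewrite !inE permM; case: tpermP => // [->|->]; rewrite ?sx // eqxx.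
by exists (s x); rewrite inE ?permM ?tpermR ?eqxx // (inj_eq perm_inj).
Qed.

End WordAction.

Section Kernels.
Variables (F : fieldType) (L h : nat).
Local Notation W n := {ffun 'I_n -> 'I_L.+1}.
Local Notation ker n := 'M[F]_#|{: W n}|.

(* The letters [t] with [h <= t] are the odd ones: they stand for the parts of [b] in [M(a|b)]. *)
Definition oset n (w : W n) : {set 'I_n} := [set i | (h <= w i)%N].

Lemma oset_act n (w : W n) s : oset (act w s) = s @: oset w.
Proof.
apply/setP => i; rewrite -[i](permKV s) mem_imset; last exact: perm_inj.
by rewrite !inE actE.
Qed.

Definition kv n (K : ker n) (w w' : W n) : F := K (enum_rank w) (enum_rank w').

Definition mkk n (f : W n -> W n -> F) : ker n :=
  \matrix_(i, j) f (enum_val i) (enum_val j).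

Lemma kv_mkk n (f : W n -> W n -> F) w w' : kv (mkk f) w w' = f w w'.
Proof. by rewrite /kv mxE !enum_rankK. Qed.

Lemma kvP n (K K' : ker n) : (forall w w', kv K w w' = kv K' w w') -> K = K'.
Proof.
by move=> e; apply/matrixP => i j; have := e (enum_val i) (enum_val j); rewrite /kv !enum_valK.
Qed.

Lemma kvM n (K K' : ker n) w w' : kv (K *m K') w w' = \sum_v kv K w v * kv K' v w'.
Proof.
rewrite /kv mxE (reindex (@enum_rank _)) //.
by exists enum_val => ? _; rewrite ?enum_rankK ?enum_valK.
Qed.

Lemma kvD n (K K' : ker n) w w' : kv (K + K') w w' = kv K w w' + kv K' w w'.
Proof. by rewrite /kv mxE. Qed.

Lemma kvZ n c (K : ker n) w w' : kv (c *: K) w w' = c * kv K w w'.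
Proof. by rewrite /kv mxE. Qed.

Lemma kv0 n (w w' : W n) : kv 0 w w' = 0.
Proof. by rewrite /kv mxE. Qed.

(** Commutation with the signed action of S_n on the span of the words, where [s] sends w to
    [eps F (oset w) s] times [act w s]. Signs are their own inverses, so both appear as factors. *)
Definition equiv n (K : ker n) := forall s w w',
  kv K (act w s) (act w' s) = eps F (oset w) s * eps F (oset w') s * kv K w w'.

Lemma equivD n (K K' : ker n) : equiv K -> equiv K' -> equiv (K + K').
Proof. by move=> e e' s w w'; rewrite !kvD e e' mulrDr. Qed.

Lemma equivZ n c (K : ker n) : equiv K -> equiv (c *: K).
Proof. by move=> e s w w'; rewrite !kvZ e mulrCA. Qed.

Lemma equiv0 n : equiv (0 : ker n).
Proof. by move=> s w w'; rewrite !kv0 mulr0. Qed.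

Lemma equivM n (K K' : ker n) : equiv K -> equiv K' -> equiv (K *m K').
Proof.
move=> e e' s w w'; rewrite !kvM (reindex_inj (@act_inj _ _ s)) mulr_sumr.
apply: eq_bigr => v _; rewrite e e'.
by rewrite -[RHS]mul1r -(eps_sq F (oset v) s); ring.
Qed.

Lemma equiv_neq0 n (K : ker n) s w w' : equiv K ->
  (kv K (act w s) (act w' s) == 0) = (kv K w w' == 0).
Proof. by move=> e; rewrite e !mulf_eq0 !(negbTE (eps_neq0 _ _ _)). Qed.

Definition same n (u w : W n) : bool := [exists s, w == act u s].

Lemma sameP n (u w : W n) : reflect (exists s, w = act u s) (same u w).
Proof. by apply: (iffP existsP) => -[s e]; exists s; apply/eqP. Qed.

Lemma same_refl n (u : W n) : same u u.
Proof. by apply/sameP; exists 1%g; rewrite act1. Qed.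

Lemma same_sym n (u w : W n) : same u w = same w u.
Proof.
by apply/sameP/sameP => -[s ->]; exists s^-1%g; rewrite -actM mulgV act1.
Qed.

Lemma same_trans n (v u w : W n) : same u v -> same v w -> same u w.
Proof. by move=> /sameP[s ->] /sameP[t ->]; apply/sameP; exists (s * t)%g; rewrite actM. Qed.

Lemma same_act n (u w : W n) s : same u (act w s) = same u w.
Proof.
have h' : same w (act w s) by apply/sameP; exists s.
by apply/idP/idP => H; apply: same_trans H _; rewrite // same_sym.
Qed.

(** The projection of the span of all words onto those of the content of [u]: the identity of
    M(u). *)
Definition one n (u : W n) : ker n := mkk (fun w w' => ((w == w') && same u w)%:R).

Lemma kv_one n (u w w' : W n) : kv (one u) w w' = ((w == w') && same u w)%:R.
Proof. by rewrite kv_mkk. Qed.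

Lemma kv_1M n (u : W n) K w w' : kv (one u *m K) w w' = (same u w)%:R * kv K w w'.
Proof.
rewrite kvM (bigD1 w) //= big1 ?addr0 ?kv_one ?eqxx // => v nv.
by rewrite kv_one eq_sym (negbTE nv) mul0r.
Qed.

Lemma kv_M1 n (u : W n) K w w' : kv (K *m one u) w w' = (same u w')%:R * kv K w w'.
Proof.
rewrite kvM (bigD1 w') //= big1 ?addr0 ?kv_one ?eqxx 1?mulrC // => v nv.
by rewrite kv_one (negbTE nv) mulr0.
Qed.

Lemma equiv_one n (u : W n) : equiv (one u).
Proof.
move=> s w w'; rewrite !kv_one same_act (inj_eq (@act_inj _ _ s)).
case: eqP => [->|_]; last by rewrite mulr0.
by rewrite eps_sq mul1r.
Qed.

Lemma one_idem n (u : W n) : one u *m one u = one u.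
Proof. by apply/kvP => w w'; rewrite kv_1M kv_one; case: same; rewrite ?mul1r // mul0r andbF. Qed.

Definition cut n (u : W n) (K : ker n) (u' : W n) : ker n := one u *m K *m one u'.

Lemma kv_cut n (u u' : W n) K w w' :
  kv (cut u K u') w w' = (same u w && same u' w')%:R * kv K w w'.
Proof.
by rewrite kv_M1 kv_1M mulrA; do 2!case: same; rewrite ?mul0r ?mul1r ?mul0r.
Qed.

Lemma equiv_cut n (u u' : W n) K : equiv K -> equiv (cut u K u').
Proof. by move=> e; apply: equivM (equivM _ e) _; apply: equiv_one. Qed.

Lemma cut_id n (u u' : W n) K :
  (forall w w', kv K w w' != 0 -> same u w && same u' w') -> cut u K u' = K.
Proof.
move=> H; apply/kvP => w w'; rewrite kv_cut.
have [->|/H ->] := eqVneq (kv K w w') 0; first by rewrite mulr0.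
by rewrite mul1r.
Qed.

(* When [adm w0 w0'] fails the value depends on the [s] that is picked, and [orb] is not equivariant. *)
Definition orb n (w0 w0' : W n) : ker n := mkk (fun w w' =>
  if [pick s | (act w0 s == w) && (act w0' s == w')] is Some s
  then eps F (oset w0) s * eps F (oset w0') s else 0).

(** Triviality of the sign on the joint stabiliser. Where it fails and 2 is invertible, every
    equivariant kernel vanishes at the pair. *)
Definition adm n (w0 w0' : W n) := forall s, act w0 s = w0 -> act w0' s = w0' ->
  eps F (oset w0) s * eps F (oset w0') s = 1.

Lemma eps_act_mul n (w : W n) s t :
  eps F (oset w) (s * t)%g = eps F (oset w) s * eps F (oset (act w s)) t.
Proof. by rewrite eps_mul oset_act. Qed.

Lemma orb_neq0 n (w0 w0' w w' : W n) : kv (orb w0 w0') w w' != 0 ->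
  exists s, w = act w0 s /\ w' = act w0' s.
Proof.
rewrite kv_mkk; case: pickP => [s /andP[/eqP <- /eqP <-] _|]; first by exists s.
by rewrite eqxx.
Qed.

Lemma kv_orb n (w0 w0' : W n) s : adm w0 w0' ->
  kv (orb w0 w0') (act w0 s) (act w0' s) = eps F (oset w0) s * eps F (oset w0') s.
Proof.
move=> ad; rewrite kv_mkk; case: pickP => [t /andP[/eqP e /eqP e']|/(_ s)]; last by rewrite !eqxx.
have := ad (t * s^-1)%g; rewrite !actM e e' !actK => /(_ erefl erefl) ad1.
rewrite (_ : t = (t * s^-1) * s)%g; last by rewrite mulgKV.
rewrite eps_act_mul [eps F (oset w0') (_ * s)%g]eps_act_mul !actM e e' !actK.
by rewrite -[RHS]mul1r -ad1; ring.
Qed.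

Lemma equiv_orb n (w0 w0' : W n) : adm w0 w0' -> equiv (orb w0 w0').
Proof.
move=> ad s w w'.
case: (boolP [exists t, (act w0 t == w) && (act w0' t == w')]) => [/existsP[t /andP[/eqP <- /eqP <-]]|ne].
  rewrite -!actM !kv_orb // !eps_act_mul.
  by ring.
rewrite [X in _ * X]kv_mkk; case: pickP => [t Ht|_]; first by case/existsP: ne; exists t.
rewrite mulr0 kv_mkk; case: pickP => // t /andP[/eqP e /eqP e'].
by case/existsP: ne; exists (t * s^-1)%g; rewrite !actM e e' !actK !eqxx.
Qed.

End Kernels.

Lemma card_act2 n (T T' : eqType) (w : {ffun 'I_n -> T}) (v : {ffun 'I_n -> T'})
    (P : T -> T' -> bool) s :
  #|[set i | P (act w s i) (act v s i)]| = #|[set i | P (w i) (v i)]|.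
Proof.
rewrite -[RHS](card_imset _ (@perm_inj _ s)); apply: eq_card => i.
have -> : i = s (s^-1%g i) by rewrite permKV.
by rewrite (mem_imset _ _ (@perm_inj _ s)) !inE !actE.
Qed.

Lemma act_conj_card n (T : eqType) (w w' : {ffun 'I_n -> T}) :
    (forall t, #|[set i | w i == t]| = #|[set i | w' i == t]|) ->
  exists s, w' = act w s.
Proof.
move=> e; apply: act_conj; rewrite /perm_eq; apply/allP => t _ /=.
have c (u : {ffun 'I_n -> T}) : count_mem t [seq u i | i : 'I_n] = #|[set i | u i == t]|.
  rewrite count_map -sum1_count -sum1_card big_enum_cond /=.
  by apply: eq_bigl => i; rewrite !inE.
by rewrite !c e.
Qed.

(** * Factoring kernels through smaller words *)

Section PBW.
Variables (F : fieldType) (L h : nat).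
Local Notation W n := {ffun 'I_n -> 'I_L.+1}.
Local Notation ker n := 'M[F]_#|{: W n}|.
Local Notation equiv := (@equiv F L h _).
Local Notation adm := (adm F h).
Local Notation orb := (orb F h).

Definition wmin n (w w' : W n) : W n := [ffun i => if (w i <= w' i)%N then w i else w' i].
Definition omg n (w w' : W n) : nat := \sum_i ((w i - w' i) + (w' i - w i)).

Lemma adm_sym n (w w' : W n) : adm w w' -> adm w' w.
Proof. by move=> a s e e'; rewrite mulrC a. Qed.

(** By [stab_ind] only a transposition of x and y fixing [w] and [v] matters. If v x is odd, so is
    the larger w x, and the signs cancel. If v x is even but w x odd, then [v] takes the letters of
    [w'] at x and y, so [w'] is constant and even there, against the parity hypothesis. *)
Lemma adm_low n (w w' v : W n) :
    (forall x y, x != y -> w x = w y -> w' x = w' y -> (h <= w x)%N = (h <= w' x)%N) ->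
    (forall i, (v i <= w i)%N) -> (forall i, v i = w i \/ v i = w' i) ->
  adm w v.
Proof.
move=> par vw vE.
pose z := [ffun i => (w i, v i)] : {ffun 'I_n -> _}.
suff H s : act z s = z -> eps F (oset h w) s * eps F (oset h v) s = 1.
  move=> s e e'; apply: H; apply/ffunP => i; rewrite !ffunE.
  by move/ffunP/(_ i): e; move/ffunP/(_ i): e'; rewrite !ffunE => -> ->.
move: s; apply: (@stab_ind _ _ z); first by rewrite !eps1 mulr1.
move=> x y s xy; rewrite !ffunE => -[wx vx] _ IH.
rewrite !eps_act_mul !tperm_stab // mulrACA IH mulr1.
case: (boolP (h <= v x)%N) => ov.
  have ow : (h <= w x)%N by apply: leq_trans ov (vw x).
  by rewrite !eps_tperm_in ?mulrNN ?mulr1 // inE -?wx -?vx.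
case: (boolP (h <= w x)%N) => ow; last first.
  by rewrite !eps_tperm_out ?mulr1 // inE -?wx -?vx.
have ne i : v i = v x -> w i = w x -> v i = w' i.
  by move=> evx ewx; case: (vE i) => // e; move: ov; rewrite -evx e ewx ow.
have e' : w' x = w' y by rewrite -!ne.
by move: ov; rewrite ne // -(par _ _ xy wx e') ow.
Qed.

Lemma omg_act n (w w' : W n) s : omg (act w s) (act w' s) = omg w w'.
Proof. by rewrite /omg (reindex_inj (@perm_inj _ s)); apply: eq_bigr => i _; rewrite !actE. Qed.

Lemma wmin_le1 n (w w' : W n) i : (wmin w w' i <= w i)%N.
Proof. by rewrite ffunE; case: ifP => //; lia. Qed.

Lemma wmin_le2 n (w w' : W n) i : (wmin w w' i <= w' i)%N.
Proof. by rewrite ffunE; case: ifP => //; lia. Qed.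

Lemma wminE n (w w' : W n) i : wmin w w' i = w i \/ wmin w w' i = w' i.
Proof. by rewrite ffunE; case: ifP; [left|right]. Qed.

(** An entry at (w, w') comes from a word v below both with omg w v + omg v w' = omg w0 w0'. The
    triangle inequality is an equality only for v = wmin w w', and then the joint contents of (w, v)
    and (v, w') determine that of (w, w'). *)
Lemma orbM_neq0 n (w0 w0' w w' : W n) (v0 := wmin w0 w0') :
    kv (orb w0 v0 *m orb v0 w0') w w' != 0 ->
  (omg w w' <= omg w0 w0')%N /\
  (omg w w' = omg w0 w0' -> exists s, w = act w0 s /\ w' = act w0' s).
Proof.
rewrite kvM => nz.
have [v nzv] : exists v, kv (orb w0 v0) w v * kv (orb v0 w0') v w' != 0.
  apply/existsP; apply: contraNT nz; rewrite negb_exists => /forallP H.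
  by apply/eqP/big1 => v _; apply/eqP; have := H v; rewrite negbK.
move: nzv; rewrite mulf_eq0 negb_or => /andP[/orb_neq0[s [ew ev]] /orb_neq0[t [ev' ew']]].
have vw i : (v i <= w i)%N by rewrite ev ew -[i](permKV s) !actE wmin_le1.
have vw' i : (v i <= w' i)%N by rewrite ev' ew' -[i](permKV t) !actE wmin_le2.
have o1 : omg w0 w0' = (omg w v + omg v w')%N.
  have -> : omg w v = omg w0 v0 by rewrite ew ev omg_act.
  have -> : omg v w' = omg v0 w0' by rewrite ew' ev' omg_act.
  rewrite /omg -big_split /=.
  by apply: eq_bigr => i _; rewrite ffunE; case: ifP; lia.
have lef : (omg w w' <= omg w v + omg v w' ?= iff [forall (i | true), v i == wmin w w' i])%N.
  rewrite /omg -big_split /=; apply: leqif_sum => i _; apply/leqifP.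
  have := vw i; have := vw' i; case: eqP => [->|/eqP].
    by rewrite ffunE; case: ifP => *; apply/eqP; lia.
  by rewrite -val_eqE /= ffunE; case: ifP; lia.
split; first by rewrite o1 lef.
rewrite o1 => /eqP; rewrite lef => /forallP vE.
have {}vE i : v i = wmin w w' i by apply/eqP; apply: vE.
pose z0 : {ffun 'I_n -> _} := [ffun i => (w0 i, w0' i)].
pose z : {ffun 'I_n -> _} := [ffun i => (w i, w' i)].
have [r zr] : exists r, z = act z0 r.
  apply: act_conj_card => -[a b].
  have z0E (P : 'I_L.+1 * 'I_L.+1 -> bool) : [set i | P (z0 i)] = [set i | P (w0 i, w0' i)].
    by apply/setP => i; rewrite !inE ffunE.
  have zE (P : 'I_L.+1 * 'I_L.+1 -> bool) : [set i | P (z i)] = [set i | P (w i, w' i)].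
    by apply/setP => i; rewrite !inE ffunE.
  rewrite (z0E (fun t => t == (a, b))) (zE (fun t => t == (a, b))) /=.
  have c1 (P : 'I_L.+1 -> 'I_L.+1 -> bool) :
      #|[set i | P (w i) (v i)]| = #|[set i | P (w0 i) (v0 i)]|.
    by rewrite ew ev card_act2.
  have c2 (P : 'I_L.+1 -> 'I_L.+1 -> bool) :
      #|[set i | P (v i) (w' i)]| = #|[set i | P (v0 i) (w0' i)]|.
    by rewrite ew' ev' card_act2.
  have vn i : (v i : nat) = minn (w i) (w' i) by rewrite vE ffunE; case: ifP; lia.
  have v0n i : (v0 i : nat) = minn (w0 i) (w0' i) by rewrite ffunE; case: ifP; lia.
  have c3 c : (#|[set i | (w i == c) && (w' i < c)%N]| = #|[set i | (w0 i == c) && (w0' i < c)%N]|)%N.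
    have := c1 (fun x y => (x == c) && (y < c)%N).
    have -> : [set i | (w i == c) && (v i < c)%N] = [set i | (w i == c) && (w' i < c)%N].
      by apply/setP => i; rewrite !inE vn -!val_eqE /=; lia.
    by move=> ->; apply: eq_card => i; rewrite !inE v0n -!val_eqE /=; lia.
  have c4 c : (#|[set i | (w i == c) && (c < w' i)%N]| = #|[set i | (w0 i == c) && (c < w0' i)%N]|)%N.
    have := c2 (fun x y => (x == c) && (c < y)%N).
    have -> : [set i | (v i == c) && (c < w' i)%N] = [set i | (w i == c) && (c < w' i)%N].
      by apply/setP => i; rewrite !inE -!val_eqE /= vn; lia.
    by move=> ->; apply: eq_card => i; rewrite !inE -!val_eqE /= v0n; lia.
  (* Pairs (a, b) with a < b are visible in (v, w'), those with a > b in (w, v). The pairs (a, a)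
     are what remains of the letter a in w. *)
  case: (ltngtP a b) => ab.
  - have := c2 (fun x y => (x == a) && (y == b)).
    have -> : [set i | (v i == a) && (w' i == b)] = [set i | (w i, w' i) == (a, b)].
      by apply/setP => i; rewrite !inE xpair_eqE -!val_eqE /= vn; lia.
    by move=> ->; apply: eq_card => i; rewrite !inE xpair_eqE -!val_eqE /= v0n; lia.
  - have := c1 (fun x y => (x == a) && (y == b)).
    have -> : [set i | (w i == a) && (v i == b)] = [set i | (w i, w' i) == (a, b)].
      by apply/setP => i; rewrite !inE xpair_eqE -!val_eqE /= vn; lia.
    by move=> ->; apply: eq_card => i; rewrite !inE xpair_eqE -!val_eqE /= v0n; lia.
  - have := c1 (fun x y => (x == a)); rewrite -(val_inj ab) => ca.
    have split3 (u u' : W n) : #|[set i | u i == a]| =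
        (#|[set i | (u i, u' i) == (a, a)]| + #|[set i | (u i == a) && (u' i < a)%N]|
         + #|[set i | (u i == a) && (a < u' i)%N]|)%N.
      rewrite -(cardsID [set i | u' i == a]) -[X in (_ + X = _)%N](cardsID [set i | (u' i < a)%N]) addnA.
      by congr (_ + _ + _)%N; apply: eq_card => i; rewrite !inE ?xpair_eqE -?val_eqE /=; lia.
    by move: ca; rewrite (split3 w w') (split3 w0 w0') c3 c4 => /addIn/addIn ->.
exists r; split; apply/ffunP => i; move/ffunP/(_ i): zr; rewrite !ffunE.
  by case.
by case.
Qed.

(** A word contributing to this entry lies below [v0] and has the same total distance from [w0] as
    [v0]; hence it is [v0], and the sum has a single nonzero term. *)
Lemma kv_orbM_min n (w0 w0' : W n) (v0 := wmin w0 w0') : adm w0 v0 -> adm v0 w0' ->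
  kv (orb w0 v0 *m orb v0 w0') w0 w0' = 1.
Proof.
move=> a1 a2; rewrite kvM (bigD1 v0) //=.
have e1 : kv (orb w0 v0) w0 v0 = 1.
  by have := kv_orb 1%g a1; rewrite !act1 !eps1 mulr1.
have e2 : kv (orb v0 w0') v0 w0' = 1.
  by have := kv_orb 1%g a2; rewrite !act1 !eps1 mulr1.
rewrite e1 e2 mulr1 big1 ?addr0 // => v nv; apply/eqP; rewrite mulf_eq0.
apply: contraNT nv; rewrite negb_or => /andP[/orb_neq0[s [ew ev]] /orb_neq0[t [ev' ew']]].
apply/eqP/ffunP => i; apply: val_inj.
have : (\sum_i (w0 i - v i) = \sum_i (w0 i - v0 i))%N.
  by rewrite (reindex_inj (@perm_inj _ s)); apply: eq_bigr => j _; rewrite {1}ew ev !actE.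
have : (\sum_i (w0' i - v i) = \sum_i (w0' i - v0 i))%N.
  by rewrite (reindex_inj (@perm_inj _ t)); apply: eq_bigr => j _; rewrite {1}ew' ev' !actE.
have vw j : (v j <= w0 j)%N by rewrite ev ew -[j](permKV s) !actE wmin_le1.
have vw' j : (v j <= w0' j)%N by rewrite ev' ew' -[j](permKV t) !actE wmin_le2.
have le j : (v j <= v0 j)%N by rewrite ffunE; case: ifP.
move=> _ sw; apply/eqP; rewrite eqn_leq le /= leqNgt; apply/negP => lt.
suff : (\sum_i (w0 i - v0 i) < \sum_i (w0 i - v i))%N by rewrite sw ltnn.
rewrite (bigD1 i) // [X in (_ < X)%N](bigD1 i) //= -addSn leq_add //.
  by have := wmin_le1 w0 w0' i; rewrite -/v0; lia.
by apply: leq_sum => j _; have := le j; lia.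
Qed.

Hypothesis two_neq0 : (2%:R : F) != 0.

(** The transposition of x and y fixes both words, so different parities would make the entry equal
    to its negative. *)
Lemma equiv_parity n (K : ker n) w w' x y : equiv K -> kv K w w' != 0 ->
  x != y -> w x = w y -> w' x = w' y -> (h <= w x)%N = (h <= w' x)%N.
Proof.
move=> eK nz xy wx w'x.
have := eK (tperm x y) w w'; rewrite !tperm_stab //.
have e (u : W n) : u x = u y -> eps F (oset h u) (tperm x y) = if (h <= u x)%N then -1 else 1.
  move=> ux; case: ifP => o.
    by rewrite eps_tperm_in // inE ?o // -ux o.
  by rewrite eps_tperm_out // inE ?o // -ux o.
rewrite !e //; do 2!case: ifP => // _.
all: rewrite ?mulrN ?mulNr ?mulr1 ?mul1r => k; move/eqP: nz; case.
all: have: 2%:R * kv K w w' == 0 by rewrite mulr_natl mulr2n {1}k addNr.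
all: by rewrite mulf_eq0 (negbTE two_neq0) => /eqP.
Qed.

(* The product of the two orbit kernels through [wmin w0 w0'] is the orbit kernel of [(w0, w0')] up to
   kernels supported on pairs closer to the diagonal, as measured by [omg]. *)
Lemma pbw_ind n (P : ker n -> Prop) :
    P 0 -> (forall K K', P K -> P K' -> P (K + K')) -> (forall c K, P K -> P (c *: K)) ->
    (forall w0 w0', adm w0 (wmin w0 w0') -> adm (wmin w0 w0') w0' ->
       P (orb w0 (wmin w0 w0') *m orb (wmin w0 w0') w0')) ->
  forall K, equiv K -> P K.
Proof.
move=> P0 PD PZ PO.
(* The outer induction is on a strict bound [N] for [omg] on the support, the inner one on the
   number of support pairs at the top level. Subtracting [c *: G] removes (w0, w0') from that level
   and adds nothing to it. *)
suff H N (K : ker n) : equiv K -> (forall w w', (N <= omg w w')%N -> kv K w w' = 0) -> P K.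
  move=> K eK; apply: (H (\max_(ww : W n * W n) omg ww.1 ww.2).+1) => // w w'.
  by rewrite ltnNge (@leq_bigmax _ (fun ww => omg ww.1 ww.2) (w, w')).
elim: N K => [|N IHN] K eK sK.
  by rewrite (_ : K = 0) //; apply/kvP => w w'; rewrite sK // kv0.
have [m] := ubnP #|[set ww : W n * W n | (omg ww.1 ww.2 == N) && (kv K ww.1 ww.2 != 0)]|.
elim: m K eK sK => // m IHm K eK sK lem.
have [/eqP|] := eqVneq #|[set ww : W n * W n | (omg ww.1 ww.2 == N) && (kv K ww.1 ww.2 != 0)]| 0%N.
  rewrite cards_eq0 => /eqP s0; apply: IHN => // w w'; rewrite leq_eqVlt => /orP[/eqP e|/sK //].
  have := in_set0 (w, w'); rewrite -s0 inE /= -e eqxx /= => /negbFE /eqP //.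
rewrite cards_eq0 => /set0Pn[[w0 w0']]; rewrite inE /= => /andP[/eqP oN nz].
have par x y xy := equiv_parity eK nz (x := x) (y := y) xy.
have a1 : adm w0 (wmin w0 w0') := adm_low par (wmin_le1 w0 w0') (@wminE _ w0 w0').
have a2 : adm (wmin w0 w0') w0'.
  apply/adm_sym/(@adm_low _ w0' w0) => [x y xy e e'|i|i]; first by rewrite (par x y).
    exact: wmin_le2.
  by case: (wminE w0 w0' i); [right|left].
set G := orb w0 (wmin w0 w0') *m orb (wmin w0 w0') w0'.
have eG : equiv G by apply: equivM; apply: equiv_orb.
have G1 : kv G w0 w0' = 1 by apply: kv_orbM_min.
set c := kv K w0 w0' in nz.
rewrite -(subrK (c *: G) K); apply: PD; last by apply: PZ; apply: PO.
rewrite -scaleNr; set K' := K + _.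
have eK' : equiv K' by apply: equivD => //; apply: equivZ.
have G0 w w' : (N < omg w w')%N -> kv G w w' = 0.
  move=> lt; apply/eqP; apply: contraTT lt => /orbM_neq0[].
  by rewrite oN -leqNgt.
have K'0 : kv K' w0 w0' = 0 by rewrite kvD kvZ G1 mulr1 subrr.
apply: IHm => // [w w' lt|]; first by rewrite kvD kvZ G0 // sK // mulr0 addr0.
rewrite ltnS in lem; apply: leq_trans lem; apply: proper_card; apply/properP; split.
  apply/subsetP => -[w w']; rewrite !inE /= => /andP[/eqP o nz']; rewrite o eqxx /=.
  apply: contraNneq nz' => k0; have [g0|/orbM_neq0[_]] := eqVneq (kv G w w') 0.
    by rewrite kvD kvZ k0 g0 mulr0 addr0.
  case; first by rewrite o oN.
  by move=> s [-> ->]; rewrite (equiv_neq0 _ _ _ eK') K'0.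
exists (w0, w0'); first by rewrite inE /= oN eqxx.
by rewrite inE /= K'0 eqxx andbF.
Qed.

End PBW.

(** * The residue character of the endomorphism algebra *)

Section Theta.
Variables (F : fieldType) (L h : nat).
Local Notation W n := {ffun 'I_n -> 'I_L.+1}.
Local Notation ker n := 'M[F]_#|{: W n}|.
Local Notation equiv := (@equiv F L h _).
Local Notation adm := (adm F h).
Local Notation orb := (orb F h).
Local Notation one := (@one F L _).
Local Notation cut := (@cut F L _).

Definition cnt n (v : W n) k := #|[set i | (v i < k)%N]|.

Lemma cnt_same n (u v : W n) k : same u v -> cnt u k = cnt v k.
Proof.
by case/sameP => s ->; apply/esym/(card_act2 u u (fun x _ => (x < k)%N)).
Qed.

(* [bad u v]: the content of [u] does not dominate that of [v]. *)
Definition bad n (u v : W n) : Prop := exists k, (cnt u k < cnt v k)%N.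

Lemma bad_low n (u w v : W n) : same u w -> (forall i, (v i <= w i)%N) -> v != w -> bad u v.
Proof.
move=> uw vw nvw; have : ~~ [forall i, v i == w i].
  by apply: contraNN nvw => /forallP H; apply/eqP/ffunP => i; apply/eqP.
rewrite negb_forall => /existsP[i ne]; exists (w i); rewrite (cnt_same _ uw).
apply: proper_card; apply/properP; split.
  by apply/subsetP => j; rewrite !inE => /(leq_ltn_trans (vw j)).
exists i; rewrite inE ?ltnn //.
by move: ne (vw i); rewrite -val_eqE /=; lia.
Qed.

(* [Th] is the projection of End M(u) = F.1 + I onto F, where I is spanned by the maps through some M(v)
   with [bad u v]; only vanishing on I and [Th 1 = 1] are required, multiplicativity follows ([thetaM]). *)
Record theta n (u : W n) (Th : ker n -> F) : Prop := Theta {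
  thetaD : forall K K', Th (K + K') = Th K + Th K';
  thetaZ : forall c K, Th (c *: K) = c * Th K;
  theta1 : Th (one u) = 1;
  theta_bad : forall E G, equiv E -> equiv G ->
    (forall w v, kv E w v != 0 -> same u w -> bad u v) -> Th (cut u (E *m G) u) = 0 }.

Lemma cutD n (u u' : W n) K K' : cut u (K + K') u' = cut u K u' + cut u K' u'.
Proof. by rewrite /cut mulmxDr mulmxDl. Qed.

Lemma cutZ n (u u' : W n) c K : cut u (c *: K) u' = c *: cut u K u'.
Proof. by rewrite /cut -scalemxAr -scalemxAl. Qed.

Lemma cut0 n (u u' : W n) : cut u 0 u' = 0.
Proof. by rewrite /cut mulmx0 mul0mx. Qed.

Lemma one_cut n (u u' : W n) K : one u *m cut u K u' = cut u K u'.
Proof. by rewrite /cut !mulmxA one_idem. Qed.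

Lemma cut_one n (u u' : W n) K : cut u K u' *m one u' = cut u K u'.
Proof. by rewrite /cut -!mulmxA one_idem. Qed.

Lemma one_same n (u v : W n) : same u v -> one u = one v.
Proof.
move=> uv; apply/kvP => w w'; rewrite !kv_one; congr (_ && _)%:R.
by apply/idP/idP; apply: same_trans; rewrite // same_sym.
Qed.

Lemma one_diff n (u v : W n) : ~~ same u v -> one u *m one v = 0.
Proof.
move=> nuv; apply/kvP => w w'; rewrite kv_1M kv_one kv0 -natrM mulnb.
case: eqP => [->|]; rewrite ?andbF //=; case uw: (same u w') => //=.
case vw: (same v w') => //; case/negP: nuv.
by apply: same_trans uw _; rewrite same_sym.
Qed.

Lemma orb_one n (w0 w0' : W n) : one w0 *m orb w0 w0' *m one w0' = orb w0 w0'.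
Proof.
apply: cut_id => w w' /orb_neq0[s [-> ->]].
by rewrite !same_act !same_refl.
Qed.

Lemma kv_orb_r n (K : ker n) (w0 w0' w v : W n) :
  kv (K *m orb w0 w0') w v != 0 -> same w0' v.
Proof. by rewrite -orb_one mulmxA kv_M1; case: same; rewrite // mul0r eqxx. Qed.

Lemma orb_diag n (w : W n) : orb w w = one w.
Proof.
apply/kvP => u v; rewrite kv_one.
have [e|/orb_neq0[s [-> ->]]] := eqVneq (kv (orb w w) u v) 0.
  rewrite e; case: eqP => //= euv; case: sameP => // -[s us].
  have ad : adm w w by move=> t _ _; rewrite eps_sq.
  by move: e; rewrite -euv us kv_orb // eps_sq => /eqP; rewrite oner_eq0.
rewrite kv_orb; last by move=> t _ _; rewrite eps_sq.
by rewrite eqxx same_act same_refl eps_sq.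
Qed.

Definition through n (u u' : W n) (x : ker n * W n * ker n) : ker n :=
  cut u x.1.1 x.1.2 *m cut x.1.2 x.2 u'.

Hypothesis two_neq0 : (2%:R : F) != 0.

Lemma cut_1 n (u : W n) : cut u (one u) u = one u.
Proof. by rewrite /cut !one_idem. Qed.

Lemma through_one n (u u' : W n) x : through u u' x *m one u' = through u u' x.
Proof. by rewrite /through -mulmxA cut_one. Qed.

(** This is End M(u) = F.1 + I. For [w0] and [w0'] of the content of [u] the minimum either equals
    both, which gives the identity, or is strictly below one of them somewhere, which makes it
    bad. *)
Lemma pbw_end n (u : W n) K : equiv K -> exists c (s : seq (ker n * W n * ker n)),
  cut u K u = c *: one u + \sum_(x <- s) through u u x /\
  forall x, x \in s -> [/\ equiv x.1.1, equiv x.2 & bad u x.1.2].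
Proof.
move: K; apply: (pbw_ind two_neq0).
- by exists 0, [::]; rewrite cut0 scale0r big_nil addr0.
- move=> K K' [c [s [e H]]] [c' [s' [e' H']]]; exists (c + c'), (s ++ s'); split.
    by rewrite cutD e e' big_cat scalerDl /= addrACA.
  by move=> x; rewrite mem_cat => /orP[/H|/H'].
- move=> c K [c' [s [e H]]]; exists (c * c'), [seq (c *: x.1.1, x.1.2, x.2) | x <- s]; split.
    rewrite cutZ e scalerDr scalerA big_map scaler_sumr; congr (_ + _).
    by apply: eq_bigr => x _; rewrite /through /= cutZ scalemxAl.
  by move=> x /mapP[y /H[e1 e2 b] ->]; split=> //; apply: equivZ.
move=> w0 w0'; set v0 := wmin w0 w0' => a1 a2.
case: (boolP (same u w0)) => uw0; last first.
  exists 0, [::]; rewrite scale0r big_nil addr0; split=> //.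
  by rewrite /cut -(orb_one w0 v0) !mulmxA one_diff ?mul0mx.
case: (boolP (same u w0')) => uw0'; last first.
  exists 0, [::]; rewrite scale0r big_nil addr0; split=> //.
  by rewrite /cut -(orb_one v0 w0') -!mulmxA one_diff ?mulmx0 // same_sym.
have [e|ne] := eqVneq w0 w0'.
  have ev : v0 = w0 by apply/ffunP => i; rewrite ffunE -e if_same.
  exists 1, [::]; rewrite scale1r big_nil addr0; split=> //.
  by rewrite -e ev orb_diag -(one_same uw0) one_idem /cut !one_idem.
exists 0, [:: (orb w0 v0, v0, orb v0 w0')]; rewrite scale0r big_seq1 add0r; split.
  rewrite /through /cut /= (one_same uw0).
  have -> : one w0 *m (orb w0 v0 *m orb v0 w0') *m one w0 = orb w0 v0 *m orb v0 w0'.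
    rewrite -{2}(one_same uw0) (one_same uw0') -(orb_one w0 v0) -(orb_one v0 w0').
    by rewrite !mulmxA one_idem -!mulmxA one_idem.
  rewrite orb_one; congr (_ *m _).
  by rewrite -(one_same uw0) (one_same uw0') orb_one.
move=> x; rewrite inE => /eqP -> /=; split; try exact: equiv_orb.
have [ev|nv] := eqVneq v0 w0; last first.
  by apply: (bad_low uw0 _ nv); apply: wmin_le1.
apply: (bad_low uw0') => [i|]; first exact: wmin_le2.
apply: contraNneq ne => ev'.
by rewrite -ev' -ev.
Qed.

Section Fixed.
Variables (n : nat) (u : W n) (Th : ker n -> F).
Hypothesis ThP : theta u Th.

Lemma theta0 : Th 0 = 0.
Proof. by rewrite -(scale0r 0) (thetaZ ThP) mul0r. Qed.

Lemma theta_sum I (r : seq I) (G : I -> ker n) :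
  Th (\sum_(i <- r) G i) = \sum_(i <- r) Th (G i).
Proof. by elim/big_rec2: _ => [|i x y _ <-]; rewrite ?theta0 ?(thetaD ThP). Qed.

Lemma theta_through K x : equiv x.1.1 -> equiv x.2 -> bad u x.1.2 -> equiv K ->
  Th (through u u x *m cut u K u) = 0.
Proof.
move=> e1 e2 b eK.
have -> : through u u x *m cut u K u = cut u (cut u x.1.1 x.1.2 *m (cut x.1.2 x.2 u *m cut u K u)) u.
  by rewrite {2}/cut -[RHS]mulmxA !mulmxA one_idem -!mulmxA one_idem.
apply: (theta_bad ThP); first exact: equiv_cut.
  by apply: equivM; apply: equiv_cut.
move=> w v; rewrite kv_cut; case: (boolP (_ && _)) => [/andP[_ sv] _ _|]; last by rewrite mul0r eqxx.
by case: b => k; exists k; rewrite -(cnt_same k sv).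
Qed.

(** By [pbw_end] the first factor is a scalar up to maps through bad contents, and these stay in the
    kernel of [Th] after multiplication by the second factor. *)
Lemma thetaM K K' : equiv K -> equiv K' ->
  Th (cut u K u *m cut u K' u) = Th (cut u K u) * Th (cut u K' u).
Proof.
move=> eK eK'; have [c [s [-> H]]] := pbw_end u eK.
have z : {in s, forall x, forall K, equiv K -> Th (through u u x *m cut u K u) = 0}.
  by move=> x /H[e1 e2 b] K0 e0; apply: theta_through.
rewrite mulmxDl -scalemxAl one_cut mulmx_suml !(thetaD ThP) !(thetaZ ThP) (theta1 ThP) mulr1.
rewrite !theta_sum big_seq big1 => [|x /z ->] //.
rewrite big_seq [X in _ = (_ + X) * _]big1 ?addr0 // => x xs.
have := z x xs _ (@equiv_one F L h _ u).
by rewrite cut_1 through_one.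
Qed.

Lemma theta_coef K : equiv K -> exists s : seq (ker n * W n * ker n),
  cut u K u = Th (cut u K u) *: one u + \sum_(x <- s) through u u x /\
  forall x, x \in s -> [/\ equiv x.1.1, equiv x.2 & bad u x.1.2].
Proof.
move=> eK; have [c [s [e H]]] := pbw_end u eK; exists s; split=> //.
rewrite {1}e; congr (_ *: _ + _).
rewrite e (thetaD ThP) (thetaZ ThP) (theta1 ThP) mulr1 theta_sum big_seq big1 ?addr0 // => x /H[e1 e2 b].
have := theta_through e1 e2 b (@equiv_one F L h _ u).
by rewrite cut_1 through_one.
Qed.

(** For such kernels the two signs in [equiv] cancel, which allows lifting them along the Brauer
    map. *)
Definition bdiag (K : ker n) := forall w v, kv K w v != 0 -> oset h w = oset h v.

(** As [v0] lies below [w0] and [w0'], its even positions contain theirs; having no more of them, it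
    has the same ones. *)
Lemma bdiag_orb (u1 u2 w0 w0' : W n) (v0 := wmin w0 w0') :
    same u1 w0 -> same u2 w0' -> cnt u1 h = cnt u2 h -> (cnt v0 h <= cnt u1 h)%N ->
  bdiag (orb w0 v0 *m orb v0 w0').
Proof.
move=> uw uw' euu' le.
have osE (w : W n) : (forall i, (v0 i <= w i)%N) -> (cnt v0 h <= cnt w h)%N -> oset h w = oset h v0.
  move=> vw lec; apply/setP => i; rewrite !inE.
  have : [set i | (w i < h)%N] == [set i | (v0 i < h)%N].
    rewrite eqEcard [(_ <= _)%N]lec andbT; apply/subsetP => j; rewrite !inE.
    exact: leq_ltn_trans.
  by move/eqP/setP/(_ i); rewrite !inE; lia.
have o1 : oset h w0 = oset h v0.
  by apply: osE; [exact: wmin_le1|rewrite -(cnt_same _ uw)].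
have o2 : oset h w0' = oset h v0.
  by apply: osE; [exact: wmin_le2|rewrite -(cnt_same _ uw') -euu'].
move=> w w'; rewrite kvM => nz.
have [v nzv] : exists v, kv (orb w0 v0) w v * kv (orb v0 w0') v w' != 0.
  apply/existsP; apply: contraNT nz; rewrite negb_exists => /forallP H.
  by apply/eqP/big1 => v _; apply/eqP; have := H v; rewrite negbK.
move: nzv; rewrite mulf_eq0 negb_or => /andP[/orb_neq0[s [-> ev]] /orb_neq0[t [ev' ->]]].
by rewrite !oset_act o1 o2 -!oset_act -ev ev'.
Qed.

(* Kernels that change the parity of some letter factor through words with more even letters, hence lie
   in the radical of the form (f, g) |-> Th(f g) when source and target have equally many even letters. *)
Lemma theta_bdiag_l u' K : cnt u h = cnt u' h -> equiv K -> exists K0, [/\ equiv K0, bdiag K0 &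
  forall G, equiv G -> Th (cut u K u' *m cut u' G u) = Th (cut u K0 u' *m cut u' G u)].
Proof.
move=> uu'; move: K; apply: (pbw_ind two_neq0).
- by exists 0; split=> //; [exact: equiv0|move=> w v; rewrite kv0 eqxx].
- move=> K K' [K0 [e b H]] [K0' [e' b' H']]; exists (K0 + K0'); split; first exact: equivD.
    move=> w v; rewrite kvD; have [k0|/b //] := eqVneq (kv K0 w v) 0.
    by rewrite k0 add0r => /b'.
  by move=> G eG; rewrite !cutD !mulmxDl !(thetaD ThP) H // H'.
- move=> c K [K0 [e b H]]; exists (c *: K0); split; first exact: equivZ.
    by move=> w v; rewrite kvZ mulf_eq0 negb_or => /andP[_ /b].
  by move=> G eG; rewrite !cutZ -!scalemxAl !(thetaZ ThP) H.
move=> w0 w0'; set v0 := wmin w0 w0' => a1 a2.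
have zero : (forall G, equiv G -> Th (cut u (orb w0 v0 *m orb v0 w0') u' *m cut u' G u) = 0) ->
    exists K0, [/\ equiv K0, bdiag K0 & forall G, equiv G ->
      Th (cut u (orb w0 v0 *m orb v0 w0') u' *m cut u' G u) = Th (cut u K0 u' *m cut u' G u)].
  move=> H; exists 0; split; [exact: equiv0|by move=> w v; rewrite kv0 eqxx|].
  by move=> G eG; rewrite H // cut0 mul0mx theta0.
case: (boolP (same u w0)) => uw0; last first.
  apply: zero => G eG.
  by rewrite /cut -(orb_one w0 v0) !mulmxA one_diff ?mul0mx ?theta0.
case: (boolP (same u' w0')) => uw0'; last first.
  apply: zero => G eG.
  by rewrite /cut -(orb_one v0 w0') -!mulmxA [one w0' *m (one u' *m _)]mulmxA one_diff ?mul0mx ?mulmx0 ?theta0 // same_sym.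
case: (leqP (cnt v0 h) (cnt u h)) => le.
  exists (orb w0 v0 *m orb v0 w0'); split=> //; last exact: (bdiag_orb uw0 uw0').
  by apply: equivM; apply: equiv_orb.
(* Here [v0] has more even letters than [u], so it is bad with threshold [h]. *)
apply: zero => G eG.
have -> : cut u (orb w0 v0 *m orb v0 w0') u' *m cut u' G u =
          cut u (orb w0 v0 *m (orb v0 w0' *m cut u' G u)) u.
  by rewrite /cut !mulmxA -[_ *m one u' *m one u']mulmxA -[_ *m one u *m one u]mulmxA !one_idem.
apply: (theta_bad ThP); first exact: equiv_orb.
  by apply: equivM; [exact: equiv_orb|exact: equiv_cut].
by move=> w v; rewrite -[orb _ _]mul1mx => /kv_orb_r v0v _; exists h; rewrite -(cnt_same _ v0v).
Qed.

Lemma theta_bdiag_r u' K : cnt u h = cnt u' h -> equiv K -> exists K0, [/\ equiv K0, bdiag K0 &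
  forall G, equiv G -> Th (cut u G u' *m cut u' K u) = Th (cut u G u' *m cut u' K0 u)].
Proof.
move=> uu'; move: K; apply: (pbw_ind two_neq0).
- by exists 0; split=> //; [exact: equiv0|move=> w v; rewrite kv0 eqxx].
- move=> K K' [K0 [e b H]] [K0' [e' b' H']]; exists (K0 + K0'); split; first exact: equivD.
    move=> w v; rewrite kvD; have [k0|/b //] := eqVneq (kv K0 w v) 0.
    by rewrite k0 add0r => /b'.
  by move=> G eG; rewrite !cutD !mulmxDr !(thetaD ThP) H // H'.
- move=> c K [K0 [e b H]]; exists (c *: K0); split; first exact: equivZ.
    by move=> w v; rewrite kvZ mulf_eq0 negb_or => /andP[_ /b].
  by move=> G eG; rewrite !cutZ -!scalemxAr !(thetaZ ThP) H.
move=> w0 w0'; set v0 := wmin w0 w0' => a1 a2.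
have zero : (forall G, equiv G -> Th (cut u G u' *m cut u' (orb w0 v0 *m orb v0 w0') u) = 0) ->
    exists K0, [/\ equiv K0, bdiag K0 & forall G, equiv G ->
      Th (cut u G u' *m cut u' (orb w0 v0 *m orb v0 w0') u) = Th (cut u G u' *m cut u' K0 u)].
  move=> H; exists 0; split; [exact: equiv0|by move=> w v; rewrite kv0 eqxx|].
  by move=> G eG; rewrite H // cut0 mulmx0 theta0.
case: (boolP (same u' w0)) => uw0; last first.
  apply: zero => G eG.
  by rewrite /cut -(orb_one w0 v0) !mulmxA -[_ *m one u' *m one w0]mulmxA one_diff ?mulmx0 ?mul0mx ?theta0.
case: (boolP (same u w0')) => uw0'; last first.
  apply: zero => G eG.
  by rewrite /cut -(orb_one v0 w0') -!mulmxA one_diff ?mulmx0 ?theta0 // same_sym.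
case: (leqP (cnt v0 h) (cnt u h)) => le.
  exists (orb w0 v0 *m orb v0 w0'); split=> //; first by apply: equivM; apply: equiv_orb.
  by apply: (bdiag_orb uw0 uw0'); rewrite -uu'.
apply: zero => G eG.
have -> : cut u G u' *m cut u' (orb w0 v0 *m orb v0 w0') u =
          cut u (cut u G u' *m orb w0 v0 *m orb v0 w0') u.
  by rewrite /cut !mulmxA -[_ *m one u' *m one u']mulmxA !one_idem.
apply: (theta_bad ThP); [|exact: equiv_orb|].
  by apply: equivM; [exact: equiv_cut|exact: equiv_orb].
by move=> w v /kv_orb_r v0v _; exists h; rewrite -(cnt_same _ v0v).
Qed.

End Fixed.
End Theta.

(** * Brauer quotients *)

Section PGroupSum.
Variables (F : fieldType) (p : nat).
Hypothesis charF : p \in [pchar F].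

(* Orbits of a p-group that are not fixed points have size divisible by p. *)
Lemma sum_pgroup_fix (gT : finGroupType) (T : finType) (to : {action gT &-> T})
    (Q : {group gT}) (f : T -> F) :
    (p.-group Q)%g -> (forall s v, s \in Q -> f (to v s) = f v) ->
  \sum_v f v = \sum_(v in ('Fix_to(Q))%g) f v.
Proof.
move=> pQ inv; rewrite (bigID (mem ('Fix_to(Q))%g)) /= [X in _ + X](_ : _ = 0) ?addr0 //.
rewrite (partition_big (orbit to Q) predT) //= big1 // => O _.
case: (pickP (fun v => (v \notin ('Fix_to(Q))%g) && (orbit to Q v == O))) => [v /andP[nv /eqP vO]|H].
  rewrite (eq_bigl (mem O)) => [|x]; last first.
    apply/andP/idP => [[_ /eqP <-]|]; first exact: orbit_refl.
    rewrite -vO /= => xv; have e : orbit to Q x = orbit to Q v by apply/orbit_eqP.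
    rewrite e eqxx; split=> //; apply: contra nv => /orbit1P h.
    apply/orbit1P; rewrite -e h; congr [set _].
    by move: (orbit_refl to Q v); rewrite -e h inE => /eqP.
  rewrite (eq_bigr (fun=> f v)) => [|x]; last by rewrite -vO => /orbitP[s sQ <-]; apply: inv.
  rewrite sumr_const; have : p.-nat #|O|.
    by rewrite -vO card_orbit; apply: pnat_dvd pQ; apply: dvdn_indexg.
  case/p_natP => -[|k] Ok; last by rewrite Ok expnS mulnC mulrnA -mulr_natr (pcharf0 charF) mulr0.
  case/negP: nv; apply/orbit1P; rewrite vO; apply/eqP; rewrite eq_sym eqEcard cards1 Ok leqnn andbT.
  by rewrite sub1set -vO orbit_refl.
by rewrite big_pred0.
Qed.

End PGroupSum.

Section BlockGroup.
Variables (n : nat) (D : eqType) (cell : 'I_n -> D) (p : nat).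
Hypothesis cell_pnat : forall i, p.-nat #|[set j | cell j == cell i]|.

Definition cellgrp : {set {perm 'I_n}} := [set s : {perm 'I_n} | [forall i, cell (s i) == cell i]].

Lemma cellgrp_group : group_set cellgrp.
Proof.
apply/group_setP; split; first by rewrite inE; apply/forallP => i; rewrite perm1.
move=> s t; rewrite !inE => /forallP hs /forallP ht; apply/forallP => i.
by rewrite permM (eqP (ht _)) hs.
Qed.
Canonical cellgrp_g := Group cellgrp_group.

(** Q is a Sylow subgroup of the Young subgroup of the cells. It stays transitive on each cell
    because cell sizes are powers of p: the order of Q is the cell size times the p-part of a point
    stabiliser, and the stabiliser in Q is no larger than that p-part. *)
Lemma cell_sylow : exists Q : {group {perm 'I_n}}, [/\ (p.-group Q)%g,
  forall s i, s \in Q -> cell (s i) = cell i &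
  forall i j, cell i = cell j -> exists2 s, s \in Q & s i = j].
Proof.
have [Q sQ] := Sylow_exists p cellgrp_g; exists Q; split; first exact: pHall_pgroup sQ.
  move=> s i /(subsetP (pHall_sub sQ)); rewrite inE => /forallP/(_ i)/eqP //.
move=> i j cij; suff : j \in orbit 'P Q i by case/orbitP => s sQ' <-; exists s.
have oY : orbit 'P cellgrp i = [set k | cell k == cell i].
  apply/setP => k; rewrite inE; apply/orbitP/eqP => [[s]|e].
    by rewrite inE => /forallP/(_ i)/eqP <- <-.
  exists (tperm i k); last by rewrite /= /aperm tpermL.
  by rewrite inE; apply/forallP => x; case: tpermP => [->|->|//]; rewrite e.
suff -> : orbit 'P Q i = orbit 'P cellgrp i by rewrite oY inE cij.
apply/eqP; rewrite eqEcard imsetS ?(pHall_sub sQ) //=.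
have := card_orbit_stab 'P cellgrp_g i; have := card_orbit_stab 'P Q i.
rewrite /= => hQ hY.
have cQ : #|Q| = (#|('C_cellgrp[i | 'P])%g|`_p * #|orbit 'P cellgrp i|)%N.
  rewrite (card_Hall sQ) /= -hY partnM ?cardG_gt0 //; last by rewrite oY (cardD1 i) inE eqxx.
  by rewrite mulnC; congr (_ * _)%N; rewrite part_pnat_id // oY.
have le : (#|('C_Q[i | 'P])%g| <= #|('C_cellgrp[i | 'P])%g|`_p)%N.
  apply: dvdn_leq; first exact: part_gt0.
  rewrite -(part_pnat_id (pi := p) (n := #|('C_Q[i | 'P])%g|)); last first.
    by apply: pgroupS (pHall_pgroup sQ); apply: subsetIl.
  apply: partn_dvd => //; apply: cardSg; apply: setSI; exact: pHall_sub sQ.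
have pos : (0 < #|('C_Q[i | 'P])%g|)%N by exact: cardG_gt0.
rewrite -(leq_pmul2r pos) hQ cQ mulnC leq_mul //.
Qed.

End BlockGroup.

(* The positions are cut into consecutive intervals, the x-th one starting at [st x] with length [q x]. *)
Record blocks (p n d : nat) (cell : 'I_n -> 'I_d) (q st : 'I_d -> nat) : Prop := Blocks {
  cellE : forall i x, (cell i == x) = (st x <= i < st x + q x)%N;
  st_mono : forall x y : 'I_d, (x < y)%N -> (st x + q x <= st y)%N;
  st_bound : forall x, (st x + q x <= n)%N;
  q_pnat : forall x, p.-nat (q x) }.

Section Brauer.
Variables (F : fieldType) (L h p : nat).
Variables (n d : nat) (cell : 'I_n -> 'I_d) (q st : 'I_d -> nat).
Hypothesis blkP : blocks p cell q st.
Local Notation W n := {ffun 'I_n -> 'I_L.+1}.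
Local Notation ker n := 'M[F]_#|{: W n}|.
Local Notation equiv := (@equiv F L h _).

Lemma q_gt0 x : (0 < q x)%N.
Proof. by have /andP[] := q_pnat blkP x. Qed.

Lemma pos_lt x (o : nat) : (o < q x)%N -> (st x + o < n)%N.
Proof. by move=> lt; apply: leq_trans (st_bound blkP x); rewrite ltn_add2l. Qed.

Lemma cell_bounds i : (st (cell i) <= i < st (cell i) + q (cell i))%N.
Proof. by rewrite -(cellE blkP). Qed.

Lemma cell_lt i j : (cell i < cell j)%N -> (i < j)%N.
Proof.
move=> lt; have := st_mono blkP lt; have := cell_bounds i; have := cell_bounds j.
by lia.
Qed.

Lemma card_cell x : #|[set i | cell i == x]| = q x.
Proof.
pose f (o : 'I_(q x)) : 'I_n := Ordinal (pos_lt (ltn_ord o)).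
rewrite -[RHS]card_ord -(card_imset _ (_ : injective f)); last first.
  by move=> o o' [] /addnI /val_inj.
apply: eq_card => i; rewrite inE (cellE blkP); apply/idP/imsetP => [/andP[l u]|[o _ ->]].
  have lt : (i - st x < q x)%N by lia.
  by exists (Ordinal lt) => //; apply: val_inj => /=; lia.
by rewrite /= leq_addr ltn_add2l ltn_ord.
Qed.

Definition infl (y : W d) : W n := [ffun i => y (cell i)].

Lemma card_infl (v : W d) (P : pred 'I_L.+1) :
  #|[set i | P (infl v i)]| = (\sum_(x | P (v x)) q x)%N.
Proof.
rewrite -sum1_card (partition_big cell (fun x => P (v x))) /=.
  apply: eq_bigr => x vx; rewrite -card_cell -sum1_card; apply: eq_bigl => i.
  by rewrite !inE ffunE; case: eqP => [->|]; rewrite ?vx ?andbF.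
by move=> i; rewrite inE ffunE.
Qed.

Definition Br (K : ker n) : ker d := mkk (fun y y' => kv K (infl y) (infl y')).

Lemma kv_Br K y y' : kv (Br K) y y' = kv K (infl y) (infl y').
Proof. by rewrite kv_mkk. Qed.

Lemma BrD K K' : Br (K + K') = Br K + Br K'.
Proof. by apply: kvP => y y'; rewrite kvD !kv_Br kvD. Qed.

Lemma BrZ c K : Br (c *: K) = c *: Br K.
Proof. by apply: kvP => y y'; rewrite kvZ !kv_Br kvZ. Qed.

Lemma infl_inj : injective infl.
Proof.
move=> y y' e; apply/ffunP => x; have lt := pos_lt (q_gt0 x).
have c : cell (Ordinal lt) = x.
  by apply/eqP; rewrite (cellE blkP) /= addn0 leqnn -{1}[st x]addn0 ltn_add2l q_gt0.
by move/ffunP/(_ (Ordinal lt)): e; rewrite !ffunE c.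
Qed.

Lemma inflP (v : W n) : (forall i j, cell i = cell j -> v i = v j) -> exists y, v = infl y.
Proof.
move=> cst; exists [ffun x => v (Ordinal (pos_lt (q_gt0 x)))].
apply/ffunP => i; rewrite !ffunE; apply: cst; apply/esym/eqP.
by rewrite (cellE blkP) /= addn0 leqnn -{1}[st _]addn0 ltn_add2l q_gt0.
Qed.

Section Lift.
Variable g : {perm 'I_d}.
Hypothesis qg : forall x, q (g x) = q x.

Lemma lift_lt i : (st (g (cell i)) + (i - st (cell i)) < n)%N.
Proof. by apply: pos_lt; rewrite qg; have := cell_bounds i; lia. Qed.

Definition lift_fun i : 'I_n := Ordinal (lift_lt i).

Lemma cell_lift_fun i : cell (lift_fun i) = g (cell i).
Proof.
apply/eqP; rewrite (cellE blkP) /= leq_addr ltn_add2l qg.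
by have := cell_bounds i; lia.
Qed.

Lemma lift_fun_inj : injective lift_fun.
Proof.
move=> i j e; have c : cell i = cell j.
  by apply: (@perm_inj _ g); rewrite -!cell_lift_fun e.
apply: val_inj; have /= := congr1 val e; rewrite c => /addnI.
by have := cell_bounds i; have := cell_bounds j; rewrite c; lia.
Qed.

Definition liftp : {perm 'I_n} := perm lift_fun_inj.

Lemma cell_liftp i : cell (liftp i) = g (cell i).
Proof. by rewrite permE cell_lift_fun. Qed.

Lemma act_liftp (y : W d) : act (infl y) liftp = infl (act y g).
Proof.
apply/ffunP => i; rewrite -[i](permKV liftp) actE !ffunE cell_liftp.
by rewrite permK.
Qed.

Hypothesis p_odd : odd p.

Lemma q_odd x : odd (q x).
Proof. by have /p_natP[k ->] := q_pnat blkP x; rewrite oddX p_odd orbT. Qed.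

(** The lift moves blocks rigidly, so inversions occur only between different blocks. An inverted
    pair of blocks accounts for as many as the product of the two lengths, an odd number. *)
Lemma eps_liftp (y : W d) : eps F (oset h (infl y)) liftp = eps F (oset h y) g.
Proof.
have -> : eps F (oset h y) g = \prod_(xy in invs (oset h y) g) (-1) ^+ (q xy.1 * q xy.2).
  rewrite /eps -prodr_const; apply: eq_bigr => xy _.
  by rewrite -signr_odd oddM !q_odd expr1.
rewrite -(big_morph _ (exprD (-1 : F)) (expr0 (-1))) /eps; congr (_ ^+ _).
rewrite -sum1_card (partition_big (fun ij => (cell ij.1, cell ij.2)) (mem (invs (oset h y) g))) /=.
  apply: eq_bigr => -[x x']; rewrite !inE /= => /and4P[ox ox' lt gt].
  rewrite -!card_cell -cardsX -sum1_card; apply: eq_bigl => -[i j].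
  rewrite !inE /= !ffunE xpair_eqE; apply/andP/andP => [[_ /andP[]]//|[/eqP ci /eqP cj]].
  rewrite ci cj !eqxx ox ox' /= (cell_lt (_ : cell i < cell j)%N) ?ci ?cj //=; split=> //.
  by apply: cell_lt; rewrite !cell_liftp ci cj.
move=> [i j]; rewrite !inE /= !ffunE => /and4P[-> -> lt gt] /=.
have gt' : (lift_fun j < lift_fun i)%N by move: gt; rewrite !permE.
have nc : cell i != cell j.
  apply/eqP => c; move: gt'; rewrite /= c; have := cell_bounds i; have := cell_bounds j.
  by rewrite c; lia.
have lec : (cell i < cell j)%N.
  rewrite ltn_neqAle nc /= leqNgt; apply/negP => /cell_lt; lia.
rewrite lec /= ltn_neqAle -!cell_liftp; apply/andP; split.
  by rewrite !cell_liftp val_eqE (inj_eq perm_inj) eq_sym.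
by rewrite leqNgt; apply/negP => /cell_lt; lia.
Qed.

Lemma Br_equiv K y y' : equiv K ->
  kv (Br K) (act y g) (act y' g) = eps F (oset h y) g * eps F (oset h y') g * kv (Br K) y y'.
Proof. by move=> eK; rewrite !kv_Br -!act_liftp eK !eps_liftp. Qed.

End Lift.

Hypothesis p_odd : odd p.
Hypothesis charF : p \in [pchar F].

(* The words fixed by a transitive p-group on each block are the inflated ones; signs play no role since
   elements of odd order act without sign. *)
Lemma BrM K K' : equiv K -> equiv K' -> Br (K *m K') = Br K *m Br K'.
Proof.
move=> eK eK'; apply: kvP => y y'; rewrite kv_Br !kvM.
have [|Q [pQ Qcell Qtr]] := @cell_sylow n _ cell p.
  by move=> i; rewrite card_cell (q_pnat blkP).
pose to : {action {perm 'I_n} &-> W n} := TotalAction (@act1 _ _) (@actM _ _).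
have Qinfl s z : s \in Q -> act (infl z) s = infl z.
  by move=> sQ; apply/act_stabP/forallP => i; rewrite !ffunE Qcell.
have Qeps s z : s \in Q -> eps F (oset h (infl z)) s = 1.
  move=> sQ; apply: eps_odd_order; first by rewrite -oset_act Qinfl.
  have : p.-nat #[s]%g by apply: pnat_dvd pQ; apply: order_dvdG.
  by case/p_natP => k ->; rewrite oddX p_odd orbT.
rewrite (sum_pgroup_fix charF (to := to) pQ) => [|s v sQ /=]; last first.
  rewrite -{1}(Qinfl s y sQ) -{1}(Qinfl s y' sQ) eK eK' !Qeps // mul1r mulr1.
  by rewrite mulrACA eps_sq mul1r.
rewrite (eq_bigl (mem [set infl z | z : W d])) => [|v]; last first.
  apply/afixP/imsetP => [fx|[z _ ->] s sQ]; last exact: Qinfl.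
  have [i j cij|z ->] := inflP (v := v); last by exists z.
  have [s sQ <-] := Qtr i j cij.
  by have /act_stabP/forallP/(_ i)/eqP -> := fx s sQ.
rewrite big_imset /=; last by move=> ? ? _ _; apply: infl_inj.
by apply: eq_big => [z|z _]; rewrite ?inE // !kv_Br.
Qed.

End Brauer.

(** * James's theorem for signed modules *)

Section James.
Variables (F : fieldType) (L h p : nat).
Hypothesis p_odd : odd p.
Hypothesis charF : p \in [pchar F].
Hypothesis two_neq0 : (2%:R : F) != 0.
Variables (n d : nat) (cell : 'I_n -> 'I_d) (q st : 'I_d -> nat).
Hypothesis blkP : blocks p cell q st.
Local Notation W n := {ffun 'I_n -> 'I_L.+1}.
Local Notation ker n := 'M[F]_#|{: W n}|.
Local Notation equiv := (@equiv F L h _).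
(** The blocks are seen as the cells of a tableau with columns [col], and [u0] records the rows,
    shifted by [h] in odd columns. A column has one block length and one parity; its letters are
    distinct and leave no gap above the first letter of their parity. Odd blocks have length > 1
    because they come from [p mu]. *)
Variables (C : finType) (col : 'I_d -> C) (u0 : W d).
Hypothesis col_q : forall x y, col x = col y -> q x = q y.
Hypothesis col_par : forall x y, col x = col y -> (h <= u0 x)%N = (h <= u0 y)%N.
Hypothesis col_inj : forall x y, col x = col y -> u0 x = u0 y -> x = y.
Hypothesis col_down : forall x (t : nat), (t <= u0 x)%N -> (h <= t)%N = (h <= u0 x)%N ->
  exists2 y, col y = col x & u0 y = t :> nat.
Hypothesis odd_q : forall x, (h <= u0 x)%N -> (1 < q x)%N.
Local Notation inf := (infl (L := L) cell).
Local Notation Br := (Br (F := F) (L := L) cell).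

Definition colgrp : {set {perm 'I_d}} := [set g : {perm 'I_d} | [forall x, col (g x) == col x]].

(* The sign of [g] together with the sign of its action on the word [u0] antisymmetrises the even columns
   and symmetrises the odd ones, whose letters already anticommute. *)
Definition james (K : ker n) : F :=
  \sum_(g in colgrp) (-1) ^+ g * kv (Br K) (act u0 g) u0.

Lemma colgrpP g x : g \in colgrp -> col (g x) = col x.
Proof. by rewrite inE => /forallP/(_ x)/eqP. Qed.

Lemma colgrpVP g x : g \in colgrp -> col (g^-1%g x) = col x.
Proof. by move=> gG; rewrite -{2}[x](permKV g) (colgrpP _ gG). Qed.

Lemma colgrp_q g x : g \in colgrp -> q (g x) = q x.
Proof. by move=> gG; apply: col_q; apply: colgrpP. Qed.

Lemma same_infl_act g : g \in colgrp -> same (inf u0) (inf (act u0 g)).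
Proof.
move=> gG; apply/sameP; exists (liftp blkP (fun x => colgrp_q x gG)).
by rewrite act_liftp.
Qed.

Lemma jamesD K K' : james (K + K') = james K + james K'.
Proof. by rewrite /james -big_split /=; apply: eq_bigr => g _; rewrite BrD kvD mulrDr. Qed.

Lemma jamesZ c K : james (c *: K) = c * james K.
Proof. by rewrite /james mulr_sumr; apply: eq_bigr => g _; rewrite BrZ kvZ mulrCA. Qed.

(** Letters within a column are distinct, so only g = 1 in the column group fixes [u0]. *)
Lemma james1 : james (one F (inf u0)) = 1.
Proof.
rewrite /james (bigD1 1%g) /=; last by rewrite inE; apply/forallP => x; rewrite perm1.
rewrite odd_perm1 expr0 mul1r act1 kv_Br kv_one eqxx same_refl big1 ?addr0 // => g /andP[gG g1].
rewrite kv_Br kv_one; case: eqP => [e|]; last by rewrite mulr0.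
case/negP: g1; apply/eqP/permP => x; rewrite perm1.
apply: col_inj; first exact: colgrpP.
by have /act_stabP/forallP/(_ x)/eqP := infl_inj blkP e.
Qed.

Lemma kv_Br_cut (u u' : W n) K y y' :
  kv (Br (cut u K u')) y y' = (same u (inf y) && same u' (inf y'))%:R * kv (Br K) y y'.
Proof. by rewrite !kv_Br kv_cut. Qed.

(** A block of length > 1 offers two positions at which both inflated words are constant, so
    [equiv_parity] applies. *)
Lemma Br_parity K v v' x : equiv K -> kv (Br K) v v' != 0 -> (1 < q x)%N ->
  (h <= v x)%N = (h <= v' x)%N.
Proof.
rewrite kv_Br => eK nz q1.
have l0 := pos_lt blkP (ltnW q1); have l1 := pos_lt blkP q1.
have c0 : cell (Ordinal l0) = x.
  by apply/eqP; rewrite (cellE blkP) /= leq_addr ltn_add2l ltnW.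
have c1 : cell (Ordinal l1) = x.
  by apply/eqP; rewrite (cellE blkP) /= leq_addr ltn_add2l.
have := equiv_parity two_neq0 eK nz (x := Ordinal l0) (y := Ordinal l1).
rewrite !ffunE c0 c1; apply=> //.
by rewrite -val_eqE /= addn0 addn1 neq_ltn ltnSn.
Qed.

(* The transposition of [x] and [y] changes the sign of every term. *)
Lemma sum_colgrp_tperm K (v : W d) x y : equiv K -> x != y -> col x = col y -> v x = v y ->
  (h <= v x)%N = (h <= u0 x)%N -> \sum_(g in colgrp) (-1) ^+ g * kv (Br K) (act u0 g) v = 0.
Proof.
move=> eK xy cxy vxy par; set S := \sum_(g in _) _.
have tG : tperm x y \in colgrp.
  by rewrite inE; apply/forallP => z; case: tpermP => // ->; rewrite cxy.
suff SN : S = - S.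
  have : 2%:R * S = 0 by rewrite mulr_natl mulr2n {1}SN addNr.
  by move/eqP; rewrite mulf_eq0 (negbTE two_neq0) => /eqP.
rewrite {1}/S (reindex_inj (mulIg (tperm x y))) /= -sumrN; apply: eq_big => [g|g gG].
  rewrite !inE; apply: eq_forallb => z; rewrite permM.
  by case: tpermP => // ->; rewrite cxy.
have {}gG : g \in colgrp.
  move: gG; rewrite !inE => /forallP H; apply/forallP => z; move: (H z); rewrite permM.
  by case: tpermP => // ->; rewrite cxy.
rewrite actM -{1}(tperm_stab vxy) (Br_equiv blkP (fun z => colgrp_q z tG) p_odd _ _ eK).
rewrite odd_permM odd_tperm xy addbT signrN mulNr; congr (- _); congr (_ * _).
have e1 : (x \in oset h (act u0 g)) = (h <= u0 x)%N.
  by rewrite inE ffunE; apply: col_par; apply: colgrpVP.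
have e2 : (y \in oset h (act u0 g)) = (h <= u0 x)%N.
  by rewrite inE ffunE; apply: col_par; rewrite (colgrpVP _ gG).
have e3 : (x \in oset h v) = (h <= u0 x)%N by rewrite inE par.
have e4 : (y \in oset h v) = (h <= u0 x)%N by rewrite inE -vxy par.
case E: (h <= u0 x)%N.
  by rewrite !eps_tperm_in ?e1 ?e2 ?e3 ?e4 // mulrNN mulr1 mul1r.
by rewrite !eps_tperm_out ?e1 ?e2 ?e3 ?e4 ?E // mulr1 mul1r.
Qed.

(** The comparison is made column by column. If all letters of [u0] in the column are below k, every
    cell is counted for [u0]. Otherwise the letters of [v] below k are distinct and lie between the
    lowest letter of the column and k, a range that [u0] exhausts. *)
Lemma col_cnt (v : W d) k :
    (forall x, (1 < q x)%N -> (h <= v x)%N = (h <= u0 x)%N) ->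
    (forall x y, x != y -> col x = col y -> v x = v y -> (h <= v x)%N != (h <= u0 x)%N) ->
  (cnt (inf v) k <= cnt (inf u0) k)%N.
Proof.
move=> par dist; rewrite /cnt !(card_infl blkP _ (fun t : 'I_L.+1 => t < k)%N).
rewrite (partition_big col predT) //= [X in (_ <= X)%N](partition_big col predT) //=.
apply: leq_sum => c _.
pose A := [set x | (v x < k)%N && (col x == c)].
pose B := [set x | (u0 x < k)%N && (col x == c)].
suff le : (#|A| <= #|B|)%N.
  case: (set_0Vmem [set x | col x == c]) => [e0|[z]].
    by rewrite big1 // => x /andP[_ cx]; have := in_set0 x; rewrite -e0 inE cx.
  rewrite inE => /eqP cz.
  rewrite (eq_bigr (fun=> q z)) => [|x /andP[_ /eqP cx]]; last by apply: col_q; rewrite cx.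
  rewrite [X in (_ <= X)%N](eq_bigr (fun=> q z)) => [|x /andP[_ /eqP cx]]; last by apply: col_q; rewrite cx.
  rewrite !sum_nat_const leq_mul2r; apply/orP; right.
  have cE (P : pred 'I_d) : #|[set x | P x]| = #|P| by apply: eq_card => x; rewrite inE.
  by move: le; rewrite !cE.
case: (pickP (fun z => (col z == c) && (k <= u0 z)%N)) => [z /andP[/eqP cz kz]|all]; last first.
  apply: subset_leq_card; apply/subsetP => x; rewrite !inE => /andP[_ cx].
  by have := all x; rewrite cx ltnNge => /= ->.
pose t0 := if (h <= u0 z)%N then h else 0%N.
pose T := [set t : 'I_L.+1 | (t0 <= t < k)%N].
(* In an odd column the blocks are long and [par] applies. In an even one k is at most an even
   letter, so v x is even as well. *)
have pA x : x \in A -> (h <= v x)%N = (h <= u0 x)%N.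
  rewrite inE => /andP[vk /eqP cx].
  have pz : (h <= u0 x)%N = (h <= u0 z)%N by apply: col_par; rewrite cx.
  case: (boolP (h <= u0 x)%N) => [o|e]; first by rewrite par ?o //; apply: odd_q.
  by rewrite pz in e; apply/negbTE; rewrite -!ltnNge in e *; lia.
apply: (@leq_trans #|T|).
  rewrite -(card_in_imset (f := v)) => [|x y xA yA vxy].
    apply: subset_leq_card; apply/subsetP => _ /imsetP[x xA ->].
    have pz : (h <= u0 x)%N = (h <= u0 z)%N.
      by apply: col_par; move: xA; rewrite inE => /andP[_ /eqP ->].
    have := pA x xA; rewrite pz /T /t0; move: xA; rewrite !inE => /andP[-> _] pv.
    by rewrite andbT; case: ifP => // o; rewrite pv.
  apply/eqP; apply: contraT => xy; have := dist x y xy.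
  rewrite (pA x xA) eqxx; apply=> //.
  by move: xA yA; rewrite !inE => /andP[_ /eqP ->] /andP[_ /eqP ->].
apply: leq_trans (leq_imset_card u0 B); apply: subset_leq_card; apply/subsetP => t.
rewrite inE => /andP[t0t tk].
have [||y cy uy] := @col_down z t.
- exact: leq_trans (ltnW tk) kz.
- by move: t0t; rewrite /t0; case: ifP => [o ->//|]; lia.
have ut : u0 y = t by apply: val_inj.
by rewrite -ut; apply: imset_f; rewrite inE ut tk cy cz eqxx.
Qed.

(** A word v with a nonzero term would satisfy the hypotheses of [col_cnt]: the parities agree
    because [Br G] is nonzero at (v, u0), and letters are distinct because otherwise a transposition
    within a column cancels the alternating sum. Then v is not bad. *)
Lemma james_theta : theta h (inf u0) james.
Proof.
split; [exact: jamesD|exact: jamesZ|exact: james1|move=> E G eE eG bd].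
have -> : james (cut (inf u0) (E *m G) (inf u0)) =
    \sum_(g in colgrp) (-1) ^+ g * \sum_v kv (Br E) (act u0 g) v * kv (Br G) v u0.
  apply: eq_bigr => g gG; congr (_ * _).
  by rewrite kv_Br_cut same_infl_act // same_refl mul1r (BrM blkP p_odd charF eE eG) kvM.
rewrite (eq_bigr (fun g : {perm 'I_d} => \sum_v
   ((-1) ^+ g * kv (Br E) (act u0 g) v) * kv (Br G) v u0)) => [|g _]; last first.
  by rewrite mulr_sumr; apply: eq_bigr => v _; rewrite mulrA.
rewrite exchange_big /= big1 // => v _; rewrite -mulr_suml.
set S := \sum_(g in _) _; apply/eqP; rewrite mulf_eq0; apply/norP => -[Sn Gn].
have par x : (1 < q x)%N -> (h <= v x)%N = (h <= u0 x)%N by apply: Br_parity eG Gn.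
have dist x y : x != y -> col x = col y -> v x = v y -> (h <= v x)%N != (h <= u0 x)%N.
  move=> xy cxy vxy; apply: contraNN Sn => /eqP e.
  by rewrite /S (sum_colgrp_tperm eE xy cxy vxy e).
have [g gG En] : exists2 g, g \in colgrp & kv (Br E) (act u0 g) v != 0.
  apply/exists_inP; apply: contraNT Sn; rewrite negb_exists_in => /forall_inP H.
  by apply/eqP/big1 => g gG; have := H g gG; rewrite negbK => /eqP ->; rewrite mulr0.
rewrite kv_Br in En.
have [k] := bd _ _ En (same_infl_act gG).
by rewrite ltnNge (col_cnt _ par dist).
Qed.

(** Being multiplicative, [Br] turns the composite into a sum over words on the blocks, and any
    nonzero term supplies v. *)
Lemma james_neq0 (u' : W n) K K' : equiv K -> equiv K' ->
    james (cut (inf u0) K u' *m cut u' K' (inf u0)) != 0 ->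
  exists v, same u' (inf v) /\ forall x, (1 < q x)%N -> (h <= v x)%N = (h <= u0 x)%N.
Proof.
move=> eK eK' nz.
have [g gG] : exists2 g, g \in colgrp &
    kv (Br (cut (inf u0) K u' *m cut u' K' (inf u0))) (act u0 g) u0 != 0.
  apply/exists_inP; apply: contraNT nz; rewrite negb_exists_in => /forall_inP H.
  by apply/eqP/big1 => g gG; have := H g gG; rewrite negbK => /eqP ->; rewrite mulr0.
rewrite (BrM blkP p_odd charF (equiv_cut _ _ eK) (equiv_cut _ _ eK')) kvM => nz'.
have [v] : exists v, kv (Br (cut (inf u0) K u')) (act u0 g) v * kv (Br (cut u' K' (inf u0))) v u0 != 0.
  apply/existsP; apply: contraNT nz'; rewrite negb_exists => /forallP H.
  by apply/eqP/big1 => v _; have := H v; rewrite negbK => /eqP.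
rewrite mulf_eq0 negb_or !kv_Br_cut !mulf_eq0 !negb_or => /andP[/andP[s1 _] /andP[_ n2]].
exists v; split; last by move=> x; apply: Br_parity eK' n2.
by move: s1; case: (same u' _) => //; rewrite andbF eqxx.
Qed.

End James.

(** * Multiplicities of a summand as the rank of a form *)

Section LocalAlgebra.
Variable F : fieldType.

Record subalg d (S : 'M[F]_d -> Prop) : Prop := Subalg {
  sub1 : S 1%:M;
  subD : forall x y, S x -> S y -> S (x + y);
  subZ : forall c x, S x -> S (c *: x);
  subM : forall x y, S x -> S y -> S (x *m y) }.

(** By [fitting] this makes e S e local: each of its elements is nilpotent or invertible. *)
Record primitive d (S : 'M[F]_d -> Prop) (e : 'M[F]_d) : Prop := Primitive {
  prim_sub : S e;
  prim_idem : e *m e = e;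
  prim_neq0 : e != 0;
  prim_min : forall f, S f -> e *m f = f -> f *m e = f -> f *m f = f -> f = 0 \/ f = e }.

(* If X^m r is the characteristic polynomial of [x] with r(0) <> 0, Bezout for X^(m+1) and r gives an
   idempotent polynomial in [x] lying in e S e. *)
Lemma fitting d (S : 'M[F]_d -> Prop) e x : subalg S -> primitive S e -> S x ->
    e *m x = x -> x *m e = x ->
  (exists N, x ^+ N = 0) \/
  (exists j, [/\ S j, e *m j = j, j *m e = j & x *m j = e]).
Proof.
(* Polynomial evaluation needs matrices of size [d.+1]; size 0 is excluded by e being nonzero. *)
case: d S e x => [|d] S e x sS pe Sx ex xe.
  by case/eqP: (prim_neq0 pe); apply/matrixP => -[].
have Sh r : S (horner_mx x r).
  elim/poly_ind: r => [|r c IH]; first by rewrite rmorph0 -(scale0r 1%:M); apply: (subZ sS); apply: sub1.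
  rewrite rmorphD rmorphM /= horner_mx_X horner_mx_C; apply: (subD sS).
    by apply: (subM sS).
  by rewrite -[c%:M]scalemx1; apply: (subZ sS); apply: sub1.
case: (multiplicity_XsubC (char_poly x) 0) => m [r]; rewrite (monic_neq0 (char_poly_monic x)) /=.
rewrite polyC0 subr0 => r0 cE.
have cop : coprimep ('X ^+ m.+1) r by rewrite coprimep_expl // coprimep_sym coprimepX.
have [[u v] /= uv] := Bezout_eq1_coprimepP _ _ cop.
set H := horner_mx x (u * 'X ^+ m); pose E := horner_mx x (u * 'X^(m.+1)).
have EHx : E = H * x by rewrite /E /H exprSr mulrA rmorphM /= horner_mx_X.
have ExH : E = x * H by rewrite /E /H exprSr mulrA mulrC rmorphM /= horner_mx_X.
have z : horner_mx x ('X^(m.+1) * r) = 0.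
  rewrite exprS -mulrA [_ * r]mulrC -cE rmorphM /= Cayley_Hamilton mulr0 //.
have EE : E * E = E.
  have : E * (1 - E) = 0.
    have -> : 1 - E = horner_mx x (v * r).
      by rewrite -(rmorph1 (horner_mx x)) -uv rmorphD /= addrAC subrr add0r.
    by rewrite /E -rmorphM /= mulrACA rmorphM /= z mulr0.
  by rewrite mulrBr mulr1 => /eqP; rewrite subr_eq0 eq_sym => /eqP.
have SE : S E by apply: Sh.
have eE : e *m E = E by rewrite ExH -mulmxE mulmxA ex.
have Ee : E *m e = E by rewrite EHx -mulmxE -mulmxA xe.
case: (prim_min pe SE eE Ee EE) => E0; [left|right].
  exists m.+1; rewrite -[x ^+ _]mulr1 -(rmorph1 (horner_mx x)) -uv rmorphD /= -/E E0 add0r.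
  by rewrite -{1}(horner_mx_X x) -rmorphXn -rmorphM /= mulrCA rmorphM /= z mulr0.
exists (e *m H *m e); split.
- have Se := prim_sub pe; apply: (subM sS) => //; apply: (subM sS) => //; exact: Sh.
- by rewrite !mulmxA (prim_idem pe).
- by rewrite -mulmxA (prim_idem pe).
by rewrite !mulmxA xe mulmxE -ExH -mulmxE Ee E0.
Qed.

(** If x k is not invertible in the local algebra e S e, it is nilpotent, and y k = e - x k is
    inverted by the geometric series [t]. *)
Lemma local_add d (S : 'M[F]_d -> Prop) e x y j : subalg S -> primitive S e ->
    S x -> e *m x = x -> x *m e = x -> S y -> e *m y = y -> y *m e = y ->
    S j -> (x + y) *m j = e ->
  (exists2 i, S i & x *m i = e) \/ (exists2 i, S i & y *m i = e).
Proof.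
move=> sS pe Sx ex xe Sy ey ye Sj xyj.
pose k := e *m j *m e.
have Se := prim_sub pe.
have Sk : S k by do 2![apply: (subM sS) => //].
have xyk : x *m k + y *m k = e.
  rewrite -mulmxDl /k !mulmxA mulmxDl xe ye xyj; exact: prim_idem pe.
have Sxk : S (x *m k) by apply: (subM sS).
have exk : e *m (x *m k) = x *m k by rewrite mulmxA ex.
have ke : k *m e = k by rewrite /k -mulmxA (prim_idem pe).
clearbody k.
have xke : x *m k *m e = x *m k by rewrite -mulmxA ke.
case: (fitting sS pe Sxk exk xke) => [[N xN]|[i [Si _ _ xi]]]; last first.
  by left; exists (k *m i); [apply: (subM sS)|rewrite mulmxA].
right; set z := x *m k in xyk exk xke xN Sxk.
pose t : 'M_d := \sum_(i < N) z ^+ i.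
have St : S t.
  rewrite /t; elim/big_ind: _ => [|a b|i _]; [|exact: subD|].
    by rewrite -(scale0r 1%:M); apply: (subZ sS); apply: sub1.
  elim: (i : nat) => [|l IH]; first by rewrite expr0; apply: sub1.
  by rewrite exprS; apply: (subM sS).
have zt : (1%:M - z) *m t = 1%:M.
  have := subrX1 z N; rewrite xN sub0r -/t => h1.
  by rewrite -opprB mulNmx mulmxE -[X in - X]h1 opprK.
exists (k *m t *m e); first by apply: (subM sS); [apply: (subM sS)|exact: prim_sub pe].
have yk : y *m k = e *m (1%:M - z) by rewrite mulmxBr mulmx1 exk -xyk addrC addKr.
by rewrite 2!mulmxA yk -[e *m _ *m t]mulmxA zt mulmx1 (prim_idem pe).
Qed.

Lemma local_sum d (S : 'M[F]_d -> Prop) e (I : eqType) (s : seq I) (x : I -> 'M[F]_d) j :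
    subalg S -> primitive S e ->
    {in s, forall i, [/\ S (x i), e *m x i = x i & x i *m e = x i]} ->
    S j -> (\sum_(i <- s) x i) *m j = e ->
  exists2 i, i \in s & exists2 k, S k & x i *m k = e.
Proof.
move=> sS pe; elim: s j => [|i s IH] j H Sj.
  by rewrite big_nil mul0mx => e0; case/eqP: (prim_neq0 pe).
rewrite big_cons => Hj; have [Sx ex xe] := H i (mem_head _ _).
have Hs : {in s, forall i, [/\ S (x i), e *m x i = x i & x i *m e = x i]}.
  by move=> l ls; apply: H; rewrite inE ls orbT.
have [Sy ey ye] : [/\ S (\sum_(i <- s) x i), e *m (\sum_(i <- s) x i) = \sum_(i <- s) x i
    & (\sum_(i <- s) x i) *m e = \sum_(i <- s) x i].
  split; rewrite ?mulmx_sumr ?mulmx_suml big_seq.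
  - elim/big_ind: _ => [|a b|l /Hs[]//]; [|exact: subD].
    by rewrite -(scale0r 1%:M); apply: (subZ sS); apply: sub1.
  - by rewrite [RHS]big_seq; apply: eq_bigr => l /Hs[].
  - by rewrite [RHS]big_seq; apply: eq_bigr => l /Hs[].
case: (local_add sS pe Sx ex xe Sy ey ye Sj Hj) => [[k Sk xk]|[k Sk yk]].
  by exists i; [exact: mem_head|exists k].
have [l ls [k' Sk' xk']] := IH k Hs Sk yk.
by exists l; [rewrite inE ls orbT|exists k'].
Qed.

Section Multiplicity.
Variables (d : nat) (S : 'M[F]_d -> Prop) (Th : 'M[F]_d -> F) (w w' e : 'M[F]_d).
Hypothesis sS : subalg S.
Hypothesis Th_sum : forall (I : finType) (P : pred I) x, Th (\sum_(i : I | P i) x i) = \sum_(i | P i) Th (x i).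
Hypothesis Th0 : Th 0 = 0.
Hypothesis ThM : forall x y, S x -> S y -> w *m x = x -> x *m w = x -> w *m y = y -> y *m w = y ->
  Th (x *m y) = Th x * Th y.
Hypothesis pe : primitive S e.
Hypothesis we : w *m e = e.
Hypothesis ew : e *m w = e.
Hypothesis Th_e : Th e = 1.
Variables (m : nat) (P : 'I_m -> 'M[F]_d).
Hypothesis pP : forall i, primitive S (P i).
Hypothesis P_orth : forall i j, i != j -> P i *m P j = 0.
Hypothesis P_sum : \sum_i P i = w'.
Variable A : {set 'I_m}.
Hypothesis AP : forall i, i \in A <-> exists a b, [/\ S a, S b, a *m b = e & b *m a = P i].

(** Were the value nonzero, [z] could not be nilpotent, so it would be invertible in e S e. Then [e]
    would factor through the primitive idempotent [P i], making the two equivalent and putting i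
    into [A]. *)
Lemma theta_summand f g i : S f -> S g -> w *m f = f -> g *m w = g ->
  i \notin A -> Th (f *m P i *m g) = 0.
Proof.
move=> Sf Sg wf gw niA; apply/eqP; apply: contraNT niA => nz.
have SP := prim_sub (pP i); have Se := prim_sub pe.
have Sfg : S (f *m P i *m g) by do 2![apply: (subM sS) => //].
pose z := e *m (f *m P i *m g) *m e.
have Sz : S z by do 2![apply: (subM sS) => //].
have ez : e *m z = z by rewrite /z !mulmxA (prim_idem pe).
have ze : z *m e = z by rewrite /z -!mulmxA (prim_idem pe).
have wz : w *m z = z by rewrite -ez mulmxA we.
have zw : z *m w = z by rewrite -ze -mulmxA ew.
have wfg : w *m (f *m P i *m g) = f *m P i *m g by rewrite !mulmxA wf.
have fgw : f *m P i *m g *m w = f *m P i *m g by rewrite -!mulmxA gw.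
have Thz : Th z = Th (f *m P i *m g).
  rewrite /z; move: Sfg wfg fgw; move: (f *m P i *m g) => x Sx wx xw.
  have Sex : S (e *m x) by apply: (subM sS).
  rewrite ThM //; first by rewrite ThM // Th_e mul1r mulr1.
    by rewrite mulmxA we.
  by rewrite -mulmxA xw.
case: (fitting sS pe Sz ez ze) => [[N zN]|[j [Sj ej je zj]]].
  have pw k : S (z ^+ k.+1) /\ w *m z ^+ k.+1 = z ^+ k.+1 /\ z ^+ k.+1 *m w = z ^+ k.+1 /\
      Th (z ^+ k.+1) = Th z ^+ k.+1.
    elim: k => [|k [IS [Il [Ir IT]]]]; first by rewrite !expr1.
    have -> : z ^+ k.+2 = z *m z ^+ k.+1 by rewrite [LHS]exprS.
    split; first exact: (subM sS).
    by rewrite mulmxA wz -mulmxA Ir; do !split => //; rewrite ThM // IT -exprS.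
  have [_ [_ [_]]] := pw N; rewrite exprS zN mulr0 Th0 => /esym/eqP.
  by rewrite expf_eq0 /= Thz (negbTE nz).
apply/AP; exists (e *m f *m P i), (P i *m g *m e *m j).
have ab : e *m f *m P i *m (P i *m g *m e *m j) = e.
  by rewrite -[RHS]zj /z !mulmxA -[_ *m P i *m P i]mulmxA (prim_idem (pP i)).
have Sb : S (P i *m g *m e *m j) by do 3![apply: (subM sS) => //].
have Sa : S (e *m f *m P i) by do 2![apply: (subM sS) => //].
split=> //; set a := e *m f *m P i in ab Sa *; set b := P i *m g *m e *m j in ab Sb *.
have be : b *m e = b by rewrite /b -!mulmxA je.
case: (prim_min (pP i) (subM sS Sb Sa)) => //.
- by rewrite /b !mulmxA (prim_idem (pP i)).
- by rewrite /a -!mulmxA (prim_idem (pP i)).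
- by rewrite mulmxA -[b *m a *m b]mulmxA ab be.
move=> ba0; case/eqP: (prim_neq0 pe).
by rewrite -(prim_idem pe) -{1}ab -[X in _ *m X]ab mulmxA -[a *m b *m a]mulmxA ba0 mulmx0 mul0mx.
Qed.

(** The identity [w'] is the sum of the [P i]. Only i in [A] contribute to the form, and there [P i]
    is a product g f with f g = e. These f and g are dual bases, so the form has rank #|A|. *)
Lemma theta_multiplicity : exists f g : 'I_#|A| -> 'M[F]_d,
  [/\ forall i, S (f i) /\ S (g i),
      forall i, [/\ w *m f i = f i, f i *m w' = f i, w' *m g i = g i & g i *m w = g i],
      forall i j, Th (f i *m g j) = (i == j)%:R &
      forall x y, S x -> S y -> w *m x = x -> x *m w' = x -> w' *m y = y -> y *m w = y ->
        Th (x *m y) = \sum_i Th (x *m g i) * Th (f i *m y)].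
Proof.
have Se := prim_sub pe; have SP i := prim_sub (pP i).
have /fin_all_exists[ab H] : forall k : 'I_#|A|, exists ab : 'M[F]_d * 'M[F]_d,
    [/\ S ab.1, S ab.2, ab.1 *m ab.2 = e & ab.2 *m ab.1 = P (enum_val k)].
  by move=> k; have /AP[a [b [Sa Sb ab ba]]] := enum_valP k; exists (a, b).
pose f k := e *m (ab k).1 *m P (enum_val k).
pose g k := P (enum_val k) *m (ab k).2 *m e.
have Sf k : S (f k) by have [Sa _ _ _] := H k; do 2![apply: (subM sS) => //].
have Sg k : S (g k) by have [_ Sb _ _] := H k; do 2![apply: (subM sS) => //].
have wP i : w' *m P i = P i.
  rewrite -P_sum mulmx_suml (bigD1 i) //= (prim_idem (pP i)) big1 ?addr0 // => j.
  exact: P_orth.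
have Pw i : P i *m w' = P i.
  rewrite -P_sum mulmx_sumr (bigD1 i) //= (prim_idem (pP i)) big1 ?addr0 // => j ji.
  by apply: P_orth; rewrite eq_sym.
have fE k : [/\ w *m f k = f k, f k *m w' = f k, w' *m g k = g k & g k *m w = g k].
  by rewrite /f /g; split; rewrite ?mulmxA ?we ?wP // -!mulmxA ?Pw ?ew.
have fg k : f k *m g k = e.
  have [_ _ abE baE] := H k.
  rewrite /f /g !mulmxA -[_ *m P _ *m P _]mulmxA (prim_idem (pP _)) -baE.
  by rewrite !mulmxA -[e *m _ *m _]mulmxA abE -[e *m e *m _ *m _]mulmxA abE !(prim_idem pe).
have gf k : g k *m f k = P (enum_val k).
  have [_ _ abE baE] := H k.
  have bea : (ab k).2 *m e *m (ab k).1 = P (enum_val k).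
    by rewrite -abE !mulmxA baE -mulmxA baE (prim_idem (pP _)).
  rewrite /f /g !mulmxA -[_ *m e *m e]mulmxA (prim_idem pe).
  by rewrite -2![P _ *m _ *m _]mulmxA bea !(prim_idem (pP _)).
have fg0 i j : i != j -> f i *m g j = 0.
  move=> ne; rewrite /f /g !mulmxA -[_ *m P _ *m P _]mulmxA P_orth ?mulmx0 ?mul0mx //.
  by apply: contraNneq ne => /enum_val_inj ->.
clearbody f g; exists f, g; split=> // [i j|x y Sx Sy wx xw wy yw].
  by case: eqP => [<-|/eqP ne]; [rewrite fg Th_e|rewrite fg0 // Th0].
have -> : x *m y = \sum_i x *m P i *m y.
  by rewrite -mulmx_suml -mulmx_sumr P_sum xw.
rewrite Th_sum (bigID (mem A)) /= [X in _ + X]big1 ?addr0; last first.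
  by move=> i; apply: theta_summand.
rewrite big_enum_val; apply: eq_bigr => k _.
have [f1 f2 g1 g2] := fE k.
rewrite -gf -ThM; first by rewrite !mulmxA.
- exact: (subM sS).
- exact: (subM sS).
- by rewrite mulmxA wx.
- by rewrite -mulmxA g2.
- by rewrite mulmxA f1.
by rewrite -mulmxA yw.
Qed.

End Multiplicity.
End LocalAlgebra.

(** * Words attached to compositions *)

Section BaseWord.

Lemma blk_cons x c i : blk (x :: c) i = if (x <= i)%N then (blk c (i - x)).+1 else 0%N.
Proof.
rewrite /blk /= take0 addn0 (iotaDl 1 0) count_map; case: leqP => xi /=.
  rewrite add1n; congr _.+1; apply: eq_count => k /=.
  by rewrite leq_subRL.
by rewrite add0n; apply/eqP; rewrite -leqn0 leqNgt -has_count; apply/hasPn => k _ /=; lia.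
Qed.

Lemma blk_cat_l a b i : (i < sumn a)%N -> blk (a ++ b) i = blk a i /\ (blk a i < size a)%N.
Proof.
elim: a i => // x a IH i; rewrite (_ : sumn (x :: a) = (x + sumn a)%N) // => lt.
rewrite cat_cons !blk_cons; case: (leqP x i) => xi //.
by have [|-> le] := IH (i - x)%N; first by lia.
Qed.

Lemma blk_cat_r a b i : (sumn a <= i)%N -> blk (a ++ b) i = (size a + blk b (i - sumn a))%N.
Proof.
elim: a i => [|x a IH] i; first by rewrite subn0.
rewrite (_ : sumn (x :: a) = (x + sumn a)%N) // => le.
by rewrite cat_cons blk_cons ifT ?IH ?subnDA //; lia.
Qed.

Lemma count_blk c k : count (fun i => blk c i == k) (iota 0 (sumn c)) = nth 0%N c k.
Proof.
elim: c k => [|x c IH] k; first by rewrite nth_nil.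
rewrite [sumn _]/= iotaD count_cat add0n.
have -> : count (fun i => blk (x :: c) i == k) (iota 0 x) = if k is 0%N then x else 0%N.
  rewrite (eq_in_count (a2 := fun=> 0%N == k)) => [|i]; last first.
    by rewrite mem_iota blk_cons => /andP[_]; rewrite add0n ltnNge => /negbTE ->.
  by case: k => [|k]; rewrite ?count_predT ?size_iota ?count_pred0.
rewrite -[X in iota X]addn0 iotaDl count_map.
rewrite (eq_count (a2 := fun i => (blk c i).+1 == k)) => [|i]; last first.
  by rewrite /= blk_cons leq_addr addKn.
case: k => [|k] /=; first by rewrite count_pred0 addn0.
by rewrite add0n -IH; apply: eq_count.
Qed.

Lemma card_ord_count n (P : pred nat) : #|[set i : 'I_n | P i]| = count P (iota 0 n).
Proof.
rewrite -val_enum_ord count_map -sum1_count -sum1_card big_enum_cond /=.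
by apply: eq_bigl => i; rewrite inE.
Qed.

Variables (n L h : nat) (a b : seq nat).
Hypothesis ab_n : (sumn a + sumn b = n)%N.
Hypothesis a_h : (size a <= h)%N.
Hypothesis b_L : (h + size b <= L.+1)%N.

(** Letters 0, 1, ... mark the parts of [a] and letters h, h + 1, ... those of [b]. Letters from
    [size a] up to h do not occur, so that pairs of different lengths share an alphabet. *)
Definition bwn (i : nat) : nat :=
  if (i < sumn a)%N then blk a i else (h + blk b (i - sumn a))%N.

Definition bw : {ffun 'I_n -> 'I_L.+1} := [ffun i : 'I_n => inord (bwn i)].

Lemma bwn_lt i : (i < n)%N -> (bwn i < L.+1)%N.
Proof.
move=> lt; rewrite /bwn; case: ifP => [ia|/negbT ia]; first by have [_] := blk_cat_l b ia; lia.
rewrite -leqNgt in ia.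
by have [|_] := @blk_cat_l b [::] (i - sumn a); lia.
Qed.

Lemma bwE (i : 'I_n) : bw i = bwn i :> nat.
Proof. by rewrite ffunE inordK // bwn_lt. Qed.

Lemma bw_odd (i : 'I_n) : (h <= bw i)%N = (sumn a <= i)%N.
Proof.
rewrite bwE /bwn; case: ltnP => ia; last by rewrite leq_addr.
by have [_] := blk_cat_l b ia; lia.
Qed.

Lemma bw_blk (i j : 'I_n) : (bw i == bw j) = (blk (a ++ b) i == blk (a ++ b) j).
Proof.
rewrite -val_eqE /= !bwE /bwn.
case: (ltnP i) => ia; case: (ltnP j) => ja.
- by have [-> _] := blk_cat_l b ia; have [-> _] := blk_cat_l b ja.
- by have [-> ?] := blk_cat_l b ia; rewrite (blk_cat_r b ja); lia.
- by have [-> ?] := blk_cat_l b ja; rewrite (blk_cat_r b ia); lia.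
by rewrite (blk_cat_r b ia) (blk_cat_r b ja); lia.
Qed.

Lemma card_bw t : #|[set i | bw i == t :> nat]| =
  if (t < h)%N then nth 0%N a t else nth 0%N b (t - h).
Proof.
rewrite (_ : [set i | _] = [set i : 'I_n | bwn i == t]); last first.
  by apply/setP => i; rewrite !inE bwE.
rewrite (card_ord_count n (fun i => bwn i == t)) -ab_n iotaD count_cat add0n.
rewrite (eq_in_count (a2 := fun i => blk a i == t)) => [|i]; last first.
  by rewrite mem_iota add0n /bwn => /andP[_ ->].
rewrite count_blk -[X in iota X]addn0 iotaDl count_map.
rewrite (eq_count (a2 := fun i => (h + blk b i)%N == t)) => [|i]; last first.
  by rewrite /= /bwn ltnNge leq_addr addKn.
case: ltnP => th.
  rewrite (eq_count (a2 := pred0)) ?count_pred0 ?addn0 // => i /=; lia.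
rewrite nth_default ?(leq_trans a_h) // add0n -count_blk; apply: eq_count => i; lia.
Qed.

End BaseWord.

Lemma sumn_sub_take s k x : (sumn (take k s) <= k * x + sumn [seq y - x | y <- s])%N.
Proof.
elim: s k => [|y s IH] [|k] //=; rewrite ?muln0 //.
by have := IH k; rewrite mulSn; lia.
Qed.

Lemma sumn_sorted_take s k : sorted geq s ->
  (k * nth 0 s k + sumn [seq y - nth 0 s k | y <- s] = sumn (take k s))%N.
Proof.
have geq_tr : transitive geq by move=> u v w /=; lia.
elim: s k => [|y s IH] [|k] srt; rewrite ?nth_nil ?muln0 ?mul0n //.
  rewrite take0 add0n /= subnn add0n.
  have /all_pred1P -> : all (pred1 0%N) [seq z - y | z <- s]%N; last by rewrite sumn_nseq.
  apply/allP => _ /mapP[z zs ->] /=.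
  by have /= := allP (order_path_min geq_tr srt) z zs; rewrite subn_eq0.
have srt' := path_sorted srt; have := IH k srt'.
have le : (nth 0 s k <= y)%N.
  case: (ltnP k (size s)) => ks; last by rewrite nth_default.
  exact: (allP (order_path_min geq_tr srt)) (mem_nth _ ks).
change (k * nth 0 s k + sumn [seq y - nth 0 s k | y <- s] = sumn (take k s) ->
  k.+1 * nth 0 s k + (y - nth 0 s k + sumn [seq y - nth 0 s k | y <- s]) =
    y + sumn (take k s))%N => <-.
by rewrite mulSn; lia.
Qed.

(** Any k entries sum to at most k x plus all truncated differences y - x, a bound that depends only
    on the multiset. For sorted [a] and x its entry of index k, the first k entries attain it. *)
Lemma sumn_take_le s a z k : perm_eq s (a ++ nseq z 0%N) -> sorted geq a ->
  (sumn (take k s) <= sumn (take k a))%N.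
Proof.
move=> pe srt; rewrite -[X in (_ <= X)%N]sumn_sorted_take //; apply: leq_trans (sumn_sub_take s k (nth 0 a k)%N) _.
rewrite leq_add2l (perm_sumn (perm_map _ pe)) map_cat sumn_cat map_nseq sub0n sumn_nseq.
by rewrite mul0n addn0.
Qed.

(** * Pairs of partitions from contents of words *)

Section SortWord.
Variables (n L h : nat).
Local Notation W n := {ffun 'I_n -> 'I_L.+1}.
Variable v : W n.

Definition cl (t : nat) : nat := #|[set i | v i == t :> nat]|.

Definition sorted_nz (s : seq nat) : seq nat := sort geq [seq x <- s | x != 0%N].

Lemma sorted_nz_perm s : perm_eq s (sorted_nz s ++ nseq (size s - size (sorted_nz s)) 0%N).
Proof.
rewrite -(perm_filterC (fun x => x != 0%N) s) perm_sym; apply: perm_cat.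
  by rewrite perm_sort.
rewrite size_sort size_filter.
have -> : [seq x <- s | predC (fun x => x != 0%N) x] = nseq (count (predC (fun x => x != 0%N)) s) 0%N.
  rewrite -size_filter; apply/all_pred1P/allP => x; rewrite mem_filter /= negbK => /andP[] //.
by rewrite -(count_predC (fun x => x != 0%N) s) addKn.
Qed.

Lemma sorted_nz_part s : is_part (sorted_nz s).
Proof.
rewrite /is_part sort_sorted ?mem_sort ?mem_filter ?eqxx // => x y /=; lia.
Qed.

Lemma size_sorted_nz s : (size (sorted_nz s) <= size s)%N.
Proof. by rewrite size_sort size_filter count_size. Qed.

Lemma sumn_sorted_nz s : sumn (sorted_nz s) = sumn s.
Proof. by rewrite (perm_sumn (sorted_nz_perm s)) sumn_cat sumn_nseq mul0n addn0. Qed.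

(** The content of [v] is sorted within each parity because the property defining Y speaks of pairs
    of partitions only. *)
Definition wa := sorted_nz (mkseq cl h).
Definition wb := sorted_nz (mkseq (fun t => cl (h + t)) (L.+1 - h)).

Lemma cnt_cl k : cnt v k = sumn (mkseq cl k).
Proof.
elim: k => [|k IH].
  by rewrite /cnt (_ : [set i | _] = set0) ?cards0 //; apply/setP => i; rewrite !inE.
rewrite mkseqS -cats1 sumn_cat -IH /= addn0 /cnt /cl -cardsUI.
rewrite (_ : _ :&: _ = set0) ?cards0 ?addn0; last by apply/setP => i; rewrite !inE; lia.
by apply: eq_card => i; rewrite !inE; lia.
Qed.

Lemma cnt_full k : (L.+1 <= k)%N -> cnt v k = n.
Proof.
move=> le; rewrite -[RHS]card_ord /cnt -cardsT; apply: eq_card => i.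
by rewrite !inE (leq_trans (ltn_ord _)).
Qed.

Lemma mkseq_cat (f : nat -> nat) k l :
  mkseq f (k + l) = mkseq f k ++ mkseq (fun t => f (k + t)%N) l.
Proof. by rewrite /mkseq iotaD map_cat add0n -[X in iota X l]addn0 iotaDl -map_comp. Qed.

Hypothesis hL : (h <= L.+1)%N.

Lemma wab_n : (sumn wa + sumn wb = n)%N.
Proof.
rewrite !sumn_sorted_nz -sumn_cat -mkseq_cat subnKC // -cnt_cl.
exact: cnt_full.
Qed.

Lemma size_wa : (size wa <= h)%N.
Proof. by rewrite -[X in (_ <= X)%N](size_mkseq cl); apply: size_sorted_nz. Qed.

Lemma size_wb : (h + size wb <= L.+1)%N.
Proof.
have := size_sorted_nz (mkseq (fun t => cl (h + t)) (L.+1 - h)).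
by rewrite size_mkseq -/wb; lia.
Qed.

(** Both contents give the same multiset of pairs (parity, multiplicity) of letters; [act_conj]
    turns this into a permutation of the alphabet. *)
Lemma relabel : exists s : {perm 'I_L.+1},
  (forall t, (h <= s t)%N = (h <= t)%N) /\ same (bw n L h wa wb) [ffun i => s (v i)].
Proof.
pose z := [ffun t : 'I_L.+1 => ((h <= t)%N, cl t)].
pose f' t := if (t < h)%N then nth 0%N wa t else nth 0%N wb (t - h).
pose z' := [ffun t : 'I_L.+1 => ((h <= t)%N, f' t)].
have [s zs] : exists s, z' = act z s.
  apply: act_conj.
  have zE (g : nat -> nat) : [seq [ffun t : 'I_L.+1 => ((h <= t)%N, g t)] i | i : 'I_L.+1] =
     [seq (false, x) | x <- mkseq g h] ++
     [seq (true, x) | x <- mkseq (fun t => g (h + t)%N) (L.+1 - h)].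
    transitivity (map (fun t : nat => ((h <= t)%N, g t)) (map val (enum 'I_L.+1))).
      by rewrite -map_comp; apply: eq_map => t; rewrite /= ffunE.
    rewrite val_enum_ord.
    rewrite -{1}(subnKC hL) iotaD map_cat add0n -!map_comp; congr (_ ++ _).
      by apply/eq_in_map => t; rewrite mem_iota add0n /= => lt; rewrite leqNgt lt.
    rewrite (_ : iota (0 + h) _ = map (addn h) (iota 0 (L.+1 - h))); last by rewrite -iotaDl addnC.
    rewrite -map_comp; apply: eq_map => t /=.
    by rewrite leq_addr.
  rewrite !zE; apply: perm_cat; apply: perm_map.
    apply: perm_trans (sorted_nz_perm _) _; rewrite size_mkseq -/wa.
    suff -> : mkseq f' h = wa ++ nseq (h - size wa) 0%N by [].
    apply: (@eq_from_nth _ 0%N) => [|i]; first by rewrite size_cat size_nseq size_mkseq subnKC ?size_wa.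
    rewrite size_mkseq => ih; rewrite nth_mkseq // /f' ih nth_cat nth_nseq.
    by case: (ltnP i (size wa)) => // le; rewrite nth_default ?if_same.
  apply: perm_trans (sorted_nz_perm _) _; rewrite size_mkseq -/wb.
  suff -> : mkseq (fun t => f' (h + t)%N) (L.+1 - h) = wb ++ nseq (L.+1 - h - size wb) 0%N by [].
  have sb := size_wb.
  apply: (@eq_from_nth _ 0%N) => [|i]; first by rewrite size_cat size_nseq size_mkseq; lia.
  rewrite size_mkseq => ih; rewrite nth_mkseq // /f' ltnNge leq_addr addKn /= nth_cat nth_nseq.
  by case: (ltnP i (size wb)) => // le; rewrite nth_default ?if_same.
have zst t : ((h <= s t)%N, f' (s t)) = ((h <= t)%N, cl t).
  by have := actE z s t; rewrite -zs !ffunE.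
exists s; split=> [t|]; first by have [] := zst t.
apply/sameP; apply: act_conj_card => t.
have := card_bw wab_n size_wa size_wb t; rewrite -/(f' t) => e.
have -> : #|[set i | bw n L h wa wb i == t]| = f' t by rewrite -e; apply: eq_card => i; rewrite !inE.
rewrite -[t](permKV s); have [_ ->] := zst (s^-1%g t).
by apply: eq_card => i; rewrite !inE ffunE (inj_eq perm_inj).
Qed.

Lemma sumn_take_wa k : (k <= h)%N -> (cnt v k <= sumn (take k wa))%N.
Proof.
move=> kh; rewrite cnt_cl; apply: leq_trans (sumn_take_le k (sorted_nz_perm _) _).
  by rewrite -map_take take_iota (minn_idPl kh).
by have /andP[] := sorted_nz_part (mkseq cl h).
Qed.

Lemma sumn_take_wb k : (h <= k)%N -> (cnt v k <= sumn wa + sumn (take (k - h) wb))%N.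
Proof.
move=> hk; have [Lk|kL] := leqP L.+1 k.
  rewrite cnt_full // -{1}wab_n take_oversize //; have := size_wb; lia.
rewrite cnt_cl -(subnKC hk) mkseq_cat sumn_cat addKn leq_add ?sumn_sorted_nz //.
apply: leq_trans (sumn_take_le (k - h) (sorted_nz_perm _) _).
  by rewrite -map_take take_iota (minn_idPl _) //; lia.
by have /andP[] := sorted_nz_part (mkseq (fun t => cl (h + t)) (L.+1 - h)).
Qed.

End SortWord.

Lemma cnt_bw n L h a b k : (sumn a + sumn b = n)%N -> (size a <= h)%N -> (h + size b <= L.+1)%N ->
  cnt (bw n L h a b) k = (sumn (take k a) + sumn (take (k - h) b))%N.
Proof.
move=> ab_n ah bL; rewrite cnt_cl.
have clE t : cl (bw n L h a b) t = if (t < h)%N then nth 0%N a t else nth 0%N b (t - h).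
  exact: card_bw.
rewrite /mkseq (eq_map clE).
have tk (s : seq nat) l : sumn (take l s) = sumn (mkseq (nth 0%N s) l).
  elim: l s => [|l IH] [|x s] //.
    by rewrite mkseqS -cats1 sumn_cat -IH !take_oversize //= nth_nil.
  rewrite /mkseq /= (iotaDl 1 0) -map_comp -/(sumn _); congr (_ + _)%N.
  by rewrite IH; congr sumn; apply: eq_map.
case: (leqP k h) => kh.
  rewrite (eqP (_ : k - h == 0)%N) ?take0 ?addn0 ?tk //.
  by congr sumn; apply/eq_in_map => t; rewrite mem_iota add0n => /andP[_ tk']; rewrite ifT //; lia.
rewrite -{1}(subnKC (ltnW kh)) iotaD map_cat sumn_cat add0n; congr (_ + _)%N.
  rewrite take_oversize ?(leq_trans ah) ?(ltnW kh) // -[in RHS](take_oversize ah) tk.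
  by congr sumn; apply/eq_in_map => t; rewrite mem_iota add0n /= => ->.
rewrite (_ : iota h _ = map (addn h) (iota 0 (k - h))); last by rewrite -iotaDl addn0.
rewrite tk -map_comp; congr sumn; apply: eq_map => t /=.
by rewrite ltnNge leq_addr addKn.
Qed.

(** * Signed permutation modules as modules of words *)

Section Realization.
Variables (F : fieldType) (n d : nat) (rho : {perm 'I_n} -> 'M[F]_d).
Local Notation N := (Nn n).
Local Notation rG := (rG F n).

Definition commutant (K : 'M[F]_d) := forall s, rho s *m K = K *m rho s.

Lemma commutant_subalg : subalg commutant.
Proof.
split=> [s|x y cx cy s|c x cx s|x y cx cy s].
- by rewrite mulmx1 mul1mx.
- by rewrite mulmxDr mulmxDl cx cy.
- by rewrite -scalemxAr -scalemxAl cx.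
by rewrite mulmxA cx -mulmxA cy mulmxA.
Qed.

(* [A] and [B] identify the submodule [M] of the regular module with the image of the idempotent [o]. *)
Record realizes (M : 'M[F]_N) (o : 'M[F]_d) (A : 'M[F]_(d, N)) (B : 'M[F]_(N, d)) : Prop := Realizes {
  re_AB : A *m B = o;
  re_oA : o *m A = A;
  re_M : (A == M)%MS;
  re_rho : forall s, rho s *m A = A *m rG s;
  re_comm : commutant o }.

Section One.
Variables (M : 'M[F]_N) (o : 'M[F]_d) (A : 'M[F]_(d, N)) (B : 'M[F]_(N, d)).
Hypothesis re : realizes M o A B.

Lemma re_idem : o *m o = o.
Proof. by rewrite -{2}(re_AB re) mulmxA (re_oA re) (re_AB re). Qed.

Lemma re_BA k (X : 'M_(k, N)) : (X <= M)%MS -> X *m B *m A = X.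
Proof.
have AM : (A :=: M)%MS by apply/eqmxP; apply: re_M re.
rewrite -AM => /submxP[u ->].
by rewrite -[u *m A *m B]mulmxA (re_AB re) -mulmxA (re_oA re).
Qed.

Lemma re_module K : commutant K -> mxmodule rG (K *m A).
Proof.
by move=> cK; apply/mxmoduleP => s _; rewrite -mulmxA -(re_rho re) mulmxA -cK -mulmxA submxMl.
Qed.

End One.

(** Together with [comm_hom] this identifies homomorphisms between realised submodules with the
    commutant cut by their idempotents. *)
Lemma re_hom M1 o1 A1 B1 M2 o2 A2 B2 (phi : 'M[F]_N) (K := A1 *m phi *m B2) :
    realizes M1 o1 A1 B1 -> realizes M2 o2 A2 B2 ->
    (M1 <= dom_hom_mx rG phi)%MS -> (M1 *m phi <= M2)%MS ->
  [/\ commutant K, o1 *m K = K, K *m o2 = K & K *m A2 = A1 *m phi].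
Proof.
move=> re1 re2 hphi sub2; have AM1 : (A1 :=: M1)%MS by apply/eqmxP; apply: re_M re1.
have AM2 : (A2 :=: M2)%MS by apply/eqmxP; apply: re_M re2.
have sA : (A1 *m phi <= M2)%MS by rewrite (eqmxMr _ AM1).
have KA : K *m A2 = A1 *m phi by rewrite /K (re_BA re2).
split=> //; last 2 first.
- by rewrite /K !mulmxA (re_oA re1).
- by rewrite -(re_AB re2) mulmxA KA.
move=> s; rewrite {1}/K !mulmxA (re_rho re1).
have -> : A1 *m rG s *m phi = A1 *m phi *m rG s.
  by apply/hom_mxP; rewrite ?inE // AM1.
have [u uE] : exists u, A1 *m phi = u *m A2 by apply/submxP; rewrite AM2.
rewrite /K uE -[u *m A2 *m rG s]mulmxA -(re_rho re2) -!mulmxA (re_AB re2).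
by rewrite (re_comm re2) !mulmxA -[u *m A2 *m B2]mulmxA (re_AB re2).
Qed.

Lemma comm_hom M1 o1 A1 B1 M2 o2 A2 B2 K (phi := B1 *m K *m A2) :
    realizes M1 o1 A1 B1 -> realizes M2 o2 A2 B2 -> commutant K ->
  [/\ (M1 <= dom_hom_mx rG phi)%MS, (M1 *m phi <= M2)%MS & A1 *m phi = o1 *m K *m A2].
Proof.
move=> re1 re2 cK; have AM1 : (A1 :=: M1)%MS by apply/eqmxP; apply: re_M re1.
have AM2 : (A2 :=: M2)%MS by apply/eqmxP; apply: re_M re2.
have Aphi : A1 *m phi = o1 *m K *m A2 by rewrite /phi !mulmxA (re_AB re1).
split=> //; last by rewrite -(eqmxMr _ AM1) Aphi -AM2 submxMl.
rewrite -AM1; apply/hom_mxP => s _.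
rewrite -(re_rho re1) -[rho s *m A1 *m phi]mulmxA Aphi.
rewrite -[o1 *m K *m A2 *m rG s]mulmxA -(re_rho re2) !mulmxA (re_comm re1).
by rewrite -[o1 *m rho s *m K]mulmxA cK !mulmxA.
Qed.

Lemma prim_of_summand M o A B (U V : 'M[F]_N) (e := A *m proj_mx U V *m B) :
    realizes M o A B -> mxmodule rG U -> mxmodule rG V -> (U :&: V = 0)%MS -> (U + V :=: M)%MS ->
  [/\ commutant e, e *m e = e, o *m e = e, e *m o = e & (e *m A :=: U)%MS].
Proof.
move=> re mU mV dx UV; have AM : (A :=: M)%MS by apply/eqmxP; apply: re_M re.
have UM : (U <= M)%MS by rewrite -UV addsmxSl.
have [||ce oe eo eA] := re_hom re re (phi := proj_mx U V).
- by rewrite -UV proj_mx_hom.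
- exact: submx_trans (proj_mx_sub _ _ _) UM.
split=> //.
  have -> : e *m e = e *m A *m proj_mx U V *m B by rewrite !mulmxA.
  by rewrite eA -[A *m _ *m proj_mx U V]mulmxA proj_mx_proj.
rewrite eA; apply/eqmxP; rewrite proj_mx_sub /=.
by rewrite -{1}(proj_mx_id dx (submx_refl U)) submxMr // AM.
Qed.

Lemma idem_cap M o A B (f g : 'M_d) : realizes M o A B -> f *m o = f -> g *m o = g ->
  f *m f = f -> g *m f = 0 -> (<<f *m A>> :&: <<g *m A>> = 0)%MS.
Proof.
move=> re fo go ff gf; apply/eqP; rewrite -submx0; apply/rV_subP => x; rewrite sub_capmx !genmxE.
case/andP => /submxP[u xu] /submxP[v xv].
have xB : x *m B = u *m f by rewrite xu -!mulmxA (re_AB re) fo.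
have xB' : x *m B = v *m g by rewrite xv -!mulmxA (re_AB re) go.
have : u *m f *m f = 0 by rewrite -xB xB' -mulmxA gf mulmx0.
by rewrite -mulmxA ff xu mulmxA => ->; rewrite mul0mx sub0mx.
Qed.

(** An idempotent f below e splits U into the images of f and e - f. *)
Lemma primitive_indecomp M o A B U e : realizes M o A B ->
    commutant e -> e *m e = e -> o *m e = e -> e *m o = e -> (e *m A :=: U)%MS ->
  indecomp U -> primitive commutant e.
Proof.
move=> re ce ee oe eo eU [mU nzU ind]; split=> //.
  by apply: contraNneq nzU => e0; rewrite -submx0 -eU e0 mul0mx sub0mx.
move=> f cf ef fe ff.
have fo : f *m o = f by rewrite -fe -mulmxA eo.
have cef : commutant (e - f).
  move=> s; rewrite mulmxBr mulmxBl ce cf //.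
have eef : (e - f) *m (e - f) = e - f.
  by rewrite mulmxBl !mulmxBr ee ef fe ff subrr subr0.
have m1 : mxmodule rG <<f *m A>>%MS.
  by rewrite (eqmx_module _ (genmxE _)); exact: (re_module re cf).
have m2 : mxmodule rG <<(e - f) *m A>>%MS.
  by rewrite (eqmx_module _ (genmxE _)); exact: (re_module re cef).
have dx : (<<f *m A>> :&: <<(e - f) *m A>> = 0)%MS.
  by apply: (idem_cap re); rewrite ?mulmxBl ?eo ?fo ?ef ?ff ?subrr.
have sm : (<<f *m A>> + <<(e - f) *m A>> == U)%MS.
  apply/andP; split.
    have efe : (e - f) *m e = e - f by rewrite mulmxBl ee fe.
    have s1 : (f *m A <= e *m A)%MS by rewrite -{1}fe -mulmxA submxMl.
    have s2 : ((e - f) *m A <= e *m A)%MS by rewrite -{1}efe -mulmxA submxMl.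
    by rewrite addsmx_sub !genmxE -!eU s1 s2.
  rewrite -eU -[e in (e *m A <= _)%MS](subrK f) addrC mulmxDl.
  by rewrite addmx_sub_adds ?genmxE.
have zero (g : 'M_d) : g *m o = g -> <<g *m A>>%MS == 0 -> g = 0.
  move=> go; rewrite -submx0 genmxE submx0 => /eqP g0.
  by rewrite -go -(re_AB re) mulmxA g0 mul0mx.
case: (ind _ _ m1 m2 (introT mxdirect_addsP dx) sm) => [/(zero _ fo)|/zero]; first by left.
rewrite mulmxBl eo fo => /(_ erefl) /eqP; rewrite subr_eq0 => /eqP ->; first by right.
Qed.

Lemma summand_of_idem M o A B (x : 'M_d) : realizes M o A B -> commutant x ->
  x *m x = x -> o *m x = x -> x *m o = x -> summand <<x *m A>>%MS M.
Proof.
move=> re cx xx ox xo; have AM : (A :=: M)%MS by apply/eqmxP; apply: re_M re.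
have oo := re_idem re.
have cox : commutant (o - x) by move=> s; rewrite mulmxBr mulmxBl (re_comm re) cx.
have mod y : commutant y -> mxmodule rG <<y *m A>>%MS.
  by move=> cy; rewrite (eqmx_module _ (genmxE _)); exact: (re_module re cy).
split; first exact: mod; exists <<(o - x) *m A>>%MS; split; first exact: mod.
  by apply/mxdirect_addsP/(idem_cap re); rewrite ?mulmxBl ?oo ?xo ?ox ?xx ?subrr.
apply/andP; split; first by rewrite addsmx_sub !genmxE -!AM !submxMl.
rewrite -AM -{1}(re_oA re) -[o in (o *m A <= _)%MS](subrK x) addrC mulmxDl.
by rewrite addmx_sub_adds ?genmxE.
Qed.

Lemma iso_of_kernels M1 o1 A1 B1 M2 o2 A2 B2 e x a b Y V :
    realizes M1 o1 A1 B1 -> realizes M2 o2 A2 B2 -> commutant a -> commutant b ->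
    e *m e = e -> x *m x = x -> e *m o1 = e -> o2 *m x = x -> x *m o2 = x -> commutant x -> commutant e ->
    a *m b = e -> b *m a = x -> (e *m A1 :=: Y)%MS -> (x *m A2 :=: V)%MS ->
  mx_iso rG V Y.
Proof.
move=> re1 re2 ca cb ee xx eo1 o2x xo2 cx ce ab ba eY xV.
pose K := x *m b *m e.
have cK : commutant K by do 2![apply: (subM commutant_subalg) => //].
have [h1 h2 h3] := comm_hom re2 re1 cK.
set phi := B2 *m K *m A1 in h1 h2 h3.
have AM2 : (A2 :=: M2)%MS by apply/eqmxP; apply: re_M re2.
have VM : (V <= M2)%MS by rewrite -xV -AM2 submxMl.
have xphi : x *m A2 *m phi = x *m b *m e *m A1.
  by rewrite -mulmxA h3 /K !mulmxA xo2 xx.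
have Vphi : (V *m phi :=: x *m b *m e *m A1)%MS.
  by apply/eqmxP; rewrite -xphi !(eqmxMr _ xV) submx_refl.
have bea : b *m e *m a = x by rewrite -ab !mulmxA ba -mulmxA ba xx.
have sV : (V *m phi :=: Y)%MS.
  apply/eqmxP; rewrite !Vphi -!eY; apply/andP; split; first by rewrite -mulmxA submxMl.
  have aKE : a *m x *m b *m e = e by rewrite -ba !mulmxA ab -[_ *m a *m b]mulmxA ab !ee.
  by rewrite -{1}aKE -!mulmxA submxMl.
have rk : \rank (V *m phi) = \rank V.
  apply/eqP; rewrite eqn_leq mxrankM_maxl /= Vphi.
  have xE : x *m A2 = x *m b *m e *m A1 *m (B1 *m a *m A2).
    rewrite !mulmxA -[_ *m A1 *m B1]mulmxA (re_AB re1) -[_ *m e *m o1]mulmxA eo1.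
    by rewrite -[x *m b *m e]mulmxA -[x *m _ *m a]mulmxA bea xx.
  by rewrite -xV xE mxrankM_maxl.
(* [mx_iso] asks for an invertible matrix, while [phi] is known to be injective only on V; it is
   replaced by a unit that agrees with it there. *)
have [g ug Vg] := complete_unitmx rk.
exists g => //; last by rewrite -Vg.
have mV : mxmodule rG V.
  by rewrite -(eqmx_module _ xV); exact: (re_module re2 cx).
apply/hom_mxP => s sG.
have [u Vu] : exists u, V *m rG s = u *m V by apply/submxP; apply: (mxmoduleP mV).
have /hom_mxP/(_ s sG) := submx_trans VM h1.
by rewrite Vg !Vu -[u *m V *m phi]mulmxA Vg mulmxA.
Qed.

Lemma kernels_of_iso M1 o1 A1 B1 M2 o2 A2 B2 Y Y0 V V0
    (e := A1 *m proj_mx Y Y0 *m B1) (x := A2 *m proj_mx V V0 *m B2) :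
    realizes M1 o1 A1 B1 -> realizes M2 o2 A2 B2 ->
    mxmodule rG Y -> mxmodule rG Y0 -> (Y :&: Y0 = 0)%MS -> (Y + Y0 :=: M1)%MS ->
    mxmodule rG V -> mxmodule rG V0 -> (V :&: V0 = 0)%MS -> (V + V0 :=: M2)%MS ->
    mx_iso rG V Y ->
  exists a b, [/\ commutant a, commutant b, a *m b = e & b *m a = x].
Proof.
move=> re1 re2 mY mY0 dY sY mV mV0 dV sV [g ug homg Vg].
have YM : (Y <= M1)%MS by rewrite -sY addsmxSl.
have VM : (V <= M2)%MS by rewrite -sV addsmxSl.
have homP1 : (M1 <= dom_hom_mx rG (proj_mx Y Y0))%MS by rewrite -sY proj_mx_hom.
have homP2 : (M2 <= dom_hom_mx rG (proj_mx V V0))%MS by rewrite -sV proj_mx_hom.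
have homg' : (Y <= dom_hom_mx rG (invmx g))%MS by rewrite dom_hom_invmx // -Vg submxMr.
have Yg : (Y *m invmx g <= V)%MS by rewrite -(eqmxMr _ Vg) mulmxK.
have comp (k : nat) (X : 'M_(k, N)) P Q U : (X <= dom_hom_mx rG P)%MS -> (X *m P <= U)%MS ->
    (U <= dom_hom_mx rG Q)%MS -> (X <= dom_hom_mx rG (P *m Q))%MS.
  move=> hP sU hQ; apply/hom_mxP => s sG; rewrite mulmxA (hom_mxP hP) // mulmxA.
  by apply: (hom_mxP (submx_trans sU hQ)).
have [||ca _ _ aA] := re_hom re1 re2 (phi := proj_mx Y Y0 *m invmx g).
- by apply: comp homg' => //; apply: proj_mx_sub.
- by rewrite mulmxA (submx_trans _ VM) // (submx_trans _ Yg) // submxMr // proj_mx_sub.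
have [||cb _ _ bA] := re_hom re2 re1 (phi := proj_mx V V0 *m g).
- by apply: comp homg => //; apply: proj_mx_sub.
- by rewrite mulmxA (submx_trans _ YM) // -Vg submxMr // proj_mx_sub.
exists (A1 *m (proj_mx Y Y0 *m invmx g) *m B2), (A2 *m (proj_mx V V0 *m g) *m B1); split=> //.
  rewrite 2!mulmxA aA /e; congr (_ *m B1).
  have YgV k (X : 'M_(k, N)) : (X *m proj_mx Y Y0 *m invmx g <= V)%MS.
    by rewrite (submx_trans _ Yg) // submxMr // proj_mx_sub.
  rewrite [A1 *m (_ *m invmx g)]mulmxA [_ *m (_ *m g)]mulmxA (proj_mx_id dV (YgV _ _)).
  exact: mulmxKV.
rewrite 2!mulmxA bA /x; congr (_ *m B2).
have VgY k (X : 'M_(k, N)) : (X *m proj_mx V V0 *m g <= Y)%MS.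
  by rewrite -Vg submxMr // proj_mx_sub.
rewrite [A2 *m (_ *m g)]mulmxA [_ *m (_ *m invmx g)]mulmxA (proj_mx_id dY (VgY _ _)).
exact: mulmxK.
Qed.

Lemma KS_idempotents M o A B m (V : 'I_m -> 'M[F]_N)
    (P := fun i => A *m proj_mx (V i) (\sum_(j | j != i) V j)%MS *m B) :
    realizes M o A B -> KS_decomp M V ->
  [/\ forall i, primitive commutant (P i),
      forall i j, i != j -> P i *m P j = 0,
      \sum_i P i = o &
      forall i, [/\ mxmodule rG (V i), mxmodule rG (\sum_(j | j != i) V j)%MS,
        (V i :&: (\sum_(j | j != i) V j) = 0)%MS &
        (V i + (\sum_(j | j != i) V j) :=: M)%MS]].
Proof.
move=> re [ind dx /eqmxP VM]; have AM : (A :=: M)%MS by apply/eqmxP; apply: re_M re.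
have mV i : mxmodule rG (V i) by case: (ind i).
have mV' i : mxmodule rG (\sum_(j | j != i) V j)%MS by apply: sumsmx_module => j _.
have dV i : (V i :&: (\sum_(j | j != i) V j) = 0)%MS by apply: (mxdirect_sumsP dx).
have sV i : (V i + (\sum_(j | j != i) V j) :=: M)%MS.
  by apply/eqmxP; move/eqmxP: VM; rewrite (bigD1 i).
have pr i := prim_of_summand re (mV i) (mV' i) (dV i) (sV i).
split=> //.
- move=> i; have [c ee oe eo eA] := pr i.
  exact: (primitive_indecomp re c ee oe eo eA (ind i)).
- move=> i j ij; have [_ _ _ _ eA] := pr i.
  have z : P i *m A *m proj_mx (V j) (\sum_(l | l != j) V l)%MS = 0.
    by apply: proj_mx_0 (dV j) _; rewrite eA (sumsmx_sup i).
  by rewrite {2}/P [LHS]mulmxA [P i *m (A *m _)]mulmxA z mul0mx.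
rewrite -mulmx_suml -mulmx_sumr -(re_AB re); congr (_ *m _).
have /sub_sumsmxP[u uE] : (A <= \sum_i V i)%MS by rewrite VM AM.
rewrite {1}uE mulmx_suml [RHS]uE; apply: eq_bigr => i _.
rewrite mulmx_sumr (bigD1 i) //= proj_mx_id ?submxMl // big1 ?addr0 // => j ji.
by apply: proj_mx_0 (dV j) _; rewrite (submx_trans (submxMl _ _)) // (sumsmx_sup i) // eq_sym.
Qed.

End Realization.

(** * The basis of M(a|b) indexed by words *)

Section MmodWords.
Variables (F : fieldType) (L h n : nat).
Local Notation W := {ffun 'I_n -> 'I_L.+1}.
Local Notation ker := 'M[F]_#|{: W}|.

Definition rhow (s : {perm 'I_n}) : ker :=
  mkk (fun w w' => (w' == act w s)%:R * eps F (oset h w) s).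

Lemma kv_rhoM s (K : ker) w w' :
  kv (rhow s *m K) w w' = eps F (oset h w) s * kv K (act w s) w'.
Proof.
rewrite kvM (bigD1 (act w s)) //= big1 ?addr0 ?kv_mkk ?eqxx ?mul1r // => v nv.
by rewrite kv_mkk (negbTE nv) !mul0r.
Qed.

Lemma kv_Mrho s (K : ker) w w' :
  kv (K *m rhow s) w (act w' s) = kv K w w' * eps F (oset h w') s.
Proof.
rewrite kvM (bigD1 w') //= big1 ?addr0 ?kv_mkk ?eqxx ?mul1r // => v nv.
by rewrite kv_mkk (inj_eq (@act_inj _ _ s)) eq_sym (negbTE nv) mul0r mulr0.
Qed.

Lemma commutant_equiv (K : ker) : commutant rhow K <-> equiv h K.
Proof.
split=> [cK s w w'|eK s].
  have := congr1 (fun K => kv K w (act w' s)) (cK s); rewrite kv_rhoM kv_Mrho => e.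
  rewrite -[LHS]mul1r -(eps_sq F (oset h w) s) -mulrA e.
  by ring.
apply: kvP => w w'; rewrite -[w'](actKV s) kv_rhoM kv_Mrho eK.
by rewrite 2!mulrA eps_sq mul1r mulrC.
Qed.

Variables a b : seq nat.
Hypothesis ab_n : (sumn a + sumn b = n)%N.
Hypothesis a_h : (size a <= h)%N.
Hypothesis b_L : (h + size b <= L.+1)%N.
Local Notation w0 := (bw n L h a b).
Local Notation ep x := (eps F (oset h w0) x).

Lemma sum_Nn (f : {perm 'I_n} -> F) : \sum_(j < Nn n) f (enum_val j) = \sum_x f x.
Proof.
rewrite [RHS](reindex (fun j : 'I_(Nn n) => enum_val j)) //.
by exists (gring_index (Sn n)) => x _; rewrite ?gring_valK ?gring_indexK ?inE.
Qed.

Lemma young_act s : (s \in young n (a ++ b)) = (act w0 s == w0).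
Proof.
rewrite inE; apply/forallP/eqP => [H|e i].
  by apply/act_stabP/forallP => i; rewrite bw_blk.
by have /act_stabP/forallP/(_ i) := e; rewrite bw_blk.
Qed.

Lemma chi_eps s : chi F (sumn a) s = ep s.
Proof.
rewrite /chi /eps; congr (_ ^+ #|pred_of_set _|); apply/setP => -[i j].
rewrite !inE /= !bw_odd //; apply/and3P/and4P => [[ai ij sij]|[ai _ ij sij]]; split=> //.
exact: leq_trans ai (ltnW ij).
Qed.

Definition xw (w : W) : {perm 'I_n} := odflt 1%g [pick x | act w0 x == w].

Lemma xwP w : same w0 w -> act w0 (xw w) = w.
Proof.
by case/sameP => x e; rewrite /xw; case: pickP => [y /eqP //|/(_ x)]; rewrite e eqxx.
Qed.

(** A word of content (a|b) is a right coset of the Young subgroup. Its row is the indicator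
    function of the coset, signed so as to transform by [chi]. *)
Definition Amx : 'M[F]_(#|{: W}|, Nn n) :=
  \matrix_(i, j) ((act w0 (enum_val j) == enum_val i)%:R * ep (enum_val j)).

(** Recovers the coefficients of a function in M(a|b) from its values at the coset representatives
    [xw]. *)
Definition Bmx : 'M[F]_(Nn n, #|{: W}|) :=
  \matrix_(j, i) (((enum_val j == xw (enum_val i)) && same w0 (enum_val i))%:R * ep (enum_val j)).

Lemma lreg_mul k (f : 'M[F]_(k, Nn n)) s i j :
  (f *m lreg_mx F s) i j = f i (gring_index (Sn n) (s * enum_val j)%g).
Proof.
rewrite mxE (bigD1 (gring_index (Sn n) (s * enum_val j)%g)) //= big1 => [|l nl].
  by rewrite mxE eqxx mulr1 addr0.
by rewrite mxE (negbTE nl) mulr0.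
Qed.

Lemma rG_mul k (f : 'M[F]_(k, Nn n)) s i j :
  (f *m rG F n s) i j = f i (gring_index (Sn n) (enum_val j * s^-1)%g).
Proof.
rewrite mxE (bigD1 (gring_index (Sn n) (enum_val j * s^-1)%g)) //= big1 => [|l nl].
  by rewrite !mxE gring_indexK ?inE // mulgKV gring_valK !eqxx mulr1 addr0.
rewrite !mxE eqxx /=; case: eqP => [e|]; last by rewrite mulr0.
by case/eqP: nl; rewrite e gring_indexK ?inE // mulgK gring_valK.
Qed.

Lemma Mmod_realizes : realizes rhow (Mmod F n a b) (one F w0) Amx Bmx.
Proof.
split.
- apply/matrixP => i j; rewrite mxE.
  under eq_bigr do rewrite !mxE.
  rewrite (sum_Nn (fun x => (act w0 x == enum_val i)%:R * ep x *
     (((x == xw (enum_val j)) && same w0 (enum_val j))%:R * ep x))) mxE.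
  rewrite (bigD1 (xw (enum_val j))) //= big1 ?addr0 => [|x nx]; last first.
    by rewrite (negbTE nx) mul0r mulr0.
  rewrite eqxx /=; case sj: (same w0 (enum_val j)); last first.
    by rewrite mul0r mulr0; case: eqP => // e; rewrite e sj.
  rewrite mul1r xwP // -mulrA eps_sq mulr1 eq_sym.
  by case: eqP => [->|//]; rewrite sj.
- apply/matrixP => i j; rewrite mxE (bigD1 i) //= big1 ?addr0 => [|l nl].
    rewrite mxE eqxx /= mxE; case: eqP => [<-|]; last by rewrite mul0r mulr0.
    by rewrite same_act same_refl mul1r.
  rewrite mxE; case: eqP => [e|]; last by rewrite mul0r.
  by case/eqP: nl; apply: enum_val_inj.
- apply/andP; split.
    apply/sub_bigcapmxP => s; rewrite young_act => /eqP st; apply/sub_kermxP.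
    rewrite mulmxBr mul_mx_scalar; apply/eqP; rewrite subr_eq0; apply/eqP/matrixP => i j.
    rewrite lreg_mul !mxE gring_indexK ?inE // actM st eps_act_mul st chi_eps.
    by rewrite mulrCA.
  have Ms s : act w0 s = w0 -> Mmod F n a b *m lreg_mx F s = ep s *: Mmod F n a b.
    move=> st; have sY : s \in young n (a ++ b) by rewrite young_act st.
    have /sub_bigcapmxP/(_ s sY)/sub_kermxP : (Mmod F n a b <= Mmod F n a b)%MS by [].
    by rewrite mulmxBr mul_mx_scalar chi_eps => /eqP; rewrite subr_eq0 => /eqP.
  suff -> : Mmod F n a b = Mmod F n a b *m Bmx *m Amx by apply: submxMl.
  apply/matrixP => i j; rewrite mxE; set f := Mmod F n a b in Ms *.
  rewrite (bigD1 (enum_rank (act w0 (enum_val j)))) //= big1 ?addr0 => [|l nl]; last first.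
    rewrite [Amx _ _]mxE; case: eqP => [e|]; last by rewrite mul0r mulr0.
    by case/eqP: nl; rewrite e enum_valK.
  rewrite [Amx _ _]mxE enum_rankK eqxx mul1r mxE.
  set x := xw (act w0 (enum_val j)).
  have sw : same w0 (act w0 (enum_val j)) by rewrite same_act same_refl.
  have xE : act w0 x = act w0 (enum_val j) by apply: xwP.
  rewrite (bigD1 (gring_index (Sn n) x)) //= big1 ?addr0 => [|l nl]; last first.
    rewrite mxE enum_rankK -/x; case: eqP => [e|]; last by rewrite mul0r mulr0.
    by case/eqP: nl; rewrite -e gring_valK.
  rewrite mxE enum_rankK -/x gring_indexK ?inE // eqxx sw mul1r.
  pose s := (x * (enum_val j)^-1)%g.
  have st : act w0 s = w0 by rewrite actM xE -actM mulgV act1.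
  have xs : x = (s * enum_val j)%g by rewrite mulgKV.
  have fx : f i (gring_index (Sn n) x) = ep s * f i j.
    by rewrite xs -lreg_mul Ms // mxE.
  rewrite fx [in ep x]xs eps_act_mul st.
  have e1 := eps_sq F (oset h w0) s; have e2 := eps_sq F (oset h w0) (enum_val j).
  by rewrite -[LHS]mul1r -e1 -[LHS]mul1r -{1}e2; ring.
- move=> s; apply/matrixP => i j; rewrite rG_mul !mxE gring_indexK ?inE //.
  rewrite (bigD1 (enum_rank (act (enum_val i) s))) //= big1 ?addr0 => [|l nl]; last first.
    rewrite mxE; case: eqP => [e|]; last by rewrite !mul0r.
    by case/eqP: nl; rewrite -e enum_valK.
  rewrite !mxE enum_rankK eqxx mul1r.
  have -> : (act w0 (enum_val j) == act (enum_val i) s) = (act w0 (enum_val j * s^-1)%g == enum_val i).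
    by rewrite actM -(inj_eq (@act_inj _ _ s^-1%g)) actK.
  case: eqP => [e|]; last by rewrite !mul0r mulr0.
  have -> : ep (enum_val j) = ep (enum_val j * s^-1)%g * eps F (oset h (enum_val i)) s.
    by rewrite -e -eps_act_mul mulgKV.
  have e2 := eps_sq F (oset h (enum_val i)) s.
  by rewrite -[RHS]mul1r -e2; ring.
by apply/commutant_equiv; apply: equiv_one.
Qed.

End MmodWords.

(** * Renaming letters within their parity *)

Section Relabel.
Variables (F : fieldType) (L h n : nat).
Local Notation W := {ffun 'I_n -> 'I_L.+1}.
Variable s : {perm 'I_L.+1}.
Hypothesis s_par : forall t, (h <= s t)%N = (h <= t)%N.

Definition rl (w : W) : W := [ffun i => s (w i)].

Lemma rl_inj : injective rl.
Proof.
move=> w w' e; apply/ffunP => i; apply: (@perm_inj _ s).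
by move/ffunP/(_ i): e; rewrite !ffunE.
Qed.

Lemma oset_rl w : oset h (rl w) = oset h w.
Proof. by apply/setP => i; rewrite !inE ffunE s_par. Qed.

Lemma act_rl w t : act (rl w) t = rl (act w t).
Proof. by apply/ffunP => i; rewrite !ffunE. Qed.

Lemma same_rl v w : same (rl v) (rl w) = same v w.
Proof.
apply/sameP/sameP => -[t e]; exists t; last by rewrite e act_rl.
by apply: rl_inj; rewrite e act_rl.
Qed.

Definition rlm : 'M[F]_#|{: W}| := mkk (fun w w' => (w' == rl w)%:R).
Definition rlV : 'M[F]_#|{: W}| := mkk (fun w w' => (w == rl w')%:R).

Lemma equiv_rlm : equiv h rlm.
Proof.
move=> t w w'; rewrite !kv_mkk -act_rl (inj_eq (@act_inj _ _ t)).
by case: eqP => [->|]; rewrite ?mulr0 // oset_rl eps_sq mulr1.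
Qed.

Lemma equiv_rlV : equiv h rlV.
Proof.
move=> t w w'; rewrite !kv_mkk -act_rl (inj_eq (@act_inj _ _ t)).
by case: eqP => [->|]; rewrite ?mulr0 // oset_rl eps_sq mulr1.
Qed.

Lemma rl_one v : rlm *m one F (rl v) *m rlV = one F v.
Proof.
apply: kvP => w w'; rewrite kvM (bigD1 (rl w)) //= big1 ?addr0 => [|u nu]; last first.
  by rewrite kv_M1 kv_mkk (negbTE nu) mulr0 mul0r.
rewrite kv_M1 same_rl !kv_mkk eqxx mulr1 (inj_eq rl_inj).
by rewrite -natrM mulnb andbC.
Qed.

End Relabel.

Section MultiplicityKernels.
Variables (F : fieldType) (L h n : nat).
Hypothesis two_neq0 : (2%:R : F) != 0.
Variables l u : seq nat.
Hypothesis lu_n : (sumn l + sumn u = n)%N.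
Hypothesis l_h : (size l <= h)%N.
Hypothesis u_L : (h + size u <= L.+1)%N.
Local Notation W := {ffun 'I_n -> 'I_L.+1}.
Local Notation ker := 'M[F]_#|{: W}|.
Local Notation xi := (bw n L h l u).
Local Notation S := (commutant (rhow F L h (n := n))).

(** Sorting can only raise the partial sums of the content of [v], so the excess over (l|u) at the
    threshold k survives. *)
Lemma bad_not_dom (v : W) : bad xi v -> dominates l u (wa h v) (wb h v) -> False.
Proof.
case=> k; rewrite ltnNge cnt_bw // => /negP lt dom; apply: lt.
have hL : (h <= L.+1)%N by apply: leq_trans u_L; apply: leq_addr.
have [kh|kh] := leqP k h.
  apply: leq_trans (sumn_take_wa v kh) _.
  case: k kh => [|k] kh; first by rewrite take0.
  by have [le _] := dom k.+1 isT; apply: leq_trans le (leq_addr _ _).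
apply: leq_trans (sumn_take_wb v hL (ltnW kh)) _.
rewrite [take k l]take_oversize; last exact: leq_trans l_h (ltnW kh).
have [|_ //] := dom (k - h)%N.
by rewrite subn_gt0.
Qed.

(* Otherwise [e] is a sum of maps through modules M(v) with [bad xi v]; as e S e is local, Y would be a
   summand of one of them, against the defining property of Y. *)
Lemma theta_isY (Th : ker -> F) (Y : 'M[F]_(Nn n)) (e : ker) :
    theta h xi Th -> primitive S e -> one F xi *m e = e -> e *m one F xi = e ->
    (e *m Amx F L h n l u :=: Y)%MS ->
    (forall a b : seq nat, is_part a -> is_part b -> (sumn a + sumn b)%N = n ->
        (exists U, summand U (Mmod F n a b) /\ mx_iso (rG F n) U Y) -> dominates l u a b) ->
  Th e = 1.
Proof.
move=> ThP pe oe eo eY domY.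
have hL : (h <= L.+1)%N by apply: leq_trans u_L; apply: leq_addr.
have sS := commutant_subalg (rhow F L h (n := n)).
have ee : equiv h e by apply/commutant_equiv; apply: prim_sub pe.
have cute : cut xi e xi = e by rewrite /cut oe eo.
have Th2 : Th e * Th e = Th e.
  by have := thetaM two_neq0 ThP ee ee; rewrite cute (prim_idem pe).
suff nz : Th e != 0 by apply: (mulIf nz); rewrite mul1r.
apply/eqP => Th0.
have [s []] := theta_coef two_neq0 ThP ee; rewrite cute Th0 scale0r add0r => es Hs.
have Ss x : x \in s -> S (through xi xi x).
  move=> /Hs[e1 e2 _]; apply/commutant_equiv; apply: equivM; exact: equiv_cut.
have [|||x xs [k Sk ek]] := @local_sum F _ S e _ s (fun x => e *m through xi xi x *m e) e sS pe.
- move=> x xs; split.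
  + by do 2![apply: (subM sS); [|exact: prim_sub pe || exact: Ss]]; exact: prim_sub pe.
  + by rewrite !mulmxA (prim_idem pe).
  + by rewrite -!mulmxA (prim_idem pe).
- exact: prim_sub pe.
- by rewrite -mulmx_suml -mulmx_sumr -es !(prim_idem pe).
have [e1 e2 bd] := Hs x xs; set v := x.1.2 in bd *.
have [r [rpar rsame]] := relabel v hL.
have ca := wab_n v hL; have sa := size_wa h v; have sb := size_wb v hL.
apply: (bad_not_dom bd); apply: domY => //; try exact: sorted_nz_part.
have re1 := Mmod_realizes F lu_n l_h u_L.
have re2 := Mmod_realizes F ca sa sb.
set o2 := one F _ in re2.
have o2E : o2 = one F (rl r v) by apply: one_same.
(* [rlm] and [rlV] pass between the content of [v] and its sorted form, so that [a] and [b] factor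
   [e] through a module indexed by partitions. *)
pose a := e *m cut xi x.1.1 v *m rlm F n r *m o2.
pose b := o2 *m rlV F n r *m cut v x.2 xi *m e *m k *m e.
have Se := prim_sub pe.
have So2 : S o2 by apply/commutant_equiv/equiv_one.
have Srl : S (rlm F n r) by apply/commutant_equiv/equiv_rlm.
have SrV : S (rlV F n r) by apply/commutant_equiv/equiv_rlV.
have Sc1 : S (cut xi x.1.1 v) by apply/commutant_equiv/equiv_cut.
have Sc2 : S (cut v x.2 xi) by apply/commutant_equiv/equiv_cut.
have Sa : S a by rewrite /a; do 3![apply: (subM sS) => //].
have Sb : S b by rewrite /b; do 5![apply: (subM sS) => //].
have oo2 : o2 *m o2 = o2 by apply: one_idem.
have ab : a *m b = e.
  have -> : a *m b = e *m cut xi x.1.1 v *m (rlm F n r *m (o2 *m o2) *m rlV F n r) *m cut v x.2 xi *m e *m k *m e.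
    by rewrite /a /b !mulmxA.
  rewrite oo2 o2E rl_one // -[_ *m one F v]mulmxA cut_one.
  rewrite -[e *m _ *m cut v x.2 xi]mulmxA -/(through xi xi x) ek (prim_idem pe) //.
have be : b *m e = b by rewrite /b -mulmxA (prim_idem pe).
have ea : e *m a = a by rewrite /a !mulmxA (prim_idem pe).
have ao : a *m o2 = a by rewrite /a -mulmxA oo2.
have ob : o2 *m b = b by rewrite /b !mulmxA oo2.
pose y := b *m a.
have Sy : S y by apply: (subM sS).
have yy : y *m y = y by rewrite /y mulmxA -[b *m a *m b]mulmxA ab be.
have oy : o2 *m y = y by rewrite /y mulmxA ob.
have yo : y *m o2 = y by rewrite /y -mulmxA ao.
exists <<y *m Amx F L h n (wa h v) (wb h v)>>%MS; split.
  exact: (summand_of_idem re2).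
apply: (iso_of_kernels re1 re2 Sa Sb (prim_idem pe) yy eo oy yo Sy Se ab erefl eY).
exact/eqmx_sym/genmxE.
Qed.

Variables a b : seq nat.
Hypothesis ab_n : (sumn a + sumn b = n)%N.
Hypothesis a_h : (size a <= h)%N.
Hypothesis b_L : (h + size b <= L.+1)%N.
Local Notation eta := (bw n L h a b).

Lemma multiplicity_kernels q mu (Th : ker -> F) (Y : 'M[F]_(Nn n)) m (V : 'I_m -> 'M[F]_(Nn n)) k :
    u = scale q mu -> theta h xi Th -> isY q l mu Y -> KS_decomp (Mmod F n a b) V -> iso_count V Y k ->
  exists f g : 'I_k -> ker, [/\ forall i, equiv h (f i) /\ equiv h (g i),
    forall i j, Th (cut xi (f i) eta *m cut eta (g j) xi) = (i == j)%:R &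
    forall x y, equiv h x -> equiv h y -> Th (cut xi x eta *m cut eta y xi) =
      \sum_i Th (cut xi x eta *m cut eta (g i) xi) * Th (cut xi (f i) eta *m cut eta y xi)].
Proof.
move=> uE ThP [indY [mY [Y0 [mY0 dY sY]]] domY] KS [A [AP <-]].
rewrite -uE in sY domY.
have re1 := Mmod_realizes F lu_n l_h u_L.
have re2 := Mmod_realizes F ab_n a_h b_L.
have sS := commutant_subalg (rhow F L h (n := n)).
have {}dY := mxdirect_addsP dY; have {}sY := eqmxP sY.
have [ce ee oe eo eY] := prim_of_summand re1 mY mY0 dY sY.
have pe := primitive_indecomp re1 ce ee oe eo eY indY.
have [pP orth sP VP] := KS_idempotents re2 KS.
have The := theta_isY ThP pe oe eo eY domY.
have [||||f [g [Sfg fgE del form]]] := @theta_multiplicity F _ S Th (one F xi) (one F eta) _ sS _ _ _ pe oe eo The m _ pP orth sP A.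
- move=> I P x; apply: (big_morph Th (thetaD ThP) (theta0 ThP)).
- exact: theta0 ThP.
- move=> x y /commutant_equiv ex /commutant_equiv ey ox xo oy yo.
  by have := thetaM two_neq0 ThP ex ey; rewrite /cut ox xo oy yo.
- move=> i; have [mV mV' dV sV] := VP i; split.
    by move/(AP i); apply: (kernels_of_iso re1 re2).
  case=> x [y [Sx Sy xy yx]]; apply/(AP i).
  have [c1 i1 o1 o1' V1] := prim_of_summand re2 mV mV' dV sV.
  exact: (iso_of_kernels re1 re2 Sx Sy ee i1 eo o1 o1' c1 ce xy yx eY V1).
exists f, g; split.
- by move=> i; have [/commutant_equiv ? /commutant_equiv ?] := Sfg i.
- move=> i j; have [f1 f2 g1 g2] := fgE i; have [f1' f2' g1' g2'] := fgE j.
  by rewrite /cut f1 f2 g1' g2' del.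
move=> x y ex ey; rewrite form ?one_cut ?cut_one //; last 2 first.
- by apply/commutant_equiv; apply: equiv_cut.
- by apply/commutant_equiv; apply: equiv_cut.
apply: eq_bigr => i _; have [f1 f2 g1 g2] := fgE i.
by rewrite [cut eta (g i) xi]/cut g1 g2 [cut xi (f i) eta]/cut f1 f2.
Qed.

End MultiplicityKernels.

(** * Scaling by p *)

Lemma theta_same (F : fieldType) L h n (u u' : {ffun 'I_n -> 'I_L.+1}) (Th : 'M[F]_#|{: {ffun 'I_n -> 'I_L.+1}}| -> F) :
  same u u' -> theta h u Th -> theta h u' Th.
Proof.
move=> uu' [D Z o b]; split=> //; first by rewrite -(one_same _ uu').
move=> E G eE eG H; rewrite /cut -(one_same _ uu'); apply: b => // w v nz uw.
have [|k] := H w v nz; first by apply: same_trans uw; rewrite same_sym.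
by exists k; rewrite (cnt_same _ uu').
Qed.

Section Scale.
Variables (F : fieldType) (L h p n : nat).
Hypothesis p_gt0 : (0 < p)%N.
Local Notation W n := {ffun 'I_n -> 'I_L.+1}.
Local Notation ker n := 'M[F]_#|{: W n}|.
Local Notation equiv := (@equiv F L h _).

Lemma scell_lt (i : 'I_(p * n)) : (i %/ p < n)%N.
Proof. by rewrite ltn_divLR // [X in (_ < X)%N]mulnC. Qed.

Definition scell (i : 'I_(p * n)) : 'I_n := Ordinal (scell_lt i).

Lemma scell_blocks : prime p -> blocks p scell (fun=> p) (fun x => p * x)%N.
Proof.
move=> pP; split=> [i x|x y xy|x|x]; last exact: pnat_id.
- rewrite -val_eqE /= eqn_leq andbC leq_divRL // -[(i %/ p <= x)%N]ltnS ltn_divLR //.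
  by rewrite mulnC [(x.+1 * p)%N]mulnC mulnS addnC.
- by rewrite -mulnSr leq_pmul2l.
by rewrite -mulnSr leq_pmul2l.
Qed.

Local Notation inf := (infl (L := L) scell).
Local Notation Br := (Br (F := F) (L := L) scell).

Lemma card_scell (P : pred 'I_n) : #|[set i | P (scell i)]| = (p * #|[set x | P x]|)%N.
Proof.
rewrite -sum1_card (partition_big scell P) /=; last by move=> i; rewrite inE.
rewrite (eq_bigr (fun=> p)) => [|x Px].
  rewrite sum_nat_const mulnC; congr (_ * _)%N.
  by apply: eq_card => x; rewrite !inE.
rewrite -[RHS]card_ord.
have lt (o : 'I_p) : (p * x + o < p * n)%N.
  by apply: (@leq_trans (p * x + p)%N); rewrite ?ltn_add2l // -mulnSr leq_pmul2l.
rewrite -(card_imset _ (_ : injective (fun o : 'I_p => Ordinal (lt o)))).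
  rewrite -sum1_card; apply: eq_bigl => i; rewrite inE; apply/andP/imsetP.
    case=> _ /eqP ix; exists (Ordinal (ltn_pmod i p_gt0)) => //.
    by apply: val_inj; rewrite /= -ix /= [(p * (i %/ p))%N]mulnC -divn_eq.
  have eqx o : scell (Ordinal (lt o)) = x.
    by apply: val_inj; rewrite /= [(p * x)%N]mulnC divnMDl // divn_small ?addn0.
  by case=> o _ ->; rewrite eqx eqxx.
by move=> o o' [] /addnI /val_inj.
Qed.

(** Inflation multiplies every joint letter count by p, and this factor can be cancelled. *)
Lemma same2_scell (y y' z z' : W n) t : inf z = act (inf y) t -> inf z' = act (inf y') t ->
  exists r, z = act y r /\ z' = act y' r.
Proof.
move=> e e'; pose yy : {ffun 'I_n -> _} := [ffun x => (y x, y' x)].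
pose zz : {ffun 'I_n -> _} := [ffun x => (z x, z' x)].
have [r er] : exists r, zz = act yy r.
  apply: act_conj_card => -[a b]; apply/eqP; rewrite -(eqn_pmul2l p_gt0) -!card_scell; apply/eqP.
  have := card_act2 (inf y) (inf y') (fun u v => (u == a) && (v == b)) t.
  rewrite -e -e' => c; transitivity #|[set i | (inf y i == a) && (inf y' i == b)]|.
    by apply: eq_card => i; rewrite !inE !ffunE.
  by rewrite -c; apply: eq_card => i; rewrite !inE !ffunE.
by exists r; split; apply/ffunP => i; move/ffunP/(_ i): er; rewrite !ffunE => -[].
Qed.

Hypothesis pP : prime p.
Let blkP := scell_blocks pP.

Lemma same_scell (y z : W n) : same (inf y) (inf z) = same y z.
Proof.
apply/sameP/sameP => -[s e].
  by have [r [-> _]] := same2_scell e e; exists r.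
by exists (liftp blkP (g := s) (fun=> erefl)); rewrite act_liftp e.
Qed.

Lemma Br_cut (u u' : W n) K : Br (cut (inf u) K (inf u')) = cut u (Br K) u'.
Proof. by apply: kvP => y y'; rewrite kv_Br !kv_cut !same_scell kv_Br. Qed.

Lemma Br_one (u : W n) : Br (one F (inf u)) = one F u.
Proof.
by apply: kvP => y y'; rewrite kv_Br !kv_one same_scell (inj_eq (infl_inj blkP)).
Qed.

Hypothesis p_odd : odd p.

Lemma equiv_Br K : equiv K -> equiv (Br K).
Proof. by move=> eK s y y'; rewrite (Br_equiv blkP (g := s) (fun=> erefl) p_odd _ _ eK). Qed.

Lemma cnt_scell (v : W n) k : cnt (inf v) k = (p * cnt v k)%N.
Proof. by rewrite -card_scell; apply: eq_card => i; rewrite !inE ffunE. Qed.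

Hypothesis charF : p \in [pchar F].

(** [Br] is multiplicative and inflation multiplies every [cnt] by p, so an inflated content is bad
    only if the original one is. *)
Lemma theta_Br (u : W n) (Th : ker n -> F) : theta h u Th -> theta h (inf u) (Th \o Br).
Proof.
move=> [D Z o b]; split=> [K K'|c K||E G eE eG H] /=.
- by rewrite BrD D.
- by rewrite BrZ Z.
- by rewrite Br_one.
rewrite Br_cut (BrM blkP p_odd charF eE eG); apply: b; [exact: equiv_Br|exact: equiv_Br|].
move=> w v; rewrite kv_Br => /H; rewrite same_scell => H' /H'[k].
by rewrite !cnt_scell ltn_pmul2l //; exists k.
Qed.

Definition rel2 (yy : W n * W n) (w w' : W (p * n)) : bool :=
  [exists s, (act (inf yy.1) s == w) && (act (inf yy.2) s == w')].

(* A section of [Br] on parity preserving kernels; for these no signs occur. *)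
Definition blow (K : ker n) : ker (p * n) := mkk (fun w w' =>
  if [pick yy | rel2 yy w w'] is Some yy then kv K yy.1 yy.2 else 0).

Section Blow.
Variable K : ker n.
Hypothesis eK : equiv K.
Hypothesis bK : bdiag h K.

Lemma kv_blow y y' s : kv (blow K) (act (inf y) s) (act (inf y') s) = kv K y y'.
Proof.
rewrite kv_mkk; case: pickP => [[z z'] /existsP[t /andP[/eqP e /eqP e']]|/(_ (y, y'))]; last first.
  by move/existsP; case; exists s; rewrite !eqxx.
have [r [-> ->]] : exists r, y = act z r /\ y' = act z' r.
  by apply: (@same2_scell z z' y y' (t * s^-1)%g); rewrite actM ?e ?e' actK.
rewrite /= eK; have [->|/bK ->] := eqVneq (kv K z z') 0; first by rewrite mulr0.
by rewrite eps_sq mul1r.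
Qed.

Lemma equiv_blow : equiv (blow K).
Proof.
move=> s w w'; case: (pickP (fun yy => rel2 yy w w')) => [[y y'] /existsP[t /andP[/eqP <- /eqP <-]]|H].
  rewrite -!actM !kv_blow; have [->|/bK e] := eqVneq (kv K y y') 0; first by rewrite mulr0.
  have oi v : oset h (inf v) = [set i | scell i \in oset h v].
    by apply/setP => i; rewrite !inE ffunE.
  by rewrite !oset_act /= !oi e eps_sq mul1r.
rewrite [X in _ * X]kv_mkk; case: pickP => [yy|_]; first by rewrite H.
rewrite mulr0 kv_mkk; case: pickP => // yy /existsP[t /andP[/eqP e /eqP e']].
have := H yy; rewrite /rel2 => /negbT/existsP[]; exists (t * s^-1)%g.
by rewrite !actM e e' !actK !eqxx.
Qed.

Lemma Br_blow : Br (blow K) = K.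
Proof.
by apply: kvP => y y'; rewrite kv_Br -[inf y]act1 -[inf y']act1 kv_blow.
Qed.

End Blow.

Lemma sumn_scale c : sumn (scale p c) = (p * sumn c)%N.
Proof. by elim: c => [|x c IH] /=; rewrite ?muln0 // IH mulnDr. Qed.

Lemma blk_scale c i : blk (scale p c) i = blk c (i %/ p).
Proof.
rewrite /blk size_map; apply: eq_count => k /=.
by rewrite -map_take sumn_scale leq_divRL // mulnC.
Qed.

Lemma bw_scale a b : bw (p * n) L h (scale p a) (scale p b) = inf (bw n L h a b).
Proof.
apply/ffunP => i; rewrite !ffunE /=; congr inord; rewrite /bwn !sumn_scale !blk_scale.
move: (i : nat) => {}i; rewrite ltn_divLR // mulnC; case: ifP => // _.
by rewrite divnBMl.
Qed.

End Scale.

Lemma mulmx_dim (F : fieldType) k k' (X : 'I_k' -> 'I_k -> F) (Y : 'I_k -> 'I_k' -> F) :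
  (forall i j, \sum_l X i l * Y l j = (i == j)%:R) -> (k' <= k)%N.
Proof.
move=> H; apply: (@mulmx1_min F k' k (\matrix_(i, l) X i l) (\matrix_(l, j) Y l j)).
by apply/matrixP => i j; rewrite !mxE -H; apply: eq_bigr => l _; rewrite !mxE.
Qed.

Section Comparison.
Variables (F : fieldType) (L h p n : nat).
Hypothesis pP : prime p.
Hypothesis p_odd : odd p.
Hypothesis charF : p \in [pchar F].
Hypothesis two_neq0 : (2%:R : F) != 0.
Variables a b l mu : seq nat.
Hypothesis ab_n : (sumn a + sumn b = n)%N.
Hypothesis lm_n : (sumn l + p * sumn mu = n)%N.
Hypotheses (a_h : (size a <= h)%N) (b_L : (h + size b <= L.+1)%N).
Hypotheses (l_h : (size l <= h)%N) (mu_L : (h + size mu <= L.+1)%N).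
Local Notation W n := {ffun 'I_n -> 'I_L.+1}.
Local Notation ker n := 'M[F]_#|{: W n}|.
Local Notation xi := (bw n L h l (scale p mu)).
Local Notation eta := (bw n L h a b).
Variables (Y : 'M[F]_(Nn n)) (Y' : 'M[F]_(Nn (p * n))).
Hypotheses (HY : isY p l mu Y) (HY' : isY p (scale p l) (scale p mu) Y').
Variables (m : nat) (V : 'I_m -> 'M[F]_(Nn n)) (k : nat).
Hypotheses (HV : KS_decomp (Mmod F n a b) V) (Hk : iso_count V Y k).
Variables (m' : nat) (V' : 'I_m' -> 'M[F]_(Nn (p * n))) (k' : nat).
Hypotheses (HV' : KS_decomp (Mmod F (p * n) (scale p a) (scale p b)) V') (Hk' : iso_count V' Y' k').
Variable Th : ker n -> F.
Hypothesis ThP : theta h xi Th.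

Lemma theta_pos : (0 < k)%N -> exists f g, [/\ equiv h f, equiv h g & Th (cut xi f eta *m cut eta g xi) != 0].
Proof.
move=> k0; have lm' : (sumn l + sumn (scale p mu) = n)%N by rewrite sumn_scale.
have sm : (h + size (scale p mu) <= L.+1)%N by rewrite size_map.
have [f [g [e d _]]] := multiplicity_kernels two_neq0 lm' l_h sm ab_n a_h b_L erefl ThP HY HV Hk.
by exists (f (Ordinal k0)), (g (Ordinal k0)); have [? ?] := e (Ordinal k0); split; rewrite // d eqxx oner_eq0.
Qed.

(** The matrix of the form on dual bases for (p lam|p^2 mu) is the identity of size k'; carried over
    by [Br] it factors through the k dual pairs for (lam|p mu). The converse needs lifts of those
    pairs, available once they preserve parity. *)
Lemma compare : (k' <= k)%N /\ (cnt xi h = cnt eta h -> (k <= k')%N).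
Proof.
have p0 := prime_gt0 pP.
have lm' : (sumn l + sumn (scale p mu) = n)%N by rewrite sumn_scale.
have sm : (h + size (scale p mu) <= L.+1)%N by rewrite size_map.
have [f [g [e d form]]] := multiplicity_kernels two_neq0 lm' l_h sm ab_n a_h b_L erefl ThP HY HV Hk.
have ThP' := theta_Br p0 pP p_odd charF ThP.
rewrite -(bw_scale L h n p0) in ThP'.
have [||||||f' [g' [e' d' form']]] := multiplicity_kernels (n := p * n) two_neq0 _ _ _ _ _ _ erefl ThP' HY' HV' Hk'.
- by rewrite !sumn_scale -mulnDr lm_n.
- by rewrite size_map.
- by rewrite !size_map.
- by rewrite !sumn_scale -mulnDr ab_n.
- by rewrite size_map.
- by rewrite size_map.
have tr x y : equiv h x -> equiv h y ->
    (Th \o Br (F := F) (L := L) (scell p0 (n := n)))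
      (cut (bw (p * n) L h (scale p l) (scale p (scale p mu))) x (bw (p * n) L h (scale p a) (scale p b)) *m
       cut (bw (p * n) L h (scale p a) (scale p b)) y (bw (p * n) L h (scale p l) (scale p (scale p mu)))) =
    Th (cut xi (Br (scell p0 (n := n)) x) eta *m cut eta (Br (scell p0 (n := n)) y) xi).
  move=> ex ey; rewrite /= (BrM (scell_blocks n p0 pP) p_odd charF (equiv_cut _ _ ex) (equiv_cut _ _ ey)).
  by rewrite !(bw_scale L h n p0) !(Br_cut p0 pP).
split.
  apply: (@mulmx_dim F k k' (fun i q => Th (cut xi (Br (scell p0 (n := n)) (f' i)) eta *m cut eta (g q) xi))
     (fun q j => Th (cut xi (f q) eta *m cut eta (Br (scell p0 (n := n)) (g' j)) xi))) => i j.
  have [ef _] := e' i; have [_ eg] := e' j.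
  rewrite -form; [|exact: (equiv_Br p0 pP p_odd ef)|exact: (equiv_Br p0 pP p_odd eg)].
  by rewrite -(tr _ _ ef eg) d'.
move=> cc.
(* With equally many even letters, dual bases may be replaced by parity preserving kernels without
   changing their values against equivariant ones. *)
have /fin_all_exists[f0 Hf0] : forall i, exists K0, [/\ equiv h K0, bdiag h K0 & forall G, equiv h G ->
    Th (cut xi (f i) eta *m cut eta G xi) = Th (cut xi K0 eta *m cut eta G xi)].
  by move=> i; have [ef _] := e i; apply: (theta_bdiag_l two_neq0 ThP cc ef).
have /fin_all_exists[g0 Hg0] : forall i, exists K0, [/\ equiv h K0, bdiag h K0 & forall G, equiv h G ->
    Th (cut xi G eta *m cut eta (g i) xi) = Th (cut xi G eta *m cut eta K0 xi)].
  by move=> i; have [_ eg] := e i; apply: (theta_bdiag_r two_neq0 ThP cc eg).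
pose Bl K := blow (L := L) p0 (n := n) K : ker (p * n).
have eB (K : ker n) : equiv h K -> bdiag h K -> equiv h (Bl K) by move=> *; apply: equiv_blow.
have BB (K : ker n) : equiv h K -> bdiag h K -> Br (scell p0 (n := n)) (Bl K) = K.
  by move=> eK bK; apply: (Br_blow p0 eK bK).
pose Th' := Th \o Br (F := F) (L := L) (scell p0 (n := n)).
pose xi' := bw (p * n) L h (scale p l) (scale p (scale p mu)).
pose eta' := bw (p * n) L h (scale p a) (scale p b).
apply: (@mulmx_dim F k' k (fun i q => Th' (cut xi' (Bl (f0 i)) eta' *m cut eta' (g' q) xi'))
   (fun q j => Th' (cut xi' (f' q) eta' *m cut eta' (Bl (g0 j)) xi'))) => i j.
have [ef bf hf] := Hf0 i; have [eg bg hg] := Hg0 j; have [_ egj] := e j.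
rewrite -form'; [|exact: eB|exact: eB].
by rewrite tr ?BB -?hg -?hf //; apply: eB.
Qed.

End Comparison.

(** * p-adic columns *)

Lemma blk_eq c i k : (k < size c)%N ->
  (blk c i == k) = (sumn (take k c) <= i < sumn (take k.+1 c))%N.
Proof.
elim: c i k => // x c IH i [|k] /= kc; rewrite blk_cons.
  by rewrite take0 addn0; case: leqP.
case: (leqP x i) => xi; last first.
  by apply/esym/negbTE/negP => /andP[le _]; move: (leq_trans (leq_addr _ _) le); rewrite leqNgt xi.
by rewrite eqSS IH // leq_subRL // ltn_subLR.
Qed.

Lemma blocks_exist (p n d : nat) (q : 'I_d -> nat) : (\sum_x q x = n)%N -> (forall x, p.-nat (q x)) ->
  exists (cell : 'I_n -> 'I_d) (st : 'I_d -> nat), blocks p cell q st.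
Proof.
move=> qn qp; pose c := [seq q x | x : 'I_d].
have sc : size c = d by rewrite size_map size_enum_ord.
have cn : sumn c = n by rewrite -qn sumnE big_map big_enum.
have nc (x : 'I_d) : nth 0%N c x = q x by rewrite (nth_map x) ?size_enum_ord // nth_ord_enum.
have tk (x : 'I_d) : sumn (take x.+1 c) = (sumn (take x c) + q x)%N.
  by rewrite (take_nth 0%N) ?sc // -cats1 sumn_cat /= addn0 nc.
have lt (i : 'I_n) : (blk c i < d)%N.
  by have [|_] := @blk_cat_l c [::] i; rewrite ?cn // sc.
exists (fun i => Ordinal (lt i)), (fun x => sumn (take x c)); split=> // [i x|x y xy|x].
- by rewrite -val_eqE /= blk_eq ?sc // tk.
- by rewrite -tk -(take_takel c xy) -[X in (_ <= sumn X)%N](cat_take_drop x.+1) sumn_cat leq_addr.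
by rewrite -tk -cn -{2}(cat_take_drop x.+1 c) sumn_cat leq_addr.
Qed.

(** For a partition, the number of columns of height k + 1 in its diagram. *)
Definition dif (l : seq nat) (k : nat) : nat := (nth 0 l k - nth 0 l k.+1)%N.

Lemma dif_sum l t : sorted geq l -> (\sum_(t <= k < size l) dif l k = nth 0 l t)%N.
Proof.
move=> srt; have [le|lt] := leqP (size l) t; first by rewrite big_geq // nth_default.
have mono k : (nth 0 l k.+1 <= nth 0 l k)%N.
  have [kl|kl] := leqP (size l) k.+1; first by rewrite nth_default.
  have tr : transitive geq by move=> u v w /=; lia.
  by apply: (sorted_ltn_nth tr 0%N srt k k.+1); rewrite ?inE //; apply: ltnW.
have anti k : (t <= k)%N -> (nth 0 l k <= nth 0 l t)%N.
  by elim: k => [|k IH]; rewrite leq_eqVlt => /orP[/eqP <- //|] // /IH; apply: leq_trans.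
suff H m : (t <= m)%N -> (\sum_(t <= k < m) dif l k = nth 0 l t - nth 0 l m)%N.
  by rewrite H ?(ltnW lt) // [nth 0%N l (size l)]nth_default // subn0.
elim: m => [|m IH] tm; first by move: tm; rewrite leqn0 => /eqP ->; rewrite big_geq // subnn.
move: tm; rewrite leq_eqVlt => /orP[/eqP <-|tm]; first by rewrite big_geq // subnn.
rewrite big_nat_recr //= IH // /dif; have := mono m; have := anti m tm.
by move: (nth _ _ t) (nth _ _ m) (nth _ _ m.+1) => x y z; lia.
Qed.

Section Columns.
Variable p : nat.

Definition dig (x i : nat) : nat := (x %/ p ^ i %% p)%N.

Lemma dig_sum x I : (1 < p)%N -> (\sum_(i < I) p ^ i * dig x i = x %% p ^ I)%N.
Proof.
move=> p_gt1; elim: I => [|I IH]; first by rewrite big_ord0 expn0 modn1.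
rewrite big_ord_recr /= IH /dig expnSr; set P := (p ^ I)%N; set y := (x %/ P)%N.
have P0 : (0 < P)%N by rewrite expn_gt0 ltnW.
have xE : (x = y %/ p * (P * p) + (P * (y %% p) + x %% P))%N.
  rewrite {1}(divn_eq x P) -/y {1}(divn_eq y p) mulnDl -!mulnA addnA.
  by rewrite [(p * P)%N]mulnC [(y %% p * P)%N]mulnC.
rewrite [in RHS]xE modnMDl [RHS]modn_small; first by rewrite addnC.
have lt : (x %% P < P)%N by rewrite ltn_mod.
have lt' : (y %% p < p)%N by rewrite ltn_mod ltnW.
apply: (@leq_trans (P * (y %% p).+1)%N); first by rewrite mulnS addnC ltn_add2r.
by rewrite leq_pmul2l.
Qed.

(* A column of height k+1 and weight p^i for each unit of the i-th digit of l_k - l_(k+1); [I] bounds the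
   number of digits.  In [cols] the columns of [mu] are odd and their weight is multiplied by p. *)
Variable I : nat.

Definition cols1 (l : seq nat) : seq (nat * nat) :=
  flatten [seq nseq (dig (dif l ik.2) ik.1) (ik.1, ik.2.+1)
    | ik <- [seq (i, k) | i <- iota 0 I, k <- iota 0 (size l)]].

Lemma cols1_sum l (G : nat * nat -> nat) : (\sum_(c <- cols1 l) G c =
  \sum_(i < I) \sum_(k < size l) dig (dif l k) i * G (i : nat, k.+1))%N.
Proof.
rewrite big_flatten big_map big_allpairs_dep /= -{1}[I]subn0 big_mkord.
apply: eq_bigr => i _; rewrite -{1}[size l]subn0 big_mkord.
by apply: eq_bigr => k _; rewrite big_nseq iter_addn_0 mulnC.
Qed.

Variables l mu : seq nat.

Definition cols : seq (bool * nat * nat) :=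
  [seq (false, c.1, c.2) | c <- cols1 l] ++ [seq (true, c.1.+1, c.2) | c <- cols1 mu].

Local Notation colat c := (nth (false, 0%N, 0%N) cols c).

(* Cells are pairs (index of a column, row). *)
Definition cells : seq (nat * nat) :=
  [seq (c, j) | c <- iota 0 (size cols), j <- iota 0 (colat c).2].

Definition ccol (x : 'I_(size cells)) : nat := (nth (0, 0)%N cells x).1.
Definition crow (x : 'I_(size cells)) : nat := (nth (0, 0)%N cells x).2.

(** The weights of rows and the numbers of cells of given exponent are all instances of this formula
    for a suitable [G]. *)
Lemma cell_sum (G : bool * nat * nat -> nat -> nat) :
  (\sum_x G (colat (ccol x)) (crow x) =
   \sum_(i < I) \sum_(k < size l) dig (dif l k) i * \sum_(j < k.+1) G (false, i : nat, k.+1) j +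
   \sum_(i < I) \sum_(k < size mu) dig (dif mu k) i * \sum_(j < k.+1) G (true, i.+1, k.+1) j)%N.
Proof.
rewrite -(big_mkord predT (fun x => G (colat (nth (0, 0)%N cells x).1) (nth (0, 0)%N cells x).2)).
rewrite -(big_nth (0, 0)%N predT (fun cj => G (colat cj.1) cj.2)) big_allpairs_dep /=.
transitivity (\sum_(c <- cols) \sum_(j < c.2) G c j)%N.
  rewrite (big_nth (false, 0%N, 0%N)) /index_iota subn0; apply: eq_bigr => c _.
  by rewrite -{1}[(colat c).2]subn0 big_mkord.
rewrite big_cat !big_map /=.
by rewrite (cols1_sum l (fun c => \sum_(j < c.2) G (false, c.1, c.2) j)%N)
  (cols1_sum mu (fun c => \sum_(j < c.2) G (true, c.1.+1, c.2) j)%N).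
Qed.

Lemma cells_uniq : uniq cells.
Proof.
apply: allpairs_uniq_dep => [|c _|[a b] [c d] _ _ /= [-> ->] //]; exact: iota_uniq.
Qed.

Lemma cellP (x : 'I_(size cells)) : (ccol x < size cols)%N /\ (crow x < (colat (ccol x)).2)%N.
Proof.
rewrite /ccol /crow; have := mem_nth (0, 0)%N (ltn_ord x).
by case/allpairsPdep => c [j [cI jI ->]] /=; rewrite !mem_iota in cI jI; lia.
Qed.

Lemma cell_at c j : (c < size cols)%N -> (j < (colat c).2)%N ->
  exists x : 'I_(size cells), ccol x = c /\ crow x = j.
Proof.
move=> cc jj; have m : (c, j) \in cells.
  by apply/allpairsPdep; exists c, j; rewrite !mem_iota.
have lt : (index (c, j) cells < size cells)%N by rewrite index_mem.
by exists (Ordinal lt); rewrite /ccol /crow /= nth_index.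
Qed.

Lemma cell_inj x y : ccol x = ccol y -> crow x = crow y -> x = y.
Proof.
rewrite /ccol /crow => e1 e2; apply: val_inj; apply/eqP.
rewrite -(nth_uniq (0, 0)%N (ltn_ord x) (ltn_ord y) cells_uniq).
by apply/eqP; move: e1 e2; case: nth => ? ?; case: nth => ? ? /= -> ->.
Qed.

Lemma col_data c : (c < size cols)%N ->
  if (colat c).1.1 then (0 < (colat c).1.2)%N /\ ((colat c).2 <= size mu)%N
  else ((colat c).2 <= size l)%N.
Proof.
have c1 s (ik : nat * nat) : ik \in cols1 s -> (ik.2 <= size s)%N.
  case/flattenP => t /mapP[[i k] /allpairsPdep[i' [k' [_ kI [-> ->]]]] ->].
  by rewrite mem_nseq => /andP[_ /eqP ->] /=; rewrite mem_iota in kI; lia.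
move=> /(mem_nth (false, 0%N, 0%N)); rewrite /cols mem_cat.
by case/orP => /mapP[ik /c1 le ->].
Qed.

End Columns.

Section DigitSums.
Variable p : nat.
Hypothesis p_gt1 : (1 < p)%N.
Variable I : nat.

Lemma sum_ord_eq k t (c : nat) : (\sum_(j < k.+1) (j == t :> nat) * c = (t <= k) * c)%N.
Proof.
rewrite -big_distrl /=; congr (_ * _)%N; case: leqP => tk.
  by rewrite (bigD1 (Ordinal (tk : (t < k.+1)%N))) //= eqxx big1 // => j; rewrite -val_eqE /= => /negbTE ->.
by rewrite big1 // => j _; rewrite ltn_eqF // (leq_trans (ltn_ord j)).
Qed.

Lemma sum_nat_ord (f : nat -> nat) t m : (\sum_(t <= k < m) f k = \sum_(k < m) (t <= k) * f k)%N.
Proof.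
rewrite big_geq_mkord big_mkcond; apply: eq_bigr => k _ /=.
by case: leqP; rewrite ?mul1n.
Qed.

Lemma dif_small l k : (sumn l < p ^ I)%N -> (dif l k < p ^ I)%N.
Proof.
move=> lt; apply: leq_ltn_trans lt; apply: leq_trans (leq_subr _ _) _.
by elim: l k => [|x l IH] [|k] //=; rewrite ?leq_addr // (leq_trans (IH k)) ?leq_addl.
Qed.

(** Row t meets the columns of height k + 1 with k >= t. Recombining digits leaves the sum of
    [dif l k] over these k, which telescopes. *)
Lemma digit_row l t : sorted geq l -> (sumn l < p ^ I)%N ->
  (\sum_(i < I) \sum_(k < size l) dig p (dif l k) i * \sum_(j < k.+1) (j == t :> nat) * p ^ i
   = nth 0 l t)%N.
Proof.
move=> srt lt; rewrite exchange_big /= -(dif_sum t srt) sum_nat_ord; apply: eq_bigr => k _.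
rewrite -[in RHS](modn_small (dif_small k lt)) -(dig_sum _ _ p_gt1) big_distrr; apply: eq_bigr => i _.
by rewrite sum_ord_eq /= mulnCA [(p ^ i * _)%N]mulnC.
Qed.

Lemma sumn_pdigit l i : sumn (pdigit p l i) =
  (\sum_(k < size l) dig p (dif l k) i * k.+1)%N.
Proof.
rewrite /pdigit sumnE big_map -{1}[size l]subn0 big_mkord.
transitivity (\sum_(j < size l) \sum_(k < size l) (j <= k) * dig p (dif l k) i)%N.
  by apply: eq_bigr => j _; rewrite sum_nat_ord.
rewrite exchange_big /=; apply: eq_bigr => k _; rewrite -big_distrl mulnC /=; congr (_ * _)%N.
transitivity (\sum_(j < size l | (j < k.+1)%N) 1)%N.
  by rewrite [RHS]big_mkcond; apply: eq_bigr => j _; rewrite ltnS; case: leqP.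
by rewrite (big_ord_narrow (ltn_ord k)) sum_nat_const card_ord muln1.
Qed.

End DigitSums.

Lemma sumn_mkseq (f : nat -> nat) m : sumn (mkseq f m) = (\sum_(t < m) f t)%N.
Proof. by rewrite sumnE big_map -{1}[m]subn0 big_mkord. Qed.

(** [inLambda] demands compositions without trailing zeros, whereas letter counts run over the whole
    alphabet. *)
Fixpoint trim (s : seq nat) : seq nat :=
  if s is x :: s' then if (trim s' == [::]) && (x == 0%N) then [::] else x :: trim s' else [::].

Lemma trim_comp s : is_comp (trim s).
Proof.
rewrite /is_comp; elim: s => //= x s; case E: (trim s) => [|y t] //= _.
by have [|nx] := eqVneq x 0%N.
Qed.

Lemma nth_trim s i : nth 0%N (trim s) i = nth 0%N s i.
Proof.
elim: s i => //= x s IH i; case: ifP => [/andP[/eqP e /eqP ->]|_].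
  by case: i => [|i] //=; rewrite -IH e !nth_nil.
by case: i => [|i] //=.
Qed.

Lemma sumn_trim s : sumn (trim s) = sumn s.
Proof.
elim: s => //= x s <-; case: ifP => [/andP[/eqP -> /eqP ->]|_] //=.
Qed.

(** * The tableau of p-adic columns and elements of Lambda *)

Section Decomposition.
Variables (p n L h : nat) (l mu : seq nat).
Hypotheses (l_h : (size l <= h)%N) (mu_L : (h + size mu <= L.+1)%N).

Local Notation cls := (cols p n.+1 l mu).
Local Notation d := (size (cells p n.+1 l mu)).
Local Notation colat c := (nth (false, 0%N, 0%N) cls c).

(* The i-th letter of [cword] is the row of the i-th cell, shifted by [h] for the odd columns, so that its
   inflation to blocks of length [p ^ cexp] has the content of (l | p mu). *)
Definition cpar (x : 'I_d) : bool := (colat (ccol x)).1.1.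
Definition cexp (x : 'I_d) : nat := (colat (ccol x)).1.2.
Definition clet (x : 'I_d) : nat := if cpar x then (h + crow x)%N else crow x.
Definition cword : {ffun 'I_d -> 'I_L.+1} := [ffun x => inord (clet x)].

Lemma crow_lt x : if cpar x then (0 < cexp x)%N /\ (crow x < size mu)%N else (crow x < size l)%N.
Proof.
have [c1 c2] := cellP x; have := col_data c1; rewrite /cpar /cexp.
by case: ifP => _; [case=> ? le; split|move=> le]; rewrite // (leq_trans c2).
Qed.

Lemma cwordE x : cword x = clet x :> nat.
Proof.
rewrite ffunE inordK // /clet; have := crow_lt x.
by case: ifP => _; [case=> _|]; lia.
Qed.

Lemma cword_par x : (h <= cword x)%N = cpar x.
Proof.
rewrite cwordE /clet; have := crow_lt x; case: ifP => // _; first by rewrite leq_addr.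
by move=> lt; apply/negbTE; rewrite -ltnNge; lia.
Qed.

Hypothesis pP : prime p.
Hypotheses (l_part : is_part l) (mu_part : is_part mu).
Hypothesis lm_n : (sumn l + p * sumn mu = n)%N.

Let p_gt1 : (1 < p)%N := prime_gt1 pP.

(** Hence n.+1 digits suffice for the parts of [l] and [mu]. *)
Let n_lt : (n < p ^ n.+1)%N.
Proof. by apply: ltn_trans (ltn_expl n p_gt1) _; rewrite ltn_exp2l. Qed.

Let l_lt : (sumn l < p ^ n.+1)%N.
Proof. by apply: leq_ltn_trans n_lt; rewrite -lm_n leq_addr. Qed.

Let mu_lt : (sumn mu < p ^ n.+1)%N.
Proof.
apply: leq_ltn_trans n_lt; rewrite -lm_n; apply: leq_trans (leq_addl _ _).
by rewrite leq_pmull // prime_gt0.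
Qed.

Lemma cword_even t : (\sum_(x | ~~ cpar x && (crow x == t)) p ^ cexp x = nth 0 l t)%N.
Proof.
pose G (c : bool * nat * nat) (j : nat) := ((~~ c.1.1) * ((j == t) * p ^ c.1.2))%N.
transitivity (\sum_(x : 'I_d) G (colat (ccol x)) (crow x))%N.
  rewrite big_mkcond; apply: eq_bigr => x _; rewrite /cpar /cexp /G.
  by case: (_.1.1) => //=; case: eqP => _; rewrite ?mul1n.
rewrite (cell_sum _ _ _ _ G) /G /= [X in (_ + X)%N]big1 ?addn0 => [|i _]; last first.
  by rewrite big1 // => k _; rewrite big1 ?muln0 // => j _; rewrite mul0n.
rewrite -(digit_row (I := n.+1) p_gt1 t (proj1 (andP l_part)) l_lt).
by apply: eq_bigr => i _; apply: eq_bigr => k _; congr (_ * _)%N; apply: eq_bigr => j _; rewrite mul1n.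
Qed.

Lemma cword_odd t : (\sum_(x | cpar x && (crow x == t)) p ^ cexp x = p * nth 0 mu t)%N.
Proof.
pose G (c : bool * nat * nat) (j : nat) := (c.1.1 * ((j == t) * p ^ c.1.2))%N.
transitivity (\sum_(x : 'I_d) G (colat (ccol x)) (crow x))%N.
  rewrite big_mkcond; apply: eq_bigr => x _; rewrite /cpar /cexp /G.
  by case: (_.1.1) => //=; case: eqP => _; rewrite ?mul1n.
rewrite (cell_sum _ _ _ _ G) /G /= [X in (X + _)%N]big1 ?add0n => [|i _]; last first.
  by rewrite big1 // => k _; rewrite big1 ?muln0 // => j _; rewrite mul0n.
rewrite -(digit_row (I := n.+1) p_gt1 t (proj1 (andP mu_part)) mu_lt) big_distrr /=.
apply: eq_bigr => i _; rewrite big_distrr /=; apply: eq_bigr => k _.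
rewrite [RHS]mulnCA; congr (_ * _)%N; rewrite big_distrr /=; apply: eq_bigr => j _.
by rewrite mul1n expnS mulnCA.
Qed.

(** So the block lengths are the parts of rho: digit i of [l] gives even cells of exponent i, digit
    i - 1 of [mu] odd ones. *)
Lemma cexp_card i : (i <= n)%N -> #|[set x | cexp x == i]| = nsz p l mu i.
Proof.
move=> le_in; rewrite -sum1_card (eq_bigl (fun x => cexp x == i)) => [|x]; last by rewrite inE.
pose G (c : bool * nat * nat) (j : nat) := (c.1.2 == i : nat).
transitivity (\sum_(x : 'I_d) G (colat (ccol x)) (crow x))%N.
  by rewrite big_mkcond; apply: eq_bigr => x _; rewrite /cexp /G; case: eqP.
rewrite (cell_sum _ _ _ _ G) /G /= /nsz; congr (_ + _)%N.
  rewrite (bigD1 (Ordinal (le_in : (i < n.+1)%N))) //= [X in (_ + X)%N]big1 ?addn0 => [|j ji]; last first.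
    rewrite big1 // => k _; rewrite big1 ?muln0 // => m _.
    by rewrite -val_eqE /= in ji; rewrite (negbTE ji).
  rewrite sumn_pdigit; apply: eq_bigr => k _.
  by rewrite eqxx sum_nat_const card_ord muln1.
case: i le_in {G} => [|i] le_in; first by rewrite big1 // => j _; rewrite big1 // => k _; rewrite big1 ?muln0.
have lt : (i < n.+1)%N by apply: ltnW.
rewrite (bigD1 (Ordinal lt)) //= [X in (_ + X)%N]big1 ?addn0 => [|j ji]; last first.
  rewrite big1 // => k _; rewrite big1 ?muln0 // => m _.
  by rewrite -val_eqE /= in ji; rewrite eqSS (negbTE ji).
rewrite sumn_pdigit; apply: eq_bigr => k _.
by rewrite eqxx sum_nat_const card_ord muln1.
Qed.

Lemma sum_clet (Q : pred 'I_d) (m : nat) : (forall x, Q x -> (crow x < m)%N) ->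
  (\sum_(x | Q x) p ^ cexp x = \sum_(t < m) \sum_(x | Q x && (crow x == t)) p ^ cexp x)%N.
Proof.
move=> H; rewrite (exchange_big_dep Q) /=; last by move=> t x _ /andP[].
apply: eq_bigr => x Qx; rewrite (big_pred1 (Ordinal (H x Qx))) // => t /=.
by rewrite Qx /= -val_eqE /= eq_sym.
Qed.

Lemma sumn_nth (s : seq nat) : sumn s = (\sum_(t < size s) nth 0 s t)%N.
Proof. by rewrite sumnE (big_nth 0%N) big_mkord. Qed.

Lemma cexp_sum : (\sum_(x : 'I_d) p ^ cexp x = n)%N.
Proof.
rewrite (bigID cpar) /= (sum_clet (m := size mu)) => [|x]; last first.
  by have := crow_lt x; case: ifP => // _ [].
rewrite [X in (_ + X)%N](sum_clet (m := size l)) => [|x /negbTE px]; last first.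
  by have := crow_lt x; rewrite px.
rewrite -[RHS]lm_n (sumn_nth l) (sumn_nth mu) big_distrr /= addnC; congr (_ + _)%N.
  by apply: eq_bigr => t _; rewrite cword_even.
by apply: eq_bigr => t _; rewrite cword_odd.
Qed.

Section Blocks.
Variables (cell : 'I_n -> 'I_d) (st : 'I_d -> nat).
Hypothesis bl : blocks p cell (fun x => p ^ cexp x)%N st.

Lemma cword_same : same (bw n L h l (scale p mu)) (infl cell cword).
Proof.
have lm' : (sumn l + sumn (scale p mu) = n)%N by rewrite sumn_scale.
have sm : (h + size (scale p mu) <= L.+1)%N by rewrite size_map.
apply/sameP; apply: act_conj_card => t.
have := card_bw lm' l_h sm t => e.
have -> : #|[set i | bw n L h l (scale p mu) i == t]| = #|[set i | bw n L h l (scale p mu) i == t :> nat]|.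
  by apply: eq_card => i; rewrite !inE.
rewrite e (card_infl bl cword (pred1 t)) /=.
have ns : nth 0%N (scale p mu) (t - h) = (p * nth 0 mu (t - h))%N.
  have [le|lt] := leqP (size mu) (t - h); last by rewrite (nth_map 0%N).
  by rewrite !nth_default ?size_map ?muln0.
case: ltnP => th; [rewrite -cword_even|rewrite ns -cword_odd]; apply: eq_bigl => x.
  rewrite -val_eqE /= cwordE /clet; have := crow_lt x.
  by case: ifP => //= _ _; apply/esym/negbTE/eqP; lia.
rewrite -val_eqE /= cwordE /clet; have := crow_lt x.
by case: ifP => //= _ lt; [apply/idP/idP => /eqP ?; apply/eqP; lia|apply/esym/negbTE/eqP; lia].
Qed.

Lemma cexp_le_n x : (cexp x <= n)%N.
Proof.
have : (p ^ cexp x <= n)%N by rewrite -cexp_sum (bigD1 x) //= leq_addr.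
by apply: leq_trans; apply: ltnW; apply: ltn_expl.
Qed.

Lemma cexp_le x : (cexp x <= rmax p n l mu)%N.
Proof.
have le := cexp_le_n x; have lt : (cexp x < n.+1)%N by [].
apply: (@leq_bigmax_cond _ (fun i : 'I_n.+1 => nsz p l mu i != 0%N) (fun i : 'I_n.+1 => i : nat) (Ordinal lt)).
by rewrite /= -cexp_card // -lt0n; apply/card_gt0P; exists x; rewrite inE.
Qed.

Variables a b : seq nat.
Hypothesis ab_n : (sumn a + sumn b = n)%N.
Hypotheses (a_h : (size a <= h)%N) (b_L : (h + size b <= L.+1)%N).
Variable v : {ffun 'I_d -> 'I_L.+1}.
Hypothesis v_same : same (bw n L h a b) (infl cell v).

(** A word on the blocks is read as an element of Lambda by counting its letters separately over the
    blocks of each length p^i. *)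
Definition gam i := trim (mkseq (fun t => #|[set x | (cexp x == i) && (v x == t :> nat)]|) h).
Definition del i :=
  trim (mkseq (fun t => #|[set x | (cexp x == i) && (v x == h + t :> nat)%N]|) (L.+1 - h)).

Lemma v_weight (t : nat) :
  (\sum_(i < (rmax p n l mu).+1) p ^ i * #|[set x | (cexp x == i) && (v x == t :> nat)]| =
   if (t < h)%N then nth 0 a t else nth 0 b (t - h))%N.
Proof.
rewrite -(card_bw ab_n a_h b_L) .
have -> : #|[set i | bw n L h a b i == t :> nat]| = #|[set i | infl cell v i == t :> nat]|.
  case/sameP: v_same => s ->; rewrite -(card_act2 (bw n L h a b) (bw n L h a b) (fun u _ => u == t :> nat) s).
  by apply: eq_card => i; rewrite !inE.
rewrite (card_infl bl v (fun u => u == t :> nat)).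
rewrite (partition_big (fun x => Ordinal (cexp_le x : (cexp x < (rmax p n l mu).+1)%N)) predT) //=.
apply: eq_bigr => i _; rewrite (eq_bigr (fun=> p ^ i)%N) => [|x /andP[_ /eqP <-]] //.
rewrite sum_nat_const mulnC; congr (_ * _)%N; apply: eq_card => x.
by rewrite !inE [RHS]unfold_in /= -[in RHS]val_eqE andbC.
Qed.

Lemma gam_del_inLambda : inLambda p n l mu a b gam del.
Proof.
have hL : (h <= L.+1)%N by apply: leq_trans b_L; apply: leq_addr.
have fr i t : (L.+1 <= t)%N -> #|[set x | (cexp x == i) && (v x == t :> nat)]| = 0%N.
  move=> Lt; apply/eqP; rewrite cards_eq0; apply/eqP/setP => x; rewrite !inE.
  by apply/negbTE/negP => /andP[_ /eqP e]; have := ltn_ord (v x); rewrite e ltnNge Lt.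
split; last split.
- move=> i ir; split; try exact: trim_comp.
  rewrite !sumn_trim -sumn_cat.
  rewrite -(mkseq_cat (fun t => #|[set x | (cexp x == i) && (v x == t :> nat)]|)) subnKC //.
  have le_in : (i <= n)%N.
    apply: leq_trans ir _; by apply/bigmax_leqP => j _; rewrite -ltnS.
  rewrite sumn_mkseq -cexp_card // -sum1_card (partition_big v predT) //=.
  apply: eq_bigr => t _; rewrite -sum1_card; apply: eq_bigl => x.
  by rewrite !inE -val_eqE.
- move=> j; have [jh|hj] := ltnP j h.
    have := v_weight j; rewrite jh => <-; apply: eq_bigr => i _; congr (_ * _)%N.
    by rewrite nth_trim nth_mkseq.
  rewrite nth_default ?(leq_trans a_h) // big1 // => i _.
  by rewrite nth_trim nth_default ?size_mkseq ?muln0.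
move=> j; have := v_weight (h + j); rewrite ltnNge leq_addr addKn /= => <-.
apply: eq_bigr => i _; congr (_ * _)%N; rewrite nth_trim.
have [jl|lj] := ltnP j (L.+1 - h); first by rewrite nth_mkseq.
by rewrite nth_default ?size_mkseq // fr //; lia.
Qed.

(** On blocks of length 1 both words are even: [v] because delta_0 is empty, [cword] because odd
    columns have positive exponent. *)
Lemma del0_cnt : del 0%N = [::] ->
    (forall x, (1 < p ^ cexp x)%N -> (h <= v x)%N = (h <= cword x)%N) ->
  cnt (bw n L h l (scale p mu)) h = cnt (bw n L h a b) h.
Proof.
move=> d0 par; rewrite (cnt_same _ cword_same) (cnt_same _ v_same).
suff H x : (h <= v x)%N = (h <= cword x)%N.
  apply: eq_card => i; have e (w : {ffun 'I_d -> 'I_L.+1}) : infl cell w i = w (cell i) by rewrite ffunE.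
  by rewrite !inE !e !ltnNge H.
have [e0|e1] := posnP (cexp x); last first.
  by apply: par; rewrite -{1}(exp1n (cexp x)) ltn_exp2r.
rewrite cword_par; have := crow_lt x; case: ifP => [_ []|_ _]; first by rewrite e0.
apply/negbTE/negP => hv; have lt := ltn_ord (v x).
have := nth_trim (mkseq (fun t => #|[set x | (cexp x == 0%N) && (v x == h + t :> nat)%N]|) (L.+1 - h)) (v x - h).
rewrite -/(del 0) d0 nth_nil nth_mkseq ?ltn_sub2r ?(leq_ltn_trans hv) // subnKC // => /esym/eqP.
rewrite cards_eq0 => /eqP/setP/(_ x); by rewrite !inE e0 !eqxx.
Qed.

End Blocks.
End Decomposition.

Theorem theorem1p2 (F : fieldType) (p : nat) (pP : prime p) (p_odd : odd p)
  (charF : p \in [pchar F])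
  (n : nat) (a b lam mu : seq nat)
  (a_part : is_part a) (b_part : is_part b) (ab_n : (sumn a + sumn b)%N = n)
  (lam_part : is_part lam) (mu_part : is_part mu)
  (lm_n : (sumn lam + p * sumn mu)%N = n)
  (Y : 'M[F]_(Nn n)) (Y' : 'M[F]_(Nn (p * n)))
  (HY : isY p lam mu Y) (HY' : isY p (scale p lam) (scale p mu) Y')
  (m : nat) (V : 'I_m -> 'M[F]_(Nn n)) (HV : KS_decomp (Mmod F n a b) V)
  (m' : nat) (V' : 'I_m' -> 'M[F]_(Nn (p * n)))
  (HV' : KS_decomp (Mmod F (p * n) (scale p a) (scale p b)) V')
  (k k' : nat) (Hk : iso_count V Y k) (Hk' : iso_count V' Y' k') :
  (k' <= k)%N /\
  ((forall g d : nat -> seq nat, inLambda p n lam mu a b g d -> d 0%N = [::]) ->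
   k' = k).
Proof.
have two_neq0 : (2%:R : F) != 0.
  by rewrite -(dvdn_pcharf charF) gtnNdvd // odd_prime_gt2.
(* Enough even and odd letters for (lam|p mu) and (a|b) at once; one more letter keeps the successor
   form of the ordinal type. *)
pose h := maxn (size lam) (size a); pose L := (h + maxn (size mu) (size b))%N.
have a_h : (size a <= h)%N by rewrite leq_maxr.
have l_h : (size lam <= h)%N by rewrite leq_maxl.
have b_L : (h + size b <= L.+1)%N by rewrite ltnW // ltnS leq_add2l leq_maxr.
have mu_L : (h + size mu <= L.+1)%N by rewrite ltnW // ltnS leq_add2l leq_maxl.
have [cell [st bl]] : exists (cell : 'I_n -> 'I_(size (cells p n.+1 lam mu))) st,
    blocks p cell (fun x => p ^ cexp x)%N st.
  apply: blocks_exist => [|x]; last by rewrite pnatX pnat_id.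
  exact: (cexp_sum pP lam_part mu_part lm_n).
pose u0 := cword p n L h lam mu.
pose D := 'I_(size (cells p n.+1 lam mu)).
have par (x : D) : (h <= u0 x)%N = cpar x by apply: cword_par.
have uE (x : D) : u0 x = clet h x :> nat by apply: cwordE.
pose col (x : D) := Ordinal (proj1 (cellP x)).
have colE (x y : D) : col x = col y -> ccol x = ccol y by case.
have jt : theta h (infl cell u0) (james (F := F) cell col u0).
  apply: (james_theta p_odd charF two_neq0 bl).
  - by move=> x y /colE e; rewrite /cexp e.
  - by move=> x y /colE e; rewrite !par /cpar e.
  - move=> x y /colE e uxy; apply: (cell_inj e).
    have := congr1 val uxy; rewrite /= !uE /clet /cpar e.
    by case: ifP => // _ /addnI.
  - move=> x t; rewrite par uE /clet => tx tp.
    have [c1 c2] := cellP x.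
    have [|y [cy ry]] := @cell_at p n.+1 lam mu (ccol x) (if cpar x then t - h else t)%N c1.
      by apply: leq_ltn_trans c2; move: tx; case: ifP => //; lia.
    exists y; first by apply: val_inj.
    rewrite uE /clet ry /cpar cy -/(cpar x).
    by move: tp; case: (cpar x) => //= ht; rewrite subnKC.
  move=> x; rewrite par => px; have := crow_lt x; rewrite px => -[e _].
  by rewrite -{1}(exp1n (cexp x)) ltn_exp2r // prime_gt1.
have us : same (bw n L h lam (scale p mu)) (infl cell u0).
  exact: (cword_same l_h mu_L pP lam_part mu_part lm_n bl).
have ThP : theta h (bw n L h lam (scale p mu)) (james (F := F) cell col u0).
  by apply: theta_same jt; rewrite same_sym.
have [le eq] := compare pP p_odd charF two_neq0 ab_n lm_n a_h b_L l_h mu_L HY HY' HV Hk HV' Hk' ThP.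
split=> // Lam; apply/eqP; rewrite eqn_leq le /=.
(* For k = 0 nothing is left. Otherwise the form is nonzero, and this is what produces an element of
   Lambda. *)
have [-> //|k0] := posnP k.
apply: eq.
have [f [g [ef eg nz]]] := theta_pos two_neq0 ab_n lm_n a_h b_L l_h mu_L HY HV Hk ThP k0.
(* James's functional is anchored at the inflated word, which has the content of the base word. *)
rewrite /cut (one_same _ us) in nz.
have [v [sv pv]] := james_neq0 p_odd charF two_neq0 bl ef eg nz.
apply: (del0_cnt l_h mu_L pP lam_part mu_part lm_n bl sv) => //.
exact: Lam (gam_del_inLambda l_h mu_L pP lam_part mu_part lm_n bl ab_n a_h b_L sv).
Qed.
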